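(* Let $R$ be a noetherian pseudocompact ring, $\sigma$ a topological automorphism of $R$, $\delta$ a continuous $\sigma$-nilpotent left $\sigma$-derivation of $R$, and assume that the skew power series ring $S = R[[t;\sigma,\delta]]$ is noetherian. Let $M$ be a left $S$-module which is finitely generated as an $R$-module. Then $\operatorname{Hom}_S(M,S)=0$, and for every $j\ge1$ $$\operatorname{Ext}^j_S(M,S) = \operatorname{Ext}^{j-1}_R(M,R)^{\sigma}$$ (natural isomorphism) as right $S$-modules, where $\operatorname{Ext}^{j-1}_R(M,R)^\sigma$ carries the right $S$-module structure described in the context.
   Context: All rings are unital; ''noetherian'' means left and right noetherian. A left pseudocompact ring $R$ is a topological ring which is Hausdorff and complete and has a fundamental system of open neighbourhoods of zero consisting of left ideals $L$ such that $R/L$ has finite length as an $R$-module (if $R$ is noetherian, it is then also right pseudocompact, with the $\mathrm{Jac}(R)$-adic topology). A pseudocompact left $R$-module is a Hausdorff complete topological $R$-module with a fundamental system of open neighbourhoods of zero consisting of submodules of finite colength; $\mathfrak{PM}(R)$ denotes the abelian category of these with continuous $R$-linear maps. Over a noetherian pseudocompact ring every finitely generated module has a unique pseudocompact topology. A left $\sigma$-derivation is an additive map $\delta:R\to R$ with $\delta(ab)=\delta(a)b+\sigma(a)\delta(b)$. For $k\ge 0$ let $\mathcal{A}_k$ be the set of all noncommutative monomials in $Y,Z,Z'$ with exactly $k$ factors $Y$, and $\mathcal{A}_{\ge l}=\bigcup_{k\ge l}\mathcal{A}_k$. $\delta$ is $\sigma$-nilpotent if for every $n\ge1$ there is $m\ge1$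 such that $M(\delta,\sigma,\sigma^{-1})(R)\subseteq \mathrm{Jac}(R)^n$ for all $M\in\mathcal{A}_{\ge m}$ (substitute $\delta,\sigma,\sigma^{-1}$ for $Y,Z,Z'$ and compose). The skew power series ring $S=R[[t;\sigma,\delta]]$ is the left $R$-module of all formal power series $\sum_{i\ge0}a_it^i$, $a_i\in R$, with the product topology and the continuous multiplication determined by $ta=\sigma(a)t+\delta(a)$; explicitly $\big(\sum_{j} a_jt^j\big)\big(\sum_{l} b_lt^l\big)=\sum_{m\ge0}\big(\sum_{n=0}^m\sum_{j\ge n}a_jM_{j-n,n}(\delta,\sigma)(b_{m-n})\big)t^m$, where $M_{k,l}(Y,Z)$ is the sum of all noncommutative monomials in $Y,Z$ with $k$ factors $Y$ and $l$ factors $Z$. It is a left and right pseudocompact ring, and every element also has a unique expansion $\sum_{i\ge 0} t^ia_i$. It is topologically free as left and as right $R$-module; pseudocompact $S$-modules are pseudocompact as $R$-modules. Right $S$-module structure on $\operatorname{Ext}^j_R(M,R)^\sigma$. For a finitely generated left $S$-module $N$ (pseudocompact over $S$ and hence over $R$), let $\operatorname{Hom}_{\mathfrak{PM}(R)}(N,R)^\sigma$ be $\operatorname{Hom}_{\mathfrak{PM}(R)}(N,R)$ with right $R$-action $f^a(m):=f(m)\sigma^{-1}(a)$. It becomes a right $S$-module by setting $f^t(m):=\sigma^{-1}\big(f(tm)-\delta(f(m))\big)$ and, for $x=\sum_{i\ge0}t^ia_i\in S$, $f^x(m):=\sum_{i\ge0}((f^{t^i})^{a_i})(m)$ (a convergent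 series in $R$); this is functorial in $N$. Given a resolution $P_\bullet\to M$ by finitely generated projective $S$-modules, it is also a projective resolution of $M$ in $\mathfrak{PM}(R)$, so the cohomology of $\operatorname{Hom}_{\mathfrak{PM}(R)}(P_\bullet,R)^\sigma$ carries a right $S$-module structure; when $M$ is finitely generated over $R$ this cohomology is $\operatorname{Ext}^\ast_R(M,R)$ (usual Ext groups) with right $R$-action twisted by $\sigma^{-1}$, and the resulting right $S$-module is denoted $\operatorname{Ext}^\ast_R(M,R)^\sigma$. *)

(* Defs.v *)
From HB Require Import structures.
From mathcomp Require Import all_boot all_order all_algebra ring_quotient.
From mathcomp Require Import boolp classical_sets functions filter topology.

Set Implicit Arguments.
Unset Strict Implicit.
Unset Printing Implicit Defensive.

Import GRing.Theory.

Local Open Scope classical_set_scope.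
Local Open Scope ring_scope.

(* Uniform continuity of the subtraction forces the uniformity to be the one
   of a topological abelian group, so that the library's Cauchy filters are the
   usual ones. *)
HB.mixin Record isUniformGroup M & Uniform M & GRing.Zmodule M := {
  sub_unif_continuous : unif_continuous (fun z : M * M => z.1 - z.2)
}.

#[short(type="uniformGroup")]
HB.structure Definition UniformGroup :=
  {M of Uniform M & GRing.Zmodule M & isUniformGroup M}.

#[short(type="uniformRing")]
HB.structure Definition UniformRing :=
  {R of UniformGroup R & GRing.PzRing R}.

#[short(type="uniformLmod")]
HB.structure Definition UniformLmod (A : pzRingType) :=
  {M of UniformGroup M & GRing.Lmodule A M}.

Section Modules.
Variable A : pzRingType.

Definition submodule (V : lmodType A) (L : set V) : Prop :=
  L 0 /\ forall (a : A) (u v : V), L u -> L v -> L (a *: u + v).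

Definition fg_submodule (V : lmodType A) (L : set V) : Prop :=
  exists (n : nat) (e : 'I_n -> V), (forall i, L (e i)) /\
    forall v, L v -> exists a : 'I_n -> A, v = \sum_i a i *: e i.

Definition finitely_generated (V : lmodType A) : Prop :=
  fg_submodule [set: V].

Definition noetherian_module (V : lmodType A) : Prop :=
  forall L : set V, submodule L -> fg_submodule L.

(* V / L has a composition series L = F 0 < F 1 < ... < F n = V. *)
Definition finite_colength (V : lmodType A) (L : set V) : Prop :=
  exists (n : nat) (F : nat -> set V),
    [/\ F 0%N = L, F n = setT,
        forall i, (i <= n)%N -> submodule (F i) &
        forall i, (i < n)%N -> F i `<` F i.+1 /\
          forall K : set V, submodule K -> F i `<=` K -> K `<=` F i.+1 ->
            K = F i \/ K = F i.+1].

Definition projective (P : lmodType A) : Prop :=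
  forall (U V : lmodType A) (p : {linear U -> V}) (f : {linear P -> V}),
    (forall v, exists u, p u = v) ->
    exists h : {linear P -> U}, forall x, p (h x) = f x.

Definition left_ideal (L : set A) : Prop := submodule (L : set A^o).

Definition maximal_left_ideal (L : set A) : Prop :=
  [/\ left_ideal L, L <> setT &
      forall K : set A, left_ideal K -> L `<=` K -> K = L \/ K = setT].

Definition jacobson : set A :=
  [set x | forall L : set A, maximal_left_ideal L -> L x].

Definition ideal_mul (I J : set A) : set A :=
  [set x | exists (n : nat) (a b : 'I_n -> A),
     [/\ forall i, I (a i), forall i, J (b i) & x = \sum_i a i * b i]].

Definition ideal_exp (I : set A) (n : nat) : set A :=
  iter n (fun K => ideal_mul K I) setT.

End Modules.

Definition noetherian_ring (A : pzRingType) : Prop :=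
  noetherian_module A^o /\ noetherian_module (A^c)^o.

Definition complete_group (M : uniformGroup) : Prop :=
  forall F : set_system M, ProperFilter F -> cauchy F ->
    exists x : M, F --> x.

Definition left_pseudocompact_ring (R : uniformRing) : Prop :=
  [/\ continuous (fun z : R * R => z.1 * z.2), hausdorff_space R,
      complete_group R &
      forall U : set R, nbhs 0 U -> exists L : set R,
        [/\ left_ideal L, open L, L `<=` U &
            finite_colength (L : set R^o)]].

Definition pseudocompact_module (A : uniformRing) (N : uniformLmod A) : Prop :=
  [/\ continuous (fun z : A * N => z.1 *: z.2), hausdorff_space N,
      complete_group N &
      forall U : set N, nbhs 0 U -> exists L : set N,
        [/\ submodule L, open L, L `<=` U & finite_colength L]].

Inductive letter := Yletter | Zletter | Z'letter.

Definition is_Y (l : letter) : bool := if l is Yletter then true else false.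

Section SkewDerivations.
Variables (R : uniformRing) (sigma sigma' : R -> R) (delta : R -> R).

Definition left_derivation : Prop :=
  forall a b : R, delta (a * b) = delta a * b + sigma a * delta b.

Definition letter_app (l : letter) : R -> R :=
  match l with
  | Yletter => delta
  | Zletter => sigma
  | Z'letter => sigma'
  end.

Definition sigma_nilpotent : Prop :=
  forall n : nat, (1 <= n)%N -> exists2 m : nat, (1 <= m)%N &
    forall w : seq letter, (m <= count is_Y w)%N ->
      forall a : R, ideal_exp (@jacobson R) n (foldr letter_app a w).

(* M_{k,l}(delta, sigma)(b); the words are encoded with true for Y and false
   for Z. *)
Definition monomial_sum (k l : nat) (b : R) : R :=
  \sum_(w : (k + l).-tuple bool | count id w == k)
    foldr (fun y : bool => if y then delta else sigma) b w.

End SkewDerivations.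

(* S is R[[t; sigma, delta]]: an element x is the series with coefficients
   coef x, C is the embedding of the constants, and the topology of S is the
   product topology. *)
Record skew_power_series (R S : uniformRing) (sigma delta : R -> R)
    (C : {rmorphism R -> S}) (t : S) (coef : S -> nat -> R) : Prop := {
  sps_bij : bijective coef ;
  sps_add : forall x y i, coef (x + y) i = coef x i + coef y i ;
  sps_top : forall U : set S, open U <->
    exists2 V : set (prod_topology (fun _ : nat => R)),
      open V & U = coef @^-1` V ;
  sps_C : forall a i, coef (C a) i = if i == 0%N then a else 0 ;
  sps_t : forall i, coef t i = if i == 1%N then 1 else 0 ;
  sps_mul : forall x y m,
    (fun N : nat => \sum_(n < m.+1) \sum_(n <= j < N)
       coef x j * monomial_sum sigma delta (j - n)%N n (coef y (m - n)%N))
      @ \oo --> coef (x * y) m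
}.

Definition resScalars (R S : pzRingType) (C : {rmorphism R -> S})
  (N : lmodType S) : Type := N.

Section Restriction.
Variables (R S : pzRingType) (C : {rmorphism R -> S}) (N : lmodType S).

HB.instance Definition _ := GRing.Zmodule.on (resScalars C N).

Definition resScalars_scale (a : R) (v : resScalars C N) : resScalars C N :=
  C a *: (v : N).

Fact resScalars_scaleA a b v :
  resScalars_scale a (resScalars_scale b v) = resScalars_scale (a * b) v.
Proof. by rewrite /resScalars_scale scalerA rmorphM. Qed.

Fact resScalars_scale1 : left_id 1 resScalars_scale.
Proof. by move=> v; rewrite /resScalars_scale rmorph1 scale1r. Qed.

Fact resScalars_scaleDr : right_distributive resScalars_scale +%R.
Proof. by move=> a u v; apply: scalerDr. Qed.

Fact resScalars_scaleDl v : {morph resScalars_scale^~ v : a b / a + b}.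
Proof. by move=> a b; rewrite /resScalars_scale rmorphD; apply: scalerDl. Qed.

HB.instance Definition _ := GRing.Zmodule_isLmodule.Build R (resScalars C N)
  resScalars_scaleA resScalars_scale1 resScalars_scaleDr resScalars_scaleDl.

End Restriction.

(* The cohomology of the complex of the groups D i of functions X i -> G, with
   the differentials f |-> f \o d i and with the zero group in degree -1. *)
Section Cohomology.
Variables (X : nat -> Type) (d : forall i, X i.+1 -> X i).
Variables (G : zmodType) (D : forall i, zmodClosed (X i -> G)).

Definition cocycle i : pred (X i -> G) :=
  fun f => (f \in D i) && `[< forall x, f (d x) = 0 >].

Fact cocycle_closed i : zmod_closed (@cocycle i).
Proof.
split=> [|f g].
  by apply/andP; split; [exact: rpred0 | apply/asboolP].
move=> /andP[Df /asboolP f0] /andP[Dg /asboolP g0].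
apply/andP; split; first exact: rpredB.
by apply/asboolP => x; rewrite -[LHS]/(f _ - g _) f0 g0 subrr.
Qed.

HB.instance Definition _ i :=
  GRing.isZmodClosed.Build (X i -> G) (@cocycle i) (@cocycle_closed i).

Record cocycles i := Cocycles {
  cocycle_fun :> X i -> G ;
  _ : cocycle_fun \in @cocycle i
}.

HB.instance Definition _ i := [isSub for @cocycle_fun i].
HB.instance Definition _ i := [Choice of cocycles i by <:].
HB.instance Definition _ i := [SubChoice_isSubZmodule of cocycles i by <:].

Definition coboundary_fun i : (X i -> G) -> Prop :=
  match i with
  | 0 => fun f => forall x, f x = 0
  | k.+1 => fun f => exists2 g, g \in D k & forall x, f x = g (d x)
  end.

Definition coboundary i : pred (cocycles i) :=
  fun f => `[< coboundary_fun f >].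

Fact coboundary_closed i : zmod_closed (@coboundary i).
Proof.
split=> [|f g].
  apply/asboolP; case: i => [//|k] /=.
  by exists 0; first exact: rpred0.
move=> /asboolP Bf /asboolP Bg; apply/asboolP.
case: i f g Bf Bg => [|k] f g /=.
  by move=> f0 g0 x; rewrite -[LHS]/(f x - g x) f0 g0 subrr.
move=> [f' Df f'E] [g' Dg g'E]; exists (f' - g'); first exact: rpredB.
by move=> x; rewrite -[LHS]/(f x - g x) f'E g'E.
Qed.

HB.instance Definition _ i :=
  GRing.isZmodClosed.Build (cocycles i) (@coboundary i)
    (@coboundary_closed i).

Definition cohomology i : zmodType :=
  Quotient.quot (GRing.ZmodClosed.clone (cocycles i) (@coboundary i) _).

Definition cohomology_class i (f : cocycles i) : cohomology i :=
  (\pi_(cohomology i) f)%qT.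

End Cohomology.


Section HomGroups.

Fact linear_sub (A : pzRingType) (U V : lmodType A) (f g : U -> V) :
  linear f -> linear g -> linear (f - g).
Proof.
move=> lf lg a u v; rewrite -[LHS]/(f _ - g _) lf lg -[(f - g) u]/(f u - g u).
by rewrite -[(f - g) v]/(f v - g v) scalerBr opprD addrACA.
Qed.

Definition lin_hom (A : pzRingType) (U V : lmodType A) : pred (U -> V) :=
  fun f => `[< linear f >].

Fact lin_hom_closed (A : pzRingType) (U V : lmodType A) :
  zmod_closed (@lin_hom A U V).
Proof.
split=> [|f g].
  by apply/asboolP => a u v; rewrite /= scaler0 addr0.
by move=> /asboolP lf /asboolP lg; apply/asboolP/linear_sub.
Qed.

HB.instance Definition _ (A : pzRingType) (U V : lmodType A) :=
  GRing.isZmodClosed.Build (U -> V) (@lin_hom A U V) (@lin_hom_closed A U V).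

Fact sub_continuous (M : uniformGroup) :
  continuous (fun z : M * M => z.1 - z.2).
Proof.
move=> z; apply/cvg_entourageP => E entE.
have := @nbhs_entourage _ z _ (sub_unif_continuous E entE).
by apply: filterS => y; rewrite /xsection /= inE.
Qed.

Variables (R S : uniformRing) (C : {rmorphism R -> S}).

(* Hom in PM(R) from the pseudocompact S-module N to R *)
Definition cont_hom (N : uniformLmod S) : pred (N -> R) :=
  fun f => `[< linear (f : resScalars C N -> R^o) /\ continuous f >].

Fact cont_hom_closed (N : uniformLmod S) : zmod_closed (@cont_hom N).
Proof.
split=> [|f g].
  apply/asboolP; split; last by move=> x; apply: cvg_cst.
  by move=> a u v; rewrite /= scaler0 addr0.
move=> /asboolP[lf cf] /asboolP[lg cg]; apply/asboolP; split.
  exact: (linear_sub lf lg).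
move=> x; apply: (@continuous_comp _ _ _ (fun y => (f y, g y))
  (fun z : R * R => z.1 - z.2)).
  by apply: cvg_pair => /=; [exact: cf | exact: cg].
exact: sub_continuous.
Qed.

HB.instance Definition _ (N : uniformLmod S) :=
  GRing.isZmodClosed.Build (N -> R) (@cont_hom N) (@cont_hom_closed N).

End HomGroups.

Definition is_projective_resolution (A : pzRingType) (M : lmodType A)
    (P : nat -> lmodType A) (d : forall i, {linear P i.+1 -> P i})
    (aug : {linear P 0%N -> M}) : Prop :=
  [/\ forall i, projective (P i),
      forall m, exists p, aug p = m,
      forall p, aug p = 0 <-> exists q, p = d 0%N q &
      forall i p, d i p = 0 <-> exists q, p = d i.+1 q].

Record projResolution (A : pzRingType) (M : lmodType A) := ProjResolution {
  pr_obj :> nat -> lmodType A ;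
  pr_d : forall i, {linear pr_obj i.+1 -> pr_obj i} ;
  pr_aug : {linear pr_obj 0%N -> M} ;
  pr_proj : is_projective_resolution pr_d pr_aug
}.

(* Each term is finitely generated and carries its pseudocompact topology. *)
Record pcResolution (S : uniformRing) (M : lmodType S) := PcResolution {
  pcr_obj :> nat -> uniformLmod S ;
  pcr_d : forall i, {linear pcr_obj i.+1 -> pcr_obj i} ;
  pcr_aug : {linear pcr_obj 0%N -> M} ;
  pcr_proj : @is_projective_resolution S M pcr_obj pcr_d pcr_aug ;
  pcr_fg : forall i, finitely_generated (pcr_obj i) ;
  pcr_pc : forall i, pseudocompact_module (pcr_obj i)
}.

Definition pc_projResolution (S : uniformRing) (M : lmodType S)
    (P : pcResolution M) : projResolution M :=
  ProjResolution (pcr_proj P).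

(* Ext^i_A(M, N), computed from the projective resolution Q of M *)
Section Ext.
Variables (A : pzRingType) (M : lmodType A) (Q : projResolution M).
Variable N : lmodType A.

Definition Ext_cochains k : zmodClosed (Q k -> N) :=
  GRing.ZmodClosed.clone (Q k -> N) (@lin_hom A (Q k) N) _.

Definition Ext_cocycles i : zmodType := cocycles (@pr_d A M Q) Ext_cochains i.

Definition Ext i : zmodType := cohomology (@pr_d A M Q) Ext_cochains i.

Definition Ext_class i (f : Ext_cocycles i) : Ext i := cohomology_class f.

End Ext.

Definition ExtS (S : uniformRing) (M : lmodType S) (P : pcResolution M)
  (i : nat) : zmodType := Ext (pc_projResolution P) S^o i.

(* The cohomology of Hom_PM(R)(P, R), with the underlying group of
   Ext^i_R(M, R)^sigma *)
Section ExtPM.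
Variables (R S : uniformRing) (C : {rmorphism R -> S}).
Variables (M : lmodType S) (P : pcResolution M).

Definition ExtPM_cochains k : zmodClosed (P k -> R) :=
  GRing.ZmodClosed.clone (P k -> R) (@cont_hom R S C (P k)) _.

Definition ExtPM_cocycles i : zmodType :=
  cocycles (@pcr_d S M P) ExtPM_cochains i.

Definition ExtPM i : zmodType := cohomology (@pcr_d S M P) ExtPM_cochains i.

Definition ExtPM_class i (f : ExtPM_cocycles i) : ExtPM i :=
  cohomology_class f.

End ExtPM.

Section TwistedAction.
Variables (R S : uniformRing) (sigma' delta : R -> R).
Variables (C : {rmorphism R -> S}) (t : S) (N : lmodType S).

Definition right_expansion (x : S) (a : nat -> R) : Prop :=
  (fun n : nat => \sum_(i < n) t ^+ i * C (a i)) @ \oo --> x.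

Definition twist_t (f : N -> R) : N -> R :=
  fun m => sigma' (f (t *: m) - delta (f m)).

Definition twist_const (f : N -> R) (a : R) : N -> R :=
  fun m => f m * sigma' a.

(* g = f^x *)
Definition twisted_action (x : S) (f g : N -> R) : Prop :=
  exists2 a : nat -> R, right_expansion x a &
    forall m, (fun n : nat =>
      \sum_(i < n) twist_const (iter i twist_t f) (a i) m) @ \oo --> g m.

End TwistedAction.

(* Phi is a morphism of right S-modules; the source has the action
   f |-> (m |-> f m * x) induced by the right multiplications of S, and the
   target has the action f |-> f^x. *)
Definition right_S_linear (R S : uniformRing) (sigma' delta : R -> R)
    (C : {rmorphism R -> S}) (t : S) (M : lmodType S) (P : pcResolution M)
    (i j : nat) (Phi : ExtS P i -> ExtPM C P j) : Prop :=
  forall (x : S) (f f' : Ext_cocycles (pc_projResolution P) S^o i)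
    (g : ExtPM_cocycles C P j),
    (forall p, f' p = (f p : S) * x) ->
    Phi (Ext_class f) = ExtPM_class g ->
    exists2 g' : ExtPM_cocycles C P j,
      twisted_action sigma' delta C t x g g' &
      Phi (Ext_class f') = ExtPM_class g'.

Definition chain_map_over (A : pzRingType) (M M' : lmodType A)
    (h : M -> M') (P : projResolution M) (P' : projResolution M')
    (c : forall i, {linear P i -> P' i}) : Prop :=
  (forall p, pr_aug P' (c 0%N p) = h (pr_aug P p)) /\
  (forall i p, pr_d P' i (c i.+1 p) = c i (pr_d P i p)).

(* A comparison map c from a projective resolution Q of M over R induces an
   isomorphism from the cohomology of Hom_PM(R)(P, R) to the usual Ext group. *)
Definition restricts_to_Ext (R S : uniformRing) (C : {rmorphism R -> S})
    (M : lmodType S) (P : pcResolution M) (j : nat) : Prop :=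
  forall (Q : projResolution (resScalars C M))
    (c : forall i, {linear Q i -> resScalars C (P i)}),
    (forall q, pcr_aug P (c 0%N q) = pr_aug Q q) ->
    (forall i q, pcr_d P i (c i.+1 q) = c i (pr_d Q i q)) ->
    exists2 k : {additive ExtPM C P j -> Ext Q R^o j}, bijective k &
      forall (g : ExtPM_cocycles C P j) (g' : Ext_cocycles Q R^o j),
        (forall q, g' q = g (c j q)) -> k (ExtPM_class g) = Ext_class g'.

(* Main.v *)
(* Let [T] be the operator f |-> f^t. An S-linear map f : N -> S is the same as
   the sequence of its coefficient functions f_n : N -> R, which are R-linear
   with T f_0 = 0 and T f_(n+1) = f_n. On a finitely generated projective module
   [T] is surjective on the continuous functionals, whence an exact sequence of
   complexes
     0 -> Hom_S(P, S) -> lim_T Hom(P, R) -> Hom(P, R) -> 0,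
   whose connecting homomorphism is the isomorphism; so the point is that
   lim_T Hom(P, R) is acyclic.

   The cohomology of Hom(P, R) is noetherian over R, being computed by a
   resolution of M by free R-modules of finite rank: the mapping cone of a
   comparison map consists of linearly compact projective modules, and the open
   mapping theorem for these splits it continuously. In a T-compatible sequence
   of classes f_n, a relation f_N = \sum_(l < b) f_l c_l therefore holds for
   every N; as f_l is an iterate of T at f_N, it says that f_N = f_N x with x
   divisible by a high power of t, and 1 - x is invertible because delta is
   sigma-nilpotent. Hence f_N = 0, so lim vanishes; lim^1 vanishes because the
   equations b_n - T b_(n+1) = z_n can be solved on the finitely many generators
   of the cohomology. The same argument with M in place of P and without
   cohomology gives Hom_S(M, S) = 0. *)
Require Import Defs.
From HB Require Import structures.
From mathcomp Require Import all_boot all_order all_algebra ring_quotient.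
From mathcomp Require Import mathcomp_extra boolp classical_sets functions filter topology.

Set Implicit Arguments.
Unset Strict Implicit.
Unset Printing Implicit Defensive.

Import GRing.Theory.

Local Open Scope classical_set_scope.
Local Open Scope ring_scope.

(** * Linearly compact modules *)

(** [sigma_nilpotent] is measured in powers of the Jacobson radical, whereas the topology of [R] is
    given by open left ideals of finite colength. The two meet in the intersection of the open
    maximal left ideals: it contains the Jacobson radical, is stable under [sigma] and [sigma'],
    and, [R] being noetherian, its powers are open and form a base at zero. From then on the
    estimates run over the sequence [J n] of these powers. They rest on one count: in an iterate of
    [T], or in [t ^+ n * x], each step either shifts an index or contributes a letter [delta], and
    only boundedly many shifts can end at a given index.

    The terms of [P] are projective over [S], but over [R] they are only known as continuous
    summands of countable products of copies of [R], so that algebraic exactness says nothing about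
    continuous functionals. Lifts of continuous maps are built from preimages of the unit vectors,
    and the open mapping theorem allows these preimages to be chosen tending to zero. *)

Section Submodules.
Variables (A : pzRingType) (V : lmodType A).
Implicit Types (K L : set V).

Lemma submod0 L : submodule L -> L 0. Proof. by case. Qed.

Lemma submodD L u v : submodule L -> L u -> L v -> L (u + v).
Proof. by move=> [_ sL] Lu Lv; rewrite -[u]scale1r; apply: sL. Qed.

Lemma submodZ L a u : submodule L -> L u -> L (a *: u).
Proof. by move=> [L0 sL] Lu; rewrite -[_ *: _]addr0; apply: sL. Qed.

Lemma submodN L u : submodule L -> L u -> L (- u).
Proof. by move=> sL Lu; rewrite -scaleN1r; apply: submodZ. Qed.

Lemma submodB L u v : submodule L -> L u -> L v -> L (u - v).
Proof. by move=> sL Lu Lv; apply: submodD => //; apply: submodN. Qed.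

Lemma submodBC L u v : submodule L -> L (u - v) -> L (v - u).
Proof. by move=> sL /(submodN sL); rewrite opprB. Qed.

Lemma submod_sum L (I : Type) (r : seq I) (P : pred I) (f : I -> V) :
  submodule L -> (forall i, P i -> L (f i)) -> L (\sum_(i <- r | P i) f i).
Proof.
move=> sL Lf; apply: (big_ind L) => //; first exact: submod0.
by move=> u v; apply: submodD.
Qed.

Lemma submodI K L : submodule K -> submodule L -> submodule (K `&` L).
Proof.
move=> sK sL; split; first by split; apply: submod0.
by move=> a u v [Ku Lu] [Kv Lv]; split; [apply: sK.2 | apply: sL.2].
Qed.

Definition sum_sub K L : set V := [set x | exists2 y, K y & L (x - y)].

Lemma submod_sum_sub K L : submodule K -> submodule L -> submodule (sum_sub K L).
Proof.
move=> sK sL; split; first by exists 0; rewrite ?subr0; apply: submod0.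
move=> a u v [x Kx Lx] [y Ky Ly]; exists (a *: x + y); first exact: sK.2.
by rewrite opprD addrACA -scalerBr; apply: sL.2.
Qed.

Lemma sum_subl K L : submodule L -> K `<=` sum_sub K L.
Proof. by move=> sL x Kx; exists x => //; rewrite subrr; apply: submod0. Qed.

Lemma sum_subr K L : submodule K -> L `<=` sum_sub K L.
Proof. by move=> sK x Lx; exists 0; rewrite ?subr0 //; apply: submod0. Qed.

Lemma sum_subSl K K' L : K `<=` K' -> sum_sub K L `<=` sum_sub K' L.
Proof. by move=> KK' x [y /KK' K'y Ly]; exists y. Qed.

End Submodules.

Lemma submod_preimage (A : pzRingType) (V W : lmodType A) (f : V -> W)
  (L : set W) : linear f -> submodule L -> submodule (f @^-1` L).
Proof.
move=> lf sL; have f0 : f 0 = 0.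
  by have := lf (-1) 0 0; rewrite scaler0 addr0 scaleN1r addNr.
split; first by rewrite /= f0; apply: submod0.
by move=> a u v Lu Lv; rewrite /= lf; apply: sL.2.
Qed.

Definition down_directed (T : Type) (W : set (set T)) :=
  forall K L, W K -> W L -> exists2 M, W M & M `<=` K `&` L.

Section Artinian.
Variable A : pzRingType.

(* For directed families the descending chain condition on [V / L] gives a
   least element. *)
Definition artinian_quotient (V : lmodType A) (L : set V) :=
  forall W : set (set V), W !=set0 ->
    (forall K, W K -> submodule K /\ L `<=` K) -> down_directed W ->
    exists2 K, W K & forall K', W K' -> K `<=` K'.

(** Serves for families whose members do not contain [L], or live in another module: only the
    images, such as [K + L], have to contain [L]. *)
Lemma artinian_image (V V' : lmodType A) (L : set V) (F : set V' -> set V)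
    (W : set (set V')) :
  artinian_quotient L -> W !=set0 -> down_directed W ->
  (forall K, W K -> submodule (F K) /\ L `<=` F K) ->
  (forall K K', W K -> W K' -> K `<=` K' -> F K `<=` F K') ->
  exists2 K, W K & forall K', W K' -> F K `<=` F K'.
Proof.
move=> aL [K0 WK0] dW FW Fmono.
have [|_ [K WK <-]|_ _ [K WK <-] [K' WK' <-]|_ [K WK <-] minK] :=
  aL [set F K | K in W].
- by exists (F K0), K0.
- exact: FW.
- have [M WM MKK'] := dW _ _ WK WK'; exists (F M); first by exists M.
  by move=> x FMx; split; apply: (Fmono M) => // y /MKK' [].
by exists K => // K' WK'; apply: minK; exists K'.
Qed.

(** [V'] modulo the preimage of [L] embeds in [V / L], and a submodule [K] containing that preimage
    is determined by [f K + L]. *)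
Lemma artinian_preimage (V V' : lmodType A) (f : V' -> V) (L : set V) :
  linear f -> submodule L -> artinian_quotient L ->
  artinian_quotient (f @^-1` L).
Proof.
move=> lf sL aL W W0 sW dW.
have f0 : f 0 = 0.
  by have := lf (-1) 0 0; rewrite scaler0 addr0 scaleN1r addNr.
have fB x y : f (x - y) = f x - f y.
  by rewrite -[- y]scaleN1r addrC lf scaleN1r addrC.
have [|K K' WK WK' KK'|K WK minK] :=
  @artinian_image V V' L (fun K => sum_sub (f @` K) L) W aL W0 dW.
- move=> K /sW [sK _]; have sfK : submodule (f @` K).
    split; first by exists 0; rewrite ?f0 //; apply: submod0.
    move=> a _ _ [x Kx <-] [y Ky <-]; exists (a *: x + y); last by rewrite lf.
    exact: sK.2.
  by split; [apply: submod_sum_sub | apply: sum_subr].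
- by apply: sum_subSl => _ [x /KK' K'x <-]; exists x.
exists K => // K' WK' x Kx.
have /(minK K' WK') [_ [y K'y <-] Lxy] : sum_sub (f @` K) L (f x).
  by apply: sum_subl => //; exists x.
rewrite -(subrK y x); have [sK' LK'] := sW _ WK'.
by apply: submodD => //; apply: LK'; rewrite /= fB.
Qed.

(* [K] is recovered from [K + L1] and [K /\ L1]. *)
Lemma modular_sub (V : lmodType A) (L1 K K' : set V) :
  submodule L1 -> submodule K -> submodule K' -> K' `<=` K ->
  sum_sub K L1 `<=` sum_sub K' L1 -> K `&` L1 `<=` K' `&` L1 -> K `<=` K'.
Proof.
move=> sL1 sK sK' K'K S I x Kx.
have /S [y K'y L1xy] : sum_sub K L1 x by exact: sum_subl.
have [K'xy _] : (K' `&` L1) (x - y).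
  by apply: I; split => //; apply: submodB => //; exact: K'K.
by rewrite -(subrK y x); apply: submodD.
Qed.

Lemma artinian_sub (V : lmodType A) (L L' : set V) :
  L `<=` L' -> artinian_quotient L -> artinian_quotient L'.
Proof.
move=> LL' aL W W0 sW dW; apply: aL => // K /sW [sK L'K].
by split => // x /LL' /L'K.
Qed.

(** The quotient by the intersection is an extension of [V / L1] by a submodule of [V / L2]. Least
    members are found separately for [K + L1] and for [(K /\ L1) + L2], and the modular law combines
    them. *)
Lemma artinian_setI (V : lmodType A) (L1 L2 : set V) :
  submodule L1 -> submodule L2 ->
  artinian_quotient L1 -> artinian_quotient L2 ->
  artinian_quotient (L1 `&` L2).
Proof.
move=> s1 s2 a1 a2 W W0 sW dW.
have [|K K' WK WK' KK'|K1 WK1 min1] :=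
  @artinian_image V V L1 (fun K => sum_sub K L1) W a1 W0 dW.
- move=> K /sW [sK _].
  by split; [apply: submod_sum_sub | apply: sum_subr].
- exact: sum_subSl.
have [|K K' WK WK' KK'|K2 WK2 min2] :=
  @artinian_image V V L2 (fun K => sum_sub (K `&` L1) L2) W a2 W0 dW.
- move=> K /sW [sK _].
  have sI := submodI sK s1.
  by split; [apply: submod_sum_sub | apply: sum_subr].
- by apply: sum_subSl => x [/KK' K'x L1x].
have [K3 WK3 sub3] := dW _ _ WK1 WK2.
(* [K'] and [K3] need not be comparable; the modular law is applied to [K3] and a common lower bound
   [K4]. *)
exists K3 => // K' WK'; have [K4 WK4 sub4] := dW _ _ WK' WK3.
have [sK3 _] := sW _ WK3; have [sK4 LK4] := sW _ WK4.
suff : K3 `<=` K4 by move=> h x /h /sub4 [].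
apply: (modular_sub s1) => //; first by move=> x /sub4 [].
  move=> x [y /sub3 [K1y _] L1xy].
  by apply: (min1 K4 WK4); exists y.
move=> x [/sub3 [_ K2x] L1x].
have /(min2 K4 WK4) [y [K4y L1y] L2xy] : sum_sub (K2 `&` L1) L2 x.
  exact: sum_subl.
split => //; rewrite -(subrK y x); apply: submodD => //.
by apply: LK4; split => //; apply: submodB.
Qed.

(** Descending induction along the composition series: the step from [F i.+1] to [F i] compares
    [K + F i.+1] and, by simplicity of the factor, leaves two possibilities for the intersection of
    [K] with [F i.+1]. *)
Lemma finite_colength_artinian (V : lmodType A) (L : set V) :
  finite_colength L -> artinian_quotient L.
Proof.
move=> [n [F [F0 Fn sF stepF]]]; rewrite -F0.
suff H k : (k <= n)%N -> artinian_quotient (F (n - k)%N).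
  by have := H n (leqnn _); rewrite subnn.
elim: k => [_|k IHk ltkn].
  rewrite subn0 Fn => W [K WK] sW dW; exists K => // K' WK' x _.
  by have [_ LK'] := sW _ WK'; apply: LK'.
have {}IHk := IHk (ltnW ltkn); set i := (n - k.+1)%N.
have iE : (n - k)%N = i.+1 by rewrite /i subnSK.
have ltin : (i < n)%N by rewrite /i -iE leq_subr.
rewrite iE in IHk; have [_ simple] := stepF i ltin.
have si1 := sF _ ltin; have [[FF1 _] _] := stepF i ltin.
move=> W W0 sW dW.
have [|K K' WK WK' KK'|K1 WK1 min1] :=
  @artinian_image V V (F i.+1) (fun K => sum_sub K (F i.+1)) W IHk W0 dW.
- move=> K /sW [sK _].
  by split; [apply: submod_sum_sub | apply: sum_subr].
- exact: sum_subSl.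
have I2 K : W K -> K `&` F i.+1 = F i \/ K `&` F i.+1 = F i.+1.
  move=> /sW [sK FK]; apply: simple; first exact: submodI.
    by move=> x Fx; split; [apply: FK | apply: FF1].
  by move=> x [].
(* If some member meets [F i.+1] in [F i], so does every smaller one. Otherwise all members contain
   [F i.+1], and being least for [K + F i.+1] is enough. *)
have [[K2 [WK2 E2]]|H2] := pselect (exists K, W K /\ K `&` F i.+1 = F i).
  have [K3 WK3 sub3] := dW _ _ WK1 WK2.
  exists K3 => // K' WK'; have [K4 WK4 sub4] := dW _ _ WK' WK3.
  have [sK3 _] := sW _ WK3; have [sK4 LK4] := sW _ WK4.
  suff : K3 `<=` K4 by move=> h x /h /sub4 [].
  apply: (modular_sub si1) => //; first by move=> x /sub4 [].
    by move=> x [y /sub3 [K1y _] L1xy]; apply: (min1 K4 WK4); exists y.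
  move=> x [/sub3 [_ K2x] L1x]; split => //; apply: LK4.
  by rewrite -E2.
exists K1 => // K' WK'; have [K4 WK4 sub4] := dW _ _ WK' WK1.
have [sK1 _] := sW _ WK1; have [sK4 LK4] := sW _ WK4.
suff : K1 `<=` K4 by move=> h x /h /sub4 [].
apply: (modular_sub si1) => //; first by move=> x /sub4 [].
  exact: min1.
move=> x [_ Fx].
have [E|->] := I2 _ WK4; last by [].
by case: H2; exists K4.
Qed.

End Artinian.

Section LinearCompactness.
Variables (A : pzRingType) (V : lmodType A) (B : set (set V)).

(** Surjectivity of [V] onto the inverse limit of the [V / L]: the cosets [c L + L] are compatible,
    and [x] is a point common to all of them. *)
Definition lin_complete :=
  forall c : set V -> V,
    (forall L L', B L -> B L' -> L' `<=` L -> L (c L - c L')) ->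
    exists x, forall L, B L -> L (x - c L).

Definition lin_closed (K : set V) :=
  forall x, (forall L, B L -> exists2 z, K z & L (x - z)) -> K x.

(** The nonempty sets of this kind are the cosets of submodules. No base point is fixed, so the
    notion passes to intersections. *)
Definition affine_set (K : set V) :=
  forall (a : A) x y z, K x -> K y -> K z -> K (a *: (x - y) + z).

Definition linearly_compact :=
  forall F : set (set V), F !=set0 -> down_directed F ->
    (forall K, F K -> [/\ K !=set0, affine_set K & lin_closed K]) ->
    exists x, forall K, F K -> K x.

Hypothesis subB : forall L, B L -> submodule L.
Hypothesis artB : forall L, B L -> artinian_quotient L.
Hypothesis completeB : lin_complete.

Lemma lin_closedI K L :
  lin_closed K -> lin_closed L -> lin_closed (K `&` L).
Proof.
move=> cK cL x H; split; [apply: cK|apply: cL] => M /H [z [Kz Lz] Mz];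
by exists z.
Qed.

Lemma affine_setI K L : affine_set K -> affine_set L -> affine_set (K `&` L).
Proof.
move=> aK aL a x y z [? ?] [? ?] [? ?].
by split; [apply: aK | apply: aL].
Qed.

Lemma affine_translate L a :
  submodule L -> affine_set [set x | L (x - a)].
Proof.
move=> sL b x y z /= Lx Ly Lz; rewrite -addrA; case: (sL) => _; apply => //.
have -> : x - y = (x - a) - (y - a) by rewrite opprB addrA subrK.
exact: submodB.
Qed.

Lemma translate_closed L K a :
  B L -> submodule K -> L `<=` K -> lin_closed [set x | K (x - a)].
Proof.
move=> BL sK LK x /(_ _ BL) [z Kz /LK Kxz] /=.
by rewrite -(subrK z x) -addrA; apply: submodD.
Qed.

Definition differences (K : set V) : set V :=
  [set d | exists x y, [/\ K x, K y & d = x - y]].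

Lemma submod_differences K :
  K !=set0 -> affine_set K -> submodule (differences K).
Proof.
move=> [k Kk] aK; split; first by exists k, k; rewrite subrr.
move=> a _ _ [x [y [Kx Ky ->]]] [z [w [Kz Kw ->]]].
by exists (a *: (x - y) + z), w; rewrite addrA; split => //; apply: aK.
Qed.

(* By Zorn the family may be assumed maximal; minimality of the images in the
   artinian quotients [V / L] then forces it to contain a coset of each [L],
   i.e. to be Cauchy. *)
Theorem complete_linearly_compact : linearly_compact.
Proof.
move=> F0 F00 dF0 gF0.
pose good (F : set (set V)) := down_directed F /\
  forall K, F K -> [/\ K !=set0, affine_set K & lin_closed K].
(* Adjoining [F0] inside the predicate keeps the empty chain harmless: its union corresponds to [F0]
   itself. *)
pose P := [set F | good (F `|` F0)].
have [C CP totC|F [[dF gF] maxF]] := @Zorn_bigcup (set V) P.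
  split.
    move=> K L [[X CX XK]|F0K] [[Y CY YL]|F0L].
    - have [XY|YX] := totC X Y CX CY.
        have [dY _] := CP _ CY.
        have [||M [YM|F0M] MKL] := dY K L; try by left; auto.
          by exists M => //; left; exists Y.
        by exists M => //; right.
      have [dX _] := CP _ CX.
      have [||M [XM|F0M] MKL] := dX K L; try by left; auto.
        by exists M => //; left; exists X.
      by exists M => //; right.
    - have [dX _] := CP _ CX.
      have [||M [XM|F0M] MKL] := dX K L; [by left|by right| |].
        by exists M => //; left; exists X.
      by exists M => //; right.
    - have [dY _] := CP _ CY.
      have [||M [YM|F0M] MKL] := dY K L; [by right|by left| |].
        by exists M => //; left; exists Y.
      by exists M => //; right.
    by have [M F0M MKL] := dF0 _ _ F0K F0L; exists M => //; right.
  by move=> K [[X CX XK]|/gF0 //]; have [_] := CP _ CX; apply; left.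
set G := F `|` F0 in dF gF.
have GF : G `<=` F.
  apply: contrapT => nGF; apply: (maxF G).
    by split => [x|]; [left | exact: nGF].
  by rewrite /P /= /G -setUA setUid.
have G0 : G !=set0 by case: F00 => K F0K; exists K; right.
have cosets L : B L -> exists a : V, exists2 K, G K & K `<=` [set x | L (x - a)].
  move=> BL; have sL := subB BL.
  have [|K K' GK GK' KK'|K GK minK] := @artinian_image A V V L
      (fun K => sum_sub (differences K) L) G (artB BL) G0 dF.
  - move=> K /gF [K0 aK _]; have sD := submod_differences K0 aK.
    by split; [apply: submod_sum_sub | apply: sum_subr].
  - by apply: sum_subSl => _ [x [y [/KK' ? /KK' ? ->]]]; exists x, y.
  have [[a Ka] aK cK] := gF K GK.
  pose tr M := M `&` [set x | L (x - a)].
  (* A member [N] below [M] and [K] has, by the choice of [K], the same differences modulo [L] as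
     [K]. So a point [b] of [N] can be moved within [N] to a point congruent to [a] modulo [L]. *)
  have trne M : G M -> tr M !=set0.
    move=> GM; have [N GN NMK] := dF _ _ GM GK.
    have [[b Nb] aN _] := gF _ GN.
    have [|_ [x [y [Nx Ny ->]]] Ld] := minK N GN (a - b).
      apply: sum_subl => //; exists a, b; split => //.
      by case: (NMK _ Nb).
    have Nz : N (1 *: (x - y) + b) by exact: aN.
    exists (1 *: (x - y) + b); split; first by case: (NMK _ Nz).
    rewrite /= scale1r -addrA; move: Ld; rewrite -opprB => /(submodN sL).
    by rewrite opprK opprB addrC addrC.
  exists a, (tr K); last by move=> x [].
  left; apply: contrapT => nF.
  apply: (maxF (F `|` [set tr M | M in G])).
    split; first by move=> x; left.
    by move=> h; apply: nF; apply: h; right; exists K.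
  have dtr : down_directed (G `|` [set tr M | M in G]).
    move=> M N [GM|[M' GM' <-]] [GN|[N' GN' <-]].
    - by have [Q GQ QMN] := dF _ _ GM GN; exists Q => //; left.
    - have [Q GQ QMN] := dF _ _ GM GN'; exists (tr Q); first by right; exists Q.
      by move=> x [/QMN [? ?] ?].
    - have [Q GQ QMN] := dF _ _ GM' GN; exists (tr Q); first by right; exists Q.
      by move=> x [/QMN [? ?] ?].
    - have [Q GQ QMN] := dF _ _ GM' GN'; exists (tr Q); first by right; exists Q.
      by move=> x [/QMN [? ?] ?].
  rewrite /P /= setUAC -/G; split => // M [/gF //|[N GN <-]].
  have [N0 aN cN] := gF _ GN; split; first exact: trne.
    by apply: affine_setI => //; apply: affine_translate.
  by apply: lin_closedI => //; exact: (@translate_closed L L a BL sL).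
have /choice [c cP] : forall L, exists a : V, B L ->
    exists2 K, G K & K `<=` [set x | L (x - a)].
  move=> L; have [BL|nBL] := pselect (B L); last by exists 0.
  by have [a aP] := cosets L BL; exists a.
have [L L' BL BL' L'L|x xP] := completeB (c := c).
  have [K GK KL] := cP L BL; have [K' GK' KL'] := cP L' BL'.
  have [M GM MKK] := dF _ _ GK GK'; have [[z Mz] _ _] := gF _ GM.
  have [/KL /= Lz /KL' /= /L'L Lz'] := MKK _ Mz.
  have -> : c L - c L' = (z - c L') - (z - c L).
    by rewrite opprB [RHS]addrC addrA subrK.
  by apply: submodB => //; exact: subB.
exists x => K F0K; have GK : G K by right.
have [_ _ cK] := gF _ GK; apply: cK => L BL.
have [K' GK' K'L] := cP L BL; have [M GM MKK] := dF _ _ GK GK'.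
have [[z Mz] _ _] := gF _ GM; have [Kz /K'L /= Lz] := MKK _ Mz.
exists z => //; have -> : x - z = (x - c L) - (z - c L).
  by rewrite opprB addrA subrK.
by apply: submodB; [exact: subB | exact: xP | exact: Lz].
Qed.

End LinearCompactness.

(** * Neighbourhoods of zero and Cauchy filters in uniform groups *)

Section UniformGroups.
Variable M : uniformGroup.
Implicit Types (U : set M) (x y : M).

Lemma nbhs0_entourage (E : set (M * M)) : entourage E ->
  exists2 U : set M, nbhs 0 U & forall x y, U (x - y) -> E (x, y).
Proof.
move=> /sub_unif_continuous [[E1 E2] [/= entE1 entE2] sub].
exists [set u | E1^-1%relation (0, u)].
  have := nbhs_entourage (0 : M) (entourage_inv entE1).
  by apply: filterS => u; rewrite /xsection /= inE.
(* Subtracting the pair [(- y, - y)] from [(x - y, 0)] gives [(x, y)]; the former lies in every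
   entourage. *)
move=> x y E1xy; have [] := sub ((x - y, 0), (- y, - y)).
  by split => //=; apply: entourage_refl.
by move=> [[a b] [c d]] /= Eabcd [ea ec eb ed]; move: Eabcd; rewrite /= ea ec eb ed opprK subrK add0r.
Qed.

Lemma entourage_nbhs0 U : nbhs 0 U -> entourage [set z | U (z.1 - z.2)].
Proof.
move=> /nbhsP [E entE EU].
have [[E1 E2] [/= entE1 entE2] sub] := sub_unif_continuous E entE.
apply: filterS (entourage_inv entE1) => -[x y] /= E1xy.
have [|[[a b] [c d]] /= Eabcd [ya yb xc yd]] := sub ((y, x), (y, y)).
  by split => //=; apply: entourage_refl.
apply: EU; rewrite /xsection /= inE; move: Eabcd; rewrite ya yb xc yd subrr.
by [].
Qed.

Lemma nbhs_translate x U : nbhs x U <-> nbhs 0 [set y | U (x + y)].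
Proof.
split=> [/nbhsP [E entE EU]|H].
  have [V V0 VE] := nbhs0_entourage (entourage_inv entE).
  apply: filterS V0 => y Vy; apply: EU; rewrite /xsection /= inE.
  by apply: (VE (x + y) x); rewrite addrC addKr.
have := nbhs_entourage x (entourage_inv (entourage_nbhs0 H)).
apply: filterS => y; rewrite /xsection /= inE /=.
by rewrite addrC subrK.
Qed.

Variable B : set (set M).
Hypothesis B_sub : forall L, B L -> forall x y, L x -> L y -> L (x - y).
Hypothesis B_nbhs : forall L, B L -> nbhs 0 L.
Hypothesis B_base : forall U, nbhs 0 U -> exists2 L, B L & L `<=` U.

(** The cosets [c L + L] generate a Cauchy filter; its limit is congruent to [c L] modulo each [L]
    because [L] is itself a neighbourhood of zero. *)
Lemma coherent_limit (c : set M -> M) : complete_group M ->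
  (forall L L', B L -> B L' -> L' `<=` L -> L (c L - c L')) ->
  exists x, forall L, B L -> L (x - c L).
Proof.
move=> cM cc.
have B0 L : B L -> L 0 by move/B_nbhs/nbhs_singleton.
have BN L x : B L -> L x -> L (- x).
  by move=> BL Lx; rewrite -sub0r; apply: B_sub => //; apply: B0.
have BD L x y : B L -> L x -> L y -> L (x + y).
  by move=> BL Lx Ly; rewrite -[y]opprK; apply: B_sub => //; apply: BN.
pose F := filter_from B (fun L => [set y | L (y - c L)]).
have FF : Filter F.
  apply: filter_from_filter.
    by have [L BL _] := B_base (@filterT _ (nbhs (0 : M)) _); exists L.
  move=> K L BK BL.
  have [N BN' NKL] := B_base (filterI (B_nbhs BK) (B_nbhs BL)).
  exists N => // y /= Ny; have [Ky Ly] := NKL _ Ny.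
  split=> /=.
    rewrite -(subrK (c N) y) -addrA; apply: BD => //.
    by rewrite -opprB; apply: BN => //; apply: cc => // z /NKL [].
  rewrite -(subrK (c N) y) -addrA; apply: BD => //.
  by rewrite -opprB; apply: BN => //; apply: cc => // z /NKL [].
have PF : ProperFilter F.
  by apply: filter_from_proper => L BL; exists (c L); rewrite /= subrr; apply: B0.
have [|x Fx] := cM F PF.
  move=> E entE; have [U U0 UE] := nbhs0_entourage entE.
  have [L BL LU] := B_base U0.
  exists ([set y | L (y - c L)], [set y | L (y - c L)]).
    by split; exists L.
  move=> [y z] /= [Ly Lz]; apply: UE; apply: LU.
  have -> : y - z = (y - c L) - (z - c L) by rewrite opprB addrA subrK.
  exact: B_sub.
exists x => L BL.
have xL : nbhs x [set z | L (z - x)].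
  by apply/nbhs_translate; apply: filterS (B_nbhs BL) => y /=; rewrite addrC addKr.
have FL : F [set y | L (y - c L)] by exists L.
have [y [/= Lyx Lyc]] := filter_ex (filterI (Fx _ xL) FL).
have -> : x - c L = (y - c L) - (y - x).
  by rewrite opprB [RHS]addrC addrA subrK.
exact: B_sub.
Qed.

End UniformGroups.

(** Choose [K0] with the preimage of [K0] plus [L] least. If [phi a] lies in [K0], then for every
    [K] the coset [a + L] meets the preimage of [K]; linear compactness yields one point [x] of
    [a + L] in all of these, so [phi x = 0] by separation, and [a - x] is the required element of
    [L]. *)
Lemma open_mapping (A : pzRingType) (V Z : lmodType A) (B : set (set V))
    (U : set (set Z)) (phi : V -> Z) :
  linearly_compact B -> (forall L, B L -> submodule L) ->
  (forall L, B L -> artinian_quotient L) -> linear phi ->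
  U !=set0 -> down_directed U -> (forall K, U K -> submodule K) ->
  (forall z, (forall K, U K -> K z) -> z = 0) ->
  (forall K, U K -> exists2 L, B L & L `<=` phi @^-1` K) ->
  forall L, B L -> exists2 K, U K &
    forall a, K (phi a) -> exists2 b, L b & phi b = phi a.
Proof.
move=> lc subB artB lphi U0 dU subU sepU cU L BL; have sL := subB _ BL.
have sP K : U K -> submodule (phi @^-1` K).
  by move=> UK; apply: submod_preimage => //; apply: subU.
have [|K K' UK UK' KK'|K0 UK0 minK0] := @artinian_image A V Z L
    (fun K => sum_sub (phi @^-1` K) L) U (artB _ BL) U0 dU.
- by move=> K /sP sK; split; [apply: submod_sum_sub | apply: sum_subr].
- by apply: sum_subSl => x /KK'.
exists K0 => // a Ka.
have fam K : U K -> exists2 x, K (phi x) & L (x - a).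
  move=> UK; have /(minK0 K UK) [x Kx Lax] : sum_sub (phi @^-1` K0) L a.
    exact: sum_subl.
  by exists x => //; apply: submodBC.
pose T K := [set x | K (phi x)] `&` [set x | L (x - a)].
have [|_ _ [K UK <-] [K' UK' <-]|_ [K UK <-]|x xP] := lc [set T K | K in U].
- by case: U0 => K UK; exists (T K), K.
- have [M UM MKK] := dU _ _ UK UK'; exists (T M); first by exists M.
  by move=> x [/MKK [? ?] ?].
- split; first by have [x ? ?] := fam K UK; exists x.
    apply: affine_setI; last exact: affine_translate.
    have := @affine_translate _ _ _ 0 (sP K UK).
    by congr affine_set; apply/predeqP => x /=; rewrite subr0.
  have [L' BL' L'K] := cU K UK.
  apply: lin_closedI; last exact: (@translate_closed _ _ _ L L a BL sL).
  have := @translate_closed _ _ _ L' _ 0 BL' (sP K UK) L'K.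
  by congr lin_closed; apply/predeqP => x /=; rewrite subr0.
have phiB u v : phi (u - v) = phi u - phi v.
  by rewrite -[- v]scaleN1r addrC lphi scaleN1r addrC.
have [K1 UK1] := U0; have /xP [_ /= Lxa] : [set T K | K in U] (T K1) by exists K1.
have phix0 : phi x = 0.
  by apply: sepU => K UK; have /xP [] : [set T K | K in U] (T K) by exists K.
exists (a - x); first exact: submodBC.
by rewrite phiB phix0 subr0.
Qed.

(** * The countable product of copies of the ring *)

Section SequenceModule.
Variables (R : pzRingType) (B : set (set R)).

Definition seqmod : lmodType R := (nat -> R^o)%type.

Definition seq_ball (n : nat) (L : set R) : set seqmod :=
  [set a | forall k, (k < n)%N -> L (a k)].

Definition seq_base : set (set seqmod) :=
  [set K | exists n, exists2 L, B L & K = seq_ball n L].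

Hypothesis B_sub : forall L, B L -> left_ideal L.
Hypothesis B_art : forall L, B L -> artinian_quotient (L : set R^o).
Hypothesis B_complete : @lin_complete R R^o B.

Lemma seq_ball_sub n L : left_ideal L -> submodule (seq_ball n L).
Proof.
move=> sL; split=> [k _|a u v Lu Lv k ltkn]; first exact: (submod0 sL).
by apply: sL.2; [apply: Lu | apply: Lv].
Qed.

Lemma seq_base_sub K : seq_base K -> submodule K.
Proof. by move=> [n [L BL ->]]; apply/seq_ball_sub/B_sub. Qed.

Lemma seq_base_art K : seq_base K -> artinian_quotient K.
Proof.
move=> [n [L BL ->]]; have sL := B_sub BL.
elim: n => [|n IHn].
  move=> W [K0 WK0] sW dW; exists K0 => // K' /sW [_ LK'] x _.
  by apply: LK'.
have -> : seq_ball n.+1 L =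
    seq_ball n L `&` ((fun a : seqmod => a n : R^o) @^-1` L).
  apply/predeqP => a; split=> [La|[La Lan] k].
    by split=> [k ltkn|]; apply: La; rewrite // ltnS ltnW.
  by rewrite ltnS leq_eqVlt => /orP [/eqP ->|/La].
apply: artinian_setI => //; first exact: seq_ball_sub.
  exact: (@submod_preimage R seqmod R^o).
exact: (@artinian_preimage R R^o seqmod _ _ _ _ (B_art BL)).
Qed.

Lemma seq_complete : lin_complete seq_base.
Proof.
move=> c cc.
have ball n L : B L -> seq_base (seq_ball n L) by move=> BL; exists n, L.
(* Coordinate [k] is read off from the balls constraining [k.+1] coordinates, the largest balls that
   control index [k]. *)
have /choice [x xP] : forall k, exists x : R, forall L, B L ->
    L (x - c (seq_ball k.+1 L) k).
  move=> k; apply: (B_complete (c := fun L => c (seq_ball k.+1 L) k)).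
  move=> L L' BL BL' L'L.
  have := cc _ _ (ball k.+1 _ BL) (ball k.+1 _ BL').
  move=> H; apply: (H _ k) => // a L'a j /L'a; exact: L'L.
exists x => _ [n [L BL ->]] k ltkn.
have kn : seq_ball n L `<=` seq_ball k.+1 L.
  by move=> a La j ltjk; apply: La; apply: leq_trans ltjk ltkn.
have Lc := cc _ _ (ball k.+1 _ BL) (ball n _ BL) kn k (ltnSn k).
have := submodD (B_sub BL) (xP k L BL) Lc.
by rewrite /= [X in L (_ + X)]/GRing.add /= addrA subrK.
Qed.

Lemma seq_lincompact : linearly_compact seq_base.
Proof.
apply: complete_linearly_compact; [exact: seq_base_sub|exact: seq_base_art|].
exact: seq_complete.
Qed.

End SequenceModule.

Section LeftIdeals.
Variables (R : pzRingType) (L : set R).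
Hypothesis sL : left_ideal L.

Lemma lideal0 : L 0. Proof. exact: (submod0 sL). Qed.

Lemma lidealD x y : L x -> L y -> L (x + y).
Proof. exact: (@submodD R R^o). Qed.

Lemma lidealB x y : L x -> L y -> L (x - y).
Proof. exact: (@submodB R R^o). Qed.

Lemma lidealBC x y : L (x - y) -> L (y - x).
Proof. exact: (@submodBC R R^o). Qed.

Lemma lidealM a x : L x -> L (a * x).
Proof. exact: (@submodZ R R^o). Qed.

Lemma lideal_sum (I : Type) (r : seq I) (P : pred I) (f : I -> R) :
  (forall i, P i -> L (f i)) -> L (\sum_(i <- r | P i) f i).
Proof. exact: (@submod_sum R R^o). Qed.

End LeftIdeals.

(** * The radical of a noetherian pseudocompact ring *)

Section IdealProducts.
Variable R : pzRingType.
Implicit Types (I K : set R).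

Lemma ideal_mul0 I K : ideal_mul I K 0.
Proof. by exists 0%N, (fun=> 0), (fun=> 0); split => [[]|[]|] //; rewrite big_ord0. Qed.

Lemma ideal_mulD I K x y :
  ideal_mul I K x -> ideal_mul I K y -> ideal_mul I K (x + y).
Proof.
move=> [n [a [b [Ia Kb ->]]]] [m [c [d [Ic Kd ->]]]].
exists (n + m)%N, (fun i => match fintype.split i with inl j => a j | inr j => c j end).
exists (fun i => match fintype.split i with inl j => b j | inr j => d j end).
split=> [i|i|]; [by case: (fintype.split i)..|].
rewrite big_split_ord /=; congr (_ + _); apply: eq_bigr => i _.
  by have /= := unsplitK (inl i : 'I_n + 'I_m) => ->.
by have /= := unsplitK (inr i : 'I_n + 'I_m) => ->.
Qed.

Lemma ideal_mulM I K x y : I x -> K y -> ideal_mul I K (x * y).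
Proof.
move=> Ix Ky; exists 1%N, (fun=> x), (fun=> y).
by split => //; rewrite big_ord1.
Qed.

Lemma ideal_mul_ind I K (P : R -> Prop) :
  P 0 -> (forall x y, P x -> P y -> P (x + y)) ->
  (forall x y, I x -> K y -> P (x * y)) -> forall x, ideal_mul I K x -> P x.
Proof.
move=> P0 PD PM x [n [a [b [Ia Kb ->]]]].
by apply: (big_ind P) => // i _; apply: PM.
Qed.

Lemma left_ideal_mul I K : left_ideal I -> left_ideal (ideal_mul I K).
Proof.
move=> lI; split; first exact: ideal_mul0.
move=> a u v Iu Iv; apply: ideal_mulD => //.
rewrite /GRing.scale /=; apply: (ideal_mul_ind (P := fun u => ideal_mul I K (a * u))) Iu.
- by rewrite mulr0; apply: ideal_mul0.
- by move=> x y Hx Hy; rewrite mulrDr; apply: ideal_mulD.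
move=> x y Ix Ky; rewrite mulrA; apply: ideal_mulM => //.
exact: lidealM.
Qed.

End IdealProducts.

(** A pseudocompact ring stripped of its uniform structure: [B] plays the open left ideals of finite
    colength, and [pcb_mulr] is continuity of the right multiplications. *)
Record pc_base (R : pzRingType) (B : set (set R)) : Prop := PcBase {
  pcb_sub : forall L, B L -> left_ideal L ;
  pcb_colength : forall L, B L -> finite_colength (L : set R^o) ;
  pcb_dir : down_directed B ;
  pcb_ex : B !=set0 ;
  pcb_complete : @lin_complete R R^o B ;
  pcb_sep : forall x, (forall L, B L -> L x) -> x = 0 ;
  pcb_mulr : forall a L, B L -> exists2 K, B K & forall x, K x -> L (x * a) }.

Section OpenRadical.
Variables (R : pzRingType) (B : set (set R)).
Hypothesis pcB : pc_base B.
Hypothesis noethR : noetherian_module R^o.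

Let subB := pcb_sub pcB.

Definition opens (V : set R) := exists2 L, B L & L `<=` V.

Lemma opensI V W : opens V -> opens W -> opens (V `&` W).
Proof.
move=> [K BK KV] [L BL LW]; have [M BM MKL] := pcb_dir pcB BK BL.
by exists M => // x /MKL [/KV ? /LW ?].
Qed.

Lemma opensS V W : V `<=` W -> opens V -> opens W.
Proof. by move=> VW [L BL LV]; exists L => // x /LV /VW. Qed.

Lemma base_art L : B L -> artinian_quotient (L : set R^o).
Proof. by move=> /(pcb_colength pcB) /finite_colength_artinian. Qed.

Definition open_maximal : set (set R) := [set m | maximal_left_ideal m /\ opens m].

Definition radical : set R := [set x | forall m, open_maximal m -> m x].

Lemma left_ideal_radical : left_ideal radical.
Proof.
split=> [m [[sm _ _] _]|a u v Ru Rv m mm]; first exact: (submod0 sm).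
by have [[sm _ _] _] := mm; apply: sm.2; [apply: Ru | apply: Rv].
Qed.

Lemma maximal_span (m : set R) x y : maximal_left_ideal m -> ~ m x ->
  exists r, m (y - r * x).
Proof.
move=> [sm _ mm] nmx; pose K : set R := [set z | exists r, m (z - r * x)].
have sK : left_ideal K.
  split; first by exists 0; rewrite mul0r subr0; apply: (submod0 sm).
  move=> a u v [r mr] [s ms]; exists (a * r + s).
  have -> : a *: (u : R^o) + v - (a * r + s) * x
    = a *: (u - r * x : R^o) + (v - s * x).
    by rewrite /GRing.scale /= mulrDl opprD mulrBr mulrA addrACA.
  exact: sm.2.
have mK : m `<=` K by move=> z mz; exists 0; rewrite mul0r subr0.
have [Km|KT] := mm K sK mK.
  case: nmx; rewrite -Km; exists 1; rewrite mul1r subrr; exact: (submod0 sm).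
by have : K y by rewrite KT.
Qed.

(* If [radical] is not open there are open maximal left ideals [m n] and
   [x n] lying in [m j] for all [j < n] but not in [m n]; by linear compactness
   the left ideals of the [r] in almost all [m k] then never stabilise. *)
Lemma radical_open : opens radical.
Proof.
apply: contrapT => nopen.
have step (K : set R) : exists xm : R * set R, opens K ->
    [/\ K xm.1, open_maximal xm.2 & ~ xm.2 xm.1].
  have [oK|noK] := pselect (opens K); last by exists (0, setT).
  have [x Kx nrx] : exists2 x, K x & ~ radical x.
    apply: contrapT => H; apply: nopen; apply: opensS oK => x Kx.
    by apply: contrapT => nrx; apply: H; exists x.
  move/existsNP: nrx => [m /not_implyP [om nmx]].
  by exists (x, m).
have [f fP] := choice step.
(* [Ks n] is the intersection of the [m j] with [j < n]; being open it is not contained in the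
   radical, so some open maximal left ideal [m n] misses one of its elements [x n]. *)
pose Ks := fix Ks n := if n is k.+1 then Ks k `&` (f (Ks k)).2 else setT.
pose x n := (f (Ks n)).1; pose m n := (f (Ks n)).2.
have oKs n : opens (Ks n).
  elim: n => [|n IHn] /=.
    by have [L BL] := pcb_ex pcB; exists L.
  by apply: opensI => //; have [_ []] := fP _ IHn.
have xK n : Ks n (x n) by have [] := fP _ (oKs n).
have om n : open_maximal (m n) by have [] := fP _ (oKs n).
have nmx n : ~ m n (x n) by have [] := fP _ (oKs n).
have sm n : left_ideal (m n) by have [[]] := om n.
have Ksm j n : (j < n)%N -> Ks n `<=` m j.
  elim: n => // n IHn; rewrite ltnS leq_eqVlt => /orP [/eqP ->|ltjn] y [Ky my] //.
  exact: IHn.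
have mx j n : (j < n)%N -> m j (x n) by move=> ltjn; apply: (Ksm j n).
(* Starting from [x n], a multiple of [x k] is subtracted for each [k > n] in turn to enter [m k];
   since [x k] lies in all earlier [m j], nothing achieved before is lost. *)
have elim_x n N : exists2 y, m n (y - x n) &
    forall k, (n < k <= n + N)%N -> m k y.
  elim: N => [|N [y my mky]].
    exists (x n); first by rewrite subrr; apply: (submod0 (sm n)).
    by move=> k; rewrite addn0 ltnNge andNb.
  have [r mr] := @maximal_span _ _ y (om (n + N).+1).1 (nmx (n + N).+1).
  have rx j : (j < (n + N).+1)%N -> m j (r * x (n + N).+1).
    by move=> ltj; apply: lidealM => //; apply: mx.
  exists (y - r * x (n + N).+1).
    rewrite addrAC; apply: lidealB => //.
    by apply: rx; rewrite ltnS leq_addr.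
  move=> k /andP [ltnk]; rewrite addnS leq_eqVlt => /orP [/eqP -> //|ltk].
  apply: lidealB => //; last by apply: rx.
  by apply: mky; rewrite ltnk.
have lcR : @linearly_compact R R^o B.
  exact: (@complete_linearly_compact R R^o B subB base_art (pcb_complete pcB)).
have sep n : exists2 y, ~ m n y & forall k, (n < k)%N -> m k y.
  pose T N : set R := [set y | m n (y - x n)] `&`
    [set y | forall k, (n < k <= n + N)%N -> m k y].
  have T_aff N : affine_set (T N : set R^o).
    apply: affine_setI; first exact: (@affine_translate R R^o _ (x n) (sm n)).
    move=> a u v w mu mv mw k kN.
    by apply: (sm k).2; [exact: (lidealB (sm k) (mu k kN) (mv k kN)) | exact: mw].
  have T_cl N : @lin_closed R R^o B (T N).
    apply: lin_closedI.
      have [_ [L BL Lm]] := om n.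
      exact: (@translate_closed R R^o B L (m n) (x n) BL (sm n) Lm).
    move=> u Hu k kN; have [_ [L BL Lm]] := om k.
    have [z mz Lz] := Hu L BL.
    rewrite -(subrK z u).
    exact: (lidealD (sm k) (Lm _ Lz) (mz k kN)).
  have [|_ _ [N _ <-] [M _ <-]|_ [N _ <-]|y yP] := lcR [set T N | N in setT].
  - by exists (T 0%N), 0%N.
  - exists (T (maxn N M)); first by exists (maxn N M).
    move=> y [my mky]; split; split => // k /andP [nk kN]; apply: mky;
    by rewrite nk (leq_trans kN) // leq_add2l leq_max leqnn ?orbT.
  - by split => //; have [y my mky] := elim_x n N; exists y.
  have yT N : T N y by apply: yP; exists N.
  exists y => [my|k ltnk]; last first.
    by have [_] := yT k; apply; rewrite ltnk leq_addl.
  apply: (nmx n); have [/= my' _] := yT 0%N.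
  by rewrite -[x n](subKr y); apply: (lidealB (sm n)).
(* Finitely many generators of [U] lie in all [m k] from a common index [n] on, hence so does [U];
   but [sep n] provides an element of [U] outside [m n]. *)
pose U : set R := [set r | exists n, forall k, (n <= k)%N -> m k r].
have sU : left_ideal U.
  split; first by exists 0%N => k _; apply: (submod0 (sm k)).
  move=> a u v [n1 U1] [n2 U2]; exists (maxn n1 n2) => k.
  by rewrite geq_max => /andP [k1 k2]; apply: (sm k).2; [exact: U1|exact: U2].
have [s [e [Ue gU]]] := noethR sU.
have /choice [N NP] : forall i, exists n, forall k, (n <= k)%N -> m k (e i) by [].
pose n := \max_i N i; have [y nmy mky] := sep n.
have /gU [a yE] : U y by exists n.+1.
apply: nmy; rewrite yE; apply: (lideal_sum (sm n)) => // i _.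
by apply: (lidealM (sm n)); apply: NP; apply: leq_bigmax.
Qed.

(** As [radical_pow 0] is everything, [radical_pow 1] is the two-sided ideal [radical * R]; all
    powers are thus two-sided without first proving it of [radical]. *)
Fixpoint radical_pow (n : nat) : set R :=
  if n is k.+1 then ideal_mul radical (radical_pow k) else setT.

Lemma radical_pow_left n : left_ideal (radical_pow n).
Proof. by case: n => [|n] //=; apply/left_ideal_mul/left_ideal_radical. Qed.

Lemma radical_powr n a x : radical_pow n x -> radical_pow n (x * a).
Proof.
elim: n x => [//|n IHn] /= x.
apply: (ideal_mul_ind
  (P := fun x => ideal_mul radical (radical_pow n) (x * a))) => [|u v|u v Iu Jv].
- by rewrite mul0r; apply: ideal_mul0.
- by move=> ? ?; rewrite mulrDl; apply: ideal_mulD.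
by rewrite -mulrA; apply: ideal_mulM => //; apply: IHn.
Qed.

Lemma radical_powS n : radical_pow n.+1 `<=` radical_pow n.
Proof.
move=> x /=; have sn := radical_pow_left n; apply: ideal_mul_ind.
- exact: (submod0 sn).
- by move=> u v; apply: lidealD.
by move=> u v _ Jv; apply: lidealM.
Qed.

(** Reconciles the two conventions: [ideal_exp] multiplies the new factor on the right,
    [radical_pow] on the left. *)
Lemma radical_powSr n : ideal_mul (radical_pow n) radical `<=` radical_pow n.+1.
Proof.
elim: n => [|n IHn] x /=.
  apply: ideal_mul_ind => [|u v|u v _ Rv]; first exact: ideal_mul0.
    exact: ideal_mulD.
  rewrite -[u * v]mulr1; apply: ideal_mulM => //.
  exact: (lidealM left_ideal_radical).
apply: ideal_mul_ind => [|u v|u v]; first exact: ideal_mul0.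
  exact: ideal_mulD.
move=> + Rv; apply: (ideal_mul_ind
  (P := fun u => ideal_mul radical (ideal_mul radical (radical_pow n)) (u * v)))
  => [|a b|a b Ra Jb].
- by rewrite mul0r; apply: ideal_mul0.
- by move=> ? ?; rewrite mulrDl; apply: ideal_mulD.
by rewrite -mulrA; apply: ideal_mulM => //; apply: IHn; apply: ideal_mulM.
Qed.

Lemma jacobson_pow n : ideal_exp (@jacobson R) n `<=` radical_pow n.
Proof.
elim: n => [//|n IHn] x; rewrite /ideal_exp iterS -/(ideal_exp _ _) => Jx.
apply: radical_powSr; apply: ideal_mul_ind Jx; first exact: ideal_mul0.
  by move=> ? ?; apply: ideal_mulD.
by move=> u v /IHn Ju Jv; apply: ideal_mulM => // m [mm _]; apply: Jv.
Qed.

(** For [v] in [F'] outside [F], the annihilator of [v] in the simple module [F' / F] is a maximal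
    left ideal, open because right multiplication by [v] is continuous; hence it contains the
    radical. *)
Lemma radical_simple (F F' : set R) v x : opens F ->
  left_ideal F -> left_ideal F' -> F `<=` F' ->
  (forall K : set R, left_ideal K -> F `<=` K -> K `<=` F' -> K = F \/ K = F') ->
  radical x -> F' v -> F (x * v).
Proof.
move=> [L BL LF] sF sF' FF' simp Rx F'v.
have [Fv|nFv] := pselect (F v); first exact: lidealM.
have sm (K : set R) : left_ideal K -> left_ideal [set r | K (r * v)].
  move=> sK; split; first by rewrite /= mul0r; apply: (submod0 sK).
  move=> r u w mu mw; change (K ((r * u + w) * v)); rewrite mulrDl -mulrA.
  exact: (sK.2 r).
apply: (Rx [set r | F (r * v)]); split; last first.
  by have [L' BL' L'L] := pcb_mulr pcB v BL; exists L' => // r /L'L /LF.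
split; first exact: sm.
  by move=> mT; apply: nFv; have : [set r | F (r * v)] 1 by [rewrite mT]; rewrite /= mul1r.
move=> K sK FK.
have [|H] := pselect (K `<=` [set r | F (r * v)]); first by left; apply/seteqP.
right; have [y Ky nFy] : exists2 y, K y & ~ F (y * v).
  apply: contrapT => H'; apply: H => y Ky /=.
  by apply: contrapT => nKy; apply: H'; exists y.
pose K' : set R := [set z | exists2 k, K k & F (z - k * v)].
have sK' : left_ideal K'.
  split; first by exists 0; rewrite ?mul0r ?subr0; [apply: (submod0 sK) | apply: (submod0 sF)].
  move=> a z w [k Kk Fk] [l Kl Fl]; exists (a * k + l); first exact: (sK.2 a).
  have -> : a *: (z : R^o) + w - (a * k + l) * v
    = a *: (z - k * v : R^o) + (w - l * v).
    by rewrite /GRing.scale /= mulrDl opprD mulrBr mulrA addrACA.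
  exact: sF.2.
have [K'F|K'F'] : K' = F \/ K' = F'.
  apply: simp => // [z Fz|z [k Kk Fk]].
    by exists 0; rewrite ?mul0r ?subr0 //; apply: (submod0 sK).
  rewrite -(subrK (k * v) z); apply: lidealD => //; first exact: FF'.
  exact: lidealM.
- case: nFy; rewrite -K'F; exists y => //; rewrite subrr; exact: (submod0 sF).
have [k Kk Fk] : K' v by rewrite K'F'.
have K1 : K (1 - k) by apply: FK; rewrite /= mulrBl mul1r.
apply/seteqP; split => // z _; rewrite -[z]mulr1; apply: lidealM => //.
by rewrite -(subrK k 1); apply: lidealD.
Qed.

(** Each further factor from the radical descends one step of a composition series of [R / L]. *)
Lemma radical_pow_small L : B L -> exists n, radical_pow n `<=` L.
Proof.
move=> BL; have [n [F [F0 Fn sF stepF]]] := pcb_colength pcB BL.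
have LF i : (i <= n)%N -> L `<=` F i.
  elim: i => [|i IHi] ltin; first by rewrite F0.
  by have [[FF _] _] := stepF i ltin; move=> x /(IHi (ltnW ltin)) /FF.
exists n; suff H k : (k <= n)%N -> radical_pow k `<=` F (n - k)%N.
  by have := H n (leqnn n); rewrite subnn F0.
elim: k => [_|k IHk ltkn]; first by rewrite subn0 Fn.
have iE : (n - k)%N = (n - k.+1).+1 by rewrite subnSK.
have ltin : (n - k.+1 < n)%N by rewrite -iE leq_subr.
have [[FF _] simp] := stepF _ ltin.
have sFi := sF _ (ltnW ltin).
move=> x /=; apply: ideal_mul_ind.
- exact: (submod0 sFi).
- by move=> u v; apply: lidealD.
move=> u v Ru Jv; apply: (radical_simple _ sFi (sF _ ltin) FF simp Ru).
  by exists L => //; apply: LF; apply: ltnW.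
by have := IHk (ltnW ltkn) _ Jv; rewrite iE.
Qed.

(** Let [y] generate the left ideal [radical_pow n] and let [phi] send a sequence [a] to the
    combination of the [y i] with coefficients [a i]. Sequences with coefficients in an open [L0]
    inside the radical form an open set; by the open mapping theorem their image contains a
    neighbourhood of zero in [radical_pow n], and that image lies in [radical_pow n.+1]. *)
Lemma radical_pow_open n : opens (radical_pow n).
Proof.
elim: n => [|n oJ] /=.
  by have [L BL] := pcb_ex pcB; exists L.
have [s [y [Jy gJ]]] := noethR (radical_pow_left n).
pose phi : seqmod R -> R^o := fun a => \sum_(i < s) (a i : R) * y i.
have lphi : linear phi.
  move=> c u v; rewrite /phi scaler_sumr -big_split /=; apply: eq_bigr => i _.
  by rewrite mulrDl /GRing.scale /= mulrA.
have [L0 BL0 L0R] := radical_open.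
have BP : seq_base B (seq_ball s L0) by exists s, L0.
have [| | | | |K BK KP] := @open_mapping R (seqmod R) R^o (seq_base B) B phi
  (seq_lincompact subB base_art (pcb_complete pcB))
  (seq_base_sub subB) (seq_base_art subB base_art) lphi _ _ _ _ _ _ BP.
- exact: (pcb_ex pcB).
- exact: (pcb_dir pcB).
- exact: subB.
- exact: (pcb_sep pcB).
- move=> K BK; have /choice [Li LiP] : forall i, exists L, B L /\ forall x, L x -> K (x * y i).
    by move=> i; have [L BL LK] := pcb_mulr pcB (y i) BK; exists L.
  have [L BL LLi] : exists2 L, B L & forall i, L `<=` Li i.
    have : exists2 L, B L & forall i : 'I_s, i \in enum 'I_s -> L `<=` Li i.
      elim: (enum _) => [|j r [L BL LLi]].
        by have [L BL] := pcb_ex pcB; exists L.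
      have [M BM MLL] := pcb_dir pcB BL (LiP j).1.
      exists M => // i; rewrite in_cons => /orP [/eqP ->|/LLi H] z /MLL [Lz Ljz] //.
      exact: H.
    by move=> [L BL H]; exists L => // i; apply: H; rewrite mem_enum.
  exists (seq_ball s L); first by exists s, L.
  move=> a La; rewrite /= /phi; apply: lideal_sum; first exact: subB.
  by move=> i _; apply: (LiP i).2; apply: LLi; apply: La.
have oK : opens K by exists K.
apply: opensS (opensI oJ oK) => z [Jz Kz].
have [a zE] := gJ z Jz.
have [|b Lb bE] := KP (fun k => if insub k is Some i then a i else 0).
  move: Kz; rewrite zE; congr K; apply: eq_bigr => i _.
  by rewrite insubT //= => ltis; rewrite /GRing.scale /=; congr (a _ * _); apply: val_inj.
have -> : z = \sum_(i < s) (b i : R) * y i.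
  rewrite zE -[RHS]/(phi b) bE; apply: eq_bigr => i _.
  by rewrite insubT //= => ltis; rewrite /GRing.scale /=; congr (a _ * _); apply: val_inj.
exists s, (fun i => b i), y; split => // i.
by apply: L0R; apply: Lb.
Qed.

End OpenRadical.

Section RadicalMorphism.
Variables (R : pzRingType) (B : set (set R)) (s s' : R -> R).
Hypotheses (sD : {morph s : x y / x + y}) (sM : {morph s : x y / x * y}).
Hypotheses (sK : cancel s s') (s'K : cancel s' s).
Hypothesis s_cont : forall L, B L -> exists2 K, B K & forall x, K x -> L (s x).

(** The preimage under [s] of an open maximal left ideal is another one: bijectivity keeps it
    maximal, continuity keeps it open. *)
Lemma radical_morph x : radical B x -> radical B (s x).
Proof.
have s0 : s 0 = 0 by apply: (@addrI _ (s 0)); rewrite -sD !addr0.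
move=> Rx m [[sm mT mm] [L BL Lm]]; apply: (Rx [set r | m (s r)]); split.
  split.
  - split; first by rewrite /= s0; apply: (submod0 sm).
    move=> r u v mu mv; change (m (s (r * u + v))); rewrite sD sM.
    exact: (sm.2 (s r)).
  - move=> E; apply: mT; apply/seteqP; split => // y _; rewrite -[y]s'K.
    by have : [set r | m (s r)] (s' y) by rewrite E.
  move=> K sK' mK; have [||EK|EK] := mm [set y | K (s' y)].
  - have s'D y z : s' (y + z) = s' y + s' z.
      by apply: (can_inj sK); rewrite sD !s'K.
    have s'M y z : s' (y * z) = s' y * s' z.
      by apply: (can_inj sK); rewrite sM !s'K.
    have s'0 : s' 0 = 0 by apply: (can_inj sK); rewrite s0 s'K.
    split; first by rewrite /= s'0; apply: (submod0 sK').
    move=> r u v Ku Kv; change (K (s' (r * u + v))); rewrite s'D s'M.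
    exact: (sK'.2 (s' r)).
  - by move=> y my; apply: mK; rewrite /= s'K.
  - left; apply/seteqP; split => [y Ky|]; last exact: mK.
    by rewrite /= -EK /= sK.
  right; apply/seteqP; split => // y _; rewrite -[y]sK.
  by have : [set y | K (s' y)] (s y) by rewrite EK.
have [K BK KL] := s_cont BL.
by exists K => // y /KL /Lm.
Qed.

Lemma radical_pow_morph n x : radical_pow B n x -> radical_pow B n (s x).
Proof.
have s0 : s 0 = 0 by apply: (@addrI _ (s 0)); rewrite -sD !addr0.
elim: n x => [//|n IHn] x /=; apply: (ideal_mul_ind
  (P := fun x => ideal_mul (radical B) (radical_pow B n) (s x))) => [|u v|u v Ru Jv].
- by rewrite s0; apply: ideal_mul0.
- by move=> ? ?; rewrite sD; apply: ideal_mulD.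
by rewrite sM; apply: ideal_mulM; [apply: radical_morph | apply: IHn].
Qed.

End RadicalMorphism.

Definition word (R : Type) (sigma sigma' delta : R -> R) (w : seq letter) (a : R) : R :=
  foldr (fun l => match l with
    Yletter => delta | Zletter => sigma | Z'letter => sigma' end) a w.

(* The powers [J n] of the open radical of [R] define its topology. *)
Record skew_frame (R : pzRingType) (sigma sigma' delta : R -> R)
    (J : nat -> set R) : Prop := SkewFrame {
  frJ0 : forall x, J 0%N x ;
  frJS : forall n, J n.+1 `<=` J n ;
  frJl : forall n, left_ideal (J n) ;
  frJr : forall n a x, J n x -> J n (x * a) ;
  frJM : forall n x y, J 1%N x -> J n y -> J n.+1 (x * y) ;
  frJsep : forall x, (forall n, J n x) -> x = 0 ;
  frJart : forall n, artinian_quotient (J n : set R^o) ;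
  frJcomplete : @lin_complete R R^o [set J n | n in setT] ;
  frs_D : {morph sigma : x y / x + y} ;
  frs_M : {morph sigma : x y / x * y} ;
  frs_1 : sigma 1 = 1 ;
  frs_K : cancel sigma sigma' ;
  frs'_K : cancel sigma' sigma ;
  frd_D : {morph delta : x y / x + y} ;
  frd_M : forall x y, delta (x * y) = delta x * y + sigma x * delta y ;
  frJs : forall n x, J n x -> J n (sigma x) ;
  frJs' : forall n x, J n x -> J n (sigma' x) ;
  frJd : forall n, exists m, forall x, J m x -> J n (delta x) ;
  frnil : forall n, exists m, forall w, (m <= count is_Y w)%N ->
    forall a, J n (word sigma sigma' delta w a) }.

Section PseudocompactFrame.
Variable R : uniformRing.
Hypothesis pcR : left_pseudocompact_ring R.

Definition open_ideals : set (set R) :=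
  [set L | [/\ left_ideal L, open L & finite_colength (L : set R^o)]].

Lemma open_ideal_nbhs L : open_ideals L -> nbhs 0 L.
Proof.
by move=> [sL oL _]; apply: open_nbhs_nbhs; split => //; apply: (lideal0 sL).
Qed.

Lemma open_ideal_base U : nbhs 0 U -> exists2 L, open_ideals L & L `<=` U.
Proof. by have [_ _ _ base] := pcR; move=> /base [L [sL oL LU fL]]; exists L. Qed.

Lemma open_ideals_base : pc_base open_ideals.
Proof.
have [cM hR cR base] := pcR.
split.
- by move=> L [].
- by move=> L [].
- move=> K L /open_ideal_nbhs K0 /open_ideal_nbhs L0.
  by have [M] := open_ideal_base (filterI K0 L0); exists M.
- by have [L BL _] := open_ideal_base (@filterT _ (nbhs (0 : R)) _); exists L.
- move=> c cc; apply: (coherent_limit (B := open_ideals)) => //.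
  + by move=> L [sL _ _] x y; apply: lidealB.
  + exact: open_ideal_nbhs.
  + exact: open_ideal_base.
- move=> x Lx; apply/esym/hR => U V U0 Vx.
  have [L BL LU] := open_ideal_base U0.
  by exists x; split; [exact: (LU _ (Lx _ BL)) | exact: nbhs_singleton].
move=> a L /open_ideal_nbhs L0.
have cMa : (fun r : R => r * a) @ (0 : R) --> (0 : R) * a.
  apply: (@continuous_comp _ _ _ (fun r : R => (r, a)) (fun z : R * R => z.1 * z.2)).
    by apply: cvg_pair => /=; [exact: cvg_id | exact: cvg_cst].
  exact: cM.
have /cMa : nbhs (0 * a) L by rewrite mul0r.
by move=> /open_ideal_base [K BK KL]; exists K.
Qed.

Lemma opens_nbhs V : opens open_ideals V -> nbhs 0 V.
Proof. by move=> [L /open_ideal_nbhs L0 LV]; apply: filterS LV L0. Qed.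

Definition Rpow (n : nat) : set R := radical_pow open_ideals n.

Hypothesis noethR : noetherian_ring R.

Lemma Rpow_nbhs n : nbhs 0 (Rpow n).
Proof. exact/opens_nbhs/(radical_pow_open open_ideals_base noethR.1). Qed.

Lemma Rpow_base U : nbhs 0 U -> exists n, Rpow n `<=` U.
Proof.
move=> /open_ideal_base [L BL LU].
have [n nL] := radical_pow_small open_ideals_base BL.
by exists n => x /nL /LU.
Qed.

Variables (sigma : {rmorphism R -> R}) (sigma' : R -> R).
Variable delta : {additive R -> R}.
Hypotheses (sigmaK : cancel sigma sigma') (sigmaK' : cancel sigma' sigma).
Hypotheses (csigma : continuous sigma) (csigma' : continuous sigma').
Hypotheses (cdelta : continuous delta) (derdelta : left_derivation sigma delta).
Hypothesis nildelta : sigma_nilpotent sigma sigma' delta.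

Lemma frame : skew_frame sigma sigma' delta Rpow.
Proof.
have pcB := open_ideals_base; have [_ _ cR _] := pcR.
have Jl n : left_ideal (Rpow n) := radical_pow_left open_ideals n.
have s'D : {morph sigma' : x y / x + y}.
  by move=> x y; apply: (can_inj sigmaK); rewrite rmorphD !sigmaK'.
have s'M : {morph sigma' : x y / x * y}.
  by move=> x y; apply: (can_inj sigmaK); rewrite rmorphM !sigmaK'.
have s'0 : sigma' 0 = 0 by apply: (can_inj sigmaK); rewrite sigmaK' rmorph0.
split => //.
- exact: radical_powS.
- by move=> n a x; apply: radical_powr.
(* An element of [Rpow 1] is a sum of products [a * b] with [a] in the radical; regrouping as
   [a * (b * y)] uses only that [Rpow n] is a left ideal. *)
- move=> n x y [k [a [b [Ra _ ->]]]] Jy; rewrite mulr_suml.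
  apply: (lideal_sum (Jl n.+1)) => i _; rewrite -mulrA.
  by apply: ideal_mulM => //; apply: (lidealM (Jl n)).
- move=> x Jx; apply: (pcb_sep pcB) => L BL.
  by have [n nL] := radical_pow_small pcB BL; apply: nL; apply: Jx.
- move=> n; have [L BL LJ] := radical_pow_open pcB noethR.1 n.
  exact: (@artinian_sub R R^o L (Rpow n) LJ (base_art pcB BL)).
- move=> c cc; apply: (coherent_limit (B := [set Rpow n | n in setT])) => //.
  + by move=> _ [n _ <-] x y; apply: (lidealB (Jl n)).
  + by move=> _ [n _ <-]; apply: Rpow_nbhs.
  + by move=> U /Rpow_base [n nU]; exists (Rpow n) => //; exists n.
- exact: rmorphD.
- exact: rmorphM.
- exact: rmorph1.
- exact: raddfD.
- move=> n x; apply: radical_pow_morph (rmorphD sigma) (rmorphM sigma) sigmaK sigmaK' _ _ _.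
  move=> L /open_ideal_nbhs L0.
  have /csigma /open_ideal_base [K BK KL] : nbhs (sigma 0) L by rewrite rmorph0.
  by exists K.
- move=> n x; apply: radical_pow_morph s'D s'M sigmaK' sigmaK _ _ _.
  move=> L /open_ideal_nbhs L0.
  have /csigma' /open_ideal_base [K BK KL] : nbhs (sigma' 0) L by rewrite s'0.
  by exists K.
- move=> n; have /cdelta /Rpow_base [m mJ] : nbhs (delta 0) (Rpow n).
    by rewrite raddf0; apply: Rpow_nbhs.
  by exists m.
move=> [|n]; first by exists 0%N.
have [m _ mP] := nildelta (ltn0Sn n); exists m => w mw a.
by apply: jacobson_pow; apply: mP.
Qed.

Lemma Rpow_cvg (u : nat -> R) (l : R) :
  u @ \oo --> l <-> forall n, exists N, forall k, (N <= k)%N -> Rpow n (u k - l).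
Proof.
have Jl n : left_ideal (Rpow n) := radical_pow_left open_ideals n.
split=> [ul n|ul U].
  have : nbhs l [set x | Rpow n (x - l)].
    apply/nbhs_translate; apply: filterS (Rpow_nbhs n) => y /=.
    by rewrite addrC addKr.
  by move=> /ul [N _ NP]; exists N => k Nk; apply: NP.
move=> /nbhs_translate /Rpow_base [n nU]; have [N NP] := ul n.
exists N => // k Nk; have := nU _ (NP k Nk).
by rewrite /= addrC subrK.
Qed.

End PseudocompactFrame.

(** * Convergent sums and the operators f |-> f^x *)

Section Sums.
Variables (R : pzRingType) (sigma sigma' delta : R -> R) (J : nat -> set R).
Hypothesis fr : skew_frame sigma sigma' delta J.

Let Jl := frJl fr.

Lemma frJ_le m n x : (m <= n)%N -> J n x -> J m x.
Proof.
elim: n => [|n IHn]; first by rewrite leqn0 => /eqP ->.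
rewrite leq_eqVlt => /orP [/eqP -> //|ltmn] /(frJS fr).
exact: IHn.
Qed.

Definition conv (u : nat -> R) (l : R) :=
  forall n, exists N, forall k, (N <= k)%N -> J n (u k - l).

Definition null (u : nat -> R) :=
  forall n, exists N, forall k, (N <= k)%N -> J n (u k).

Definition psum (u : nat -> R) (N : nat) : R := \sum_(i < N) u i.

(** The limit of the partial sums, with default 0 when there is none; in this topology [null u]
    already guarantees convergence. *)
Definition Sum (u : nat -> R) : R := xget 0 [set l | conv (psum u) l].

Lemma conv_unique u l l' : conv u l -> conv u l' -> l = l'.
Proof.
move=> ul ul'; apply/eqP; rewrite -subr_eq0; apply/eqP/(frJsep fr) => n.
have [N NP] := ul n; have [N' NP'] := ul' n.
have -> : l - l' = (u (maxn N N') - l') - (u (maxn N N') - l).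
  by rewrite opprB [RHS]addrC addrA subrK.
by apply: (lidealB (Jl n)); [apply: NP' | apply: NP]; rewrite leq_max leqnn ?orbT.
Qed.

Lemma Sum_unique u l : conv (psum u) l -> Sum u = l.
Proof. by move=> ul; apply: (conv_unique _ ul); apply: xgetPex; exists l. Qed.

Lemma psum_tail u n N k : (forall i, (N <= i)%N -> J n (u i)) -> (N <= k)%N ->
  J n (psum u k - psum u N).
Proof.
move=> uJ /subnKC <-; rewrite /psum big_split_ord /= [X in J n X]addrC addKr.
by apply: (lideal_sum (Jl n)) => i _; apply: uJ; apply: leq_addr.
Qed.

(* Completeness is phrased with one point for each set [J n]. *)
Lemma cauchy_conv u : (forall n, exists N, forall k, (N <= k)%N ->
  J n (u k - u N)) -> exists l, conv u l.
Proof.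
move=> /choice [N NP].
(* The [J n] may coincide for different [n], so one index is selected for each set. *)
have [idx idxP] : exists f : set R -> nat, forall n, J (f (J n)) = J n.
  have /choice [f fP] : forall L : set R, exists k, (exists n, L = J n) -> L = J k.
    move=> L; have [[n ->]|nL] := pselect (exists n, L = J n); first by exists n.
    by exists 0%N.
  by exists f => n; rewrite -(fP (J n)) //; exists n.
have [L _ [n _ <-] [m _ <-] JJ|l lP] :=
  frJcomplete fr (c := fun L => u (N (idx L))).
  rewrite -{1}idxP; set a := idx (J n); set b := idx (J m).
  pose k := maxn (N a) (N b).
  have -> : u (N a) - u (N b) = (u k - u (N b)) - (u k - u (N a)).
    by rewrite opprB [RHS]addrC addrA subrK.
  apply: (lidealB (Jl a)); last by apply: NP; apply: leq_maxl.
  rewrite /a idxP; apply: JJ; rewrite -idxP -/b; apply: NP; exact: leq_maxr.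
exists l => n; exists (N (idx (J n))) => k Nk.
have -> : u k - l = (u k - u (N (idx (J n)))) - (l - u (N (idx (J n)))).
  by rewrite opprB addrA subrK.
apply: (lidealB (Jl n)); last by apply: lP; exists n.
by have := NP (idx (J n)) k Nk; rewrite idxP.
Qed.

Lemma SumP u : null u -> conv (psum u) (Sum u).
Proof.
move=> nu; have [|l] := @cauchy_conv (psum u); last by move=> ul; apply: xgetPex; exists l.
by move=> n; have [N NP] := nu n; exists N => k; apply: psum_tail.
Qed.

Lemma Sum_tail u n N : null u -> (forall i, (N <= i)%N -> J n (u i)) ->
  J n (Sum u - psum u N).
Proof.
move=> nu uJ; have [M MP] := SumP nu n; pose k := maxn N M.
have -> : Sum u - psum u N = (psum u k - psum u N) - (psum u k - Sum u).
  by rewrite opprB [RHS]addrC addrA subrK.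
apply: (lidealB (Jl n)); first by apply: psum_tail => //; apply: leq_maxl.
by apply: MP; apply: leq_maxr.
Qed.

Lemma Sum_J u n : null u -> (forall i, J n (u i)) -> J n (Sum u).
Proof.
move=> nu uJ; have := @Sum_tail u n 0%N nu (fun i _ => uJ i).
by rewrite /psum big_ord0 subr0.
Qed.

Lemma eq_Sum u v : u =1 v -> Sum u = Sum v.
Proof. by move=> /funext ->. Qed.

Lemma null0 : null (fun=> 0).
Proof. by move=> n; exists 0%N => k _; apply: (lideal0 (Jl n)). Qed.

Lemma nullD u v : null u -> null v -> null (fun k => u k + v k).
Proof.
move=> nu nv n; have [N NP] := nu n; have [M MP] := nv n.
exists (maxn N M) => k; rewrite geq_max => /andP [? ?].
by apply: (lidealD (Jl n)); [apply: NP | apply: MP].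
Qed.

Lemma null_map u f : (forall n, exists m, forall x, J m x -> J n (f x)) ->
  null u -> null (fun k => f (u k)).
Proof.
move=> cf nu n; have [m mP] := cf n; have [N NP] := nu m.
by exists N => k /NP /mP.
Qed.

Lemma null_mull u a : null u -> null (fun k => a * u k).
Proof. by apply: null_map => n; exists n => x; apply: (lidealM (Jl n)). Qed.

Lemma null_mulr u v : null u -> null (fun k => u k * v k).
Proof. by move=> nu n; have [N NP] := nu n; exists N => k /NP; apply: (frJr fr). Qed.

Lemma null_mulrr u v : null v -> null (fun k => u k * v k).
Proof.
by move=> nv n; have [N NP] := nv n; exists N => k /NP; apply: (lidealM (Jl n)).
Qed.

Lemma Sum_map u f : {morph f : x y / x + y} ->
  (forall n, exists m, forall x, J m x -> J n (f x)) ->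
  null u -> f (Sum u) = Sum (fun k => f (u k)).
Proof.
move=> fD cf nu; apply/esym/Sum_unique => n.
have f0 : f 0 = 0 by apply: (@addrI _ (f 0)); rewrite -fD !addr0.
have fB x y : f (x - y) = f x - f y.
  by apply: (@addIr _ (f y)); rewrite -fD !subrK.
have fS k : psum (fun k => f (u k)) k = f (psum u k).
  rewrite /psum; elim: k => [|k IHk]; first by rewrite !big_ord0.
  by rewrite !big_ord_recr /= fD IHk.
have [m mP] := cf n; have [N NP] := SumP nu m.
by exists N => k /NP /mP; rewrite fB fS.
Qed.

Lemma Sum_mull u a : null u -> a * Sum u = Sum (fun k => a * u k).
Proof.
move=> nu; apply: (Sum_map (f := fun x => a * x)) => // [x y|n].
  exact: mulrDr.
by exists n => x; apply: (lidealM (Jl n)).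
Qed.

Lemma Sum_mulr u a : null u -> Sum u * a = Sum (fun k => u k * a).
Proof.
move=> nu; apply: (Sum_map (f := fun x => x * a)) => // [x y|n].
  exact: mulrDl.
by exists n => x; apply: (frJr fr).
Qed.

Lemma SumN u : null u -> - Sum u = Sum (fun k => - u k).
Proof.
move=> nu; rewrite -mulN1r Sum_mull //.
by apply: eq_Sum => k; rewrite mulN1r.
Qed.

Lemma SumD u v : null u -> null v -> Sum u + Sum v = Sum (fun k => u k + v k).
Proof.
move=> nu nv; apply/esym/Sum_unique => n.
have [N NP] := SumP nu n; have [M MP] := SumP nv n.
exists (maxn N M) => k; rewrite geq_max => /andP [? ?].
rewrite /psum big_split opprD addrACA.
by apply: (lidealD (Jl n)); [apply: NP | apply: MP].
Qed.

Lemma nullN u : null u -> null (fun k => - u k).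
Proof.
by apply: null_map => n; exists n => x Jx; rewrite -mulN1r; apply: (lidealM (Jl n)).
Qed.

Lemma SumB u v : null u -> null v -> Sum u - Sum v = Sum (fun k => u k - v k).
Proof. by move=> nu nv; rewrite SumN // SumD //; apply: nullN. Qed.

Lemma nullB u v : null u -> null v -> null (fun k => u k - v k).
Proof. by move=> nu nv; apply: nullD => //; apply: nullN. Qed.

Lemma Sum_finite u N : (forall i, (N <= i)%N -> u i = 0) -> Sum u = psum u N.
Proof.
move=> u0; apply: Sum_unique => n; exists N => k; apply: psum_tail => i /u0 ->.
exact: (lideal0 (Jl n)).
Qed.

Lemma null_shift u : null u -> null (fun k => u k.+1).
Proof.
by move=> nu n; have [N NP] := nu n; exists N => k Nk; apply: NP; apply: leqW.
Qed.

Lemma Sum_recl u : null u -> Sum u = u 0%N + Sum (fun k => u k.+1).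
Proof.
move=> nu; apply: Sum_unique => n.
have [N NP] := SumP (null_shift nu) n.
exists N.+1 => -[//|k] Nk; rewrite /psum big_ord_recl /= opprD addrACA subrr add0r.
exact: NP.
Qed.

(** Modulo [J n] both iterated sums reduce to the same finite sum over the square of side [N],
    outside of which all terms lie in [J n]. *)
Lemma Sum_exchange (X : nat -> nat -> R) :
  (forall n, exists N, forall j k, (N <= j)%N || (N <= k)%N -> J n (X j k)) ->
  Sum (fun j => Sum (X j)) = Sum (fun k => Sum (X^~ k)).
Proof.
have half (Y : nat -> nat -> R) n N : (forall n, exists N, forall j k,
    (N <= j)%N || (N <= k)%N -> J n (Y j k)) ->
    (forall j k, (N <= j)%N || (N <= k)%N -> J n (Y j k)) ->
    J n (Sum (fun j => Sum (Y j)) - \sum_(j < N) \sum_(k < N) Y j k).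
  move=> Y0 YN.
  have nY j : null (Y j).
    by move=> m; have [M MP] := Y0 m; exists M => k Mk; apply: MP; rewrite Mk orbT.
  have nSY : null (fun j => Sum (Y j)).
    move=> m; have [M MP] := Y0 m; exists M => j Mj.
    by apply: Sum_J => // k; apply: MP; rewrite Mj.
  set S := Sum _; set s := \sum_(j < N) _.
  have -> : S - s = (S - psum (fun j => Sum (Y j)) N) +
    (psum (fun j => Sum (Y j)) N - s) by rewrite addrA subrK.
  apply: (lidealD (Jl n)).
    apply: Sum_tail => // j Nj; apply: Sum_J => // k.
    by apply: YN; rewrite Nj.
  rewrite /psum -sumrB; apply: (lideal_sum (Jl n)) => j _.
  by apply: Sum_tail => // k Nk; apply: YN; rewrite Nk orbT.
move=> X0; apply/eqP; rewrite -subr_eq0; apply/eqP/(frJsep fr) => n.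
have [N NP] := X0 n.
have H1 := half X n N X0 NP.
have H2 : J n (Sum (fun k => Sum (X^~ k)) - \sum_(k < N) \sum_(j < N) X j k).
  apply: (half (fun k j => X j k)) => [m|j k].
    by have [M MP] := X0 m; exists M => j k; rewrite orbC; apply: MP.
  by rewrite orbC; apply: NP.
rewrite exchange_big /= in H1.
have := lidealB (Jl n) H1 H2.
by rewrite opprB addrA subrK.
Qed.

Lemma finite_uniform (P : nat -> nat -> Prop) M :
  (forall j i i', (i <= i')%N -> P j i -> P j i') ->
  (forall j, (j < M)%N -> exists i, P j i) ->
  exists i, forall j, (j < M)%N -> P j i.
Proof.
move=> mono; elim: M => [|M IHM] ex; first by exists 0%N.
have [i iP] := IHM (fun j ltj => ex j (ltnW ltj)).
have [i' i'P] := ex M (ltnSn M).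
exists (maxn i i') => j; rewrite ltnS leq_eqVlt => /orP [/eqP ->|/iP].
  by apply: mono i'P; apply: leq_maxr.
by apply: mono; apply: leq_maxl.
Qed.

End Sums.

Section TwistedOperators.
Variables (R : pzRingType) (sigma sigma' delta : R -> R) (J : nat -> set R).
Hypothesis fr : skew_frame sigma sigma' delta J.

Local Notation nul := (null J).
Local Notation sm := (Sum J).
Local Notation wd := (word sigma sigma' delta).

Let Jl := frJl fr.

Lemma frs_0 : sigma 0 = 0.
Proof. by apply: (@addrI _ (sigma 0)); rewrite -(frs_D fr) !addr0. Qed.

Lemma frd_0 : delta 0 = 0.
Proof. by apply: (@addrI _ (delta 0)); rewrite -(frd_D fr) !addr0. Qed.

Lemma frs'_D : {morph sigma' : x y / x + y}.
Proof.
by move=> x y; apply: (can_inj (frs_K fr)); rewrite (frs_D fr) !(frs'_K fr).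
Qed.

Lemma frs'_M : {morph sigma' : x y / x * y}.
Proof.
by move=> x y; apply: (can_inj (frs_K fr)); rewrite (frs_M fr) !(frs'_K fr).
Qed.

Lemma frs'_0 : sigma' 0 = 0.
Proof. by apply: (can_inj (frs_K fr)); rewrite (frs'_K fr) frs_0. Qed.

Lemma frs'_N x : sigma' (- x) = - sigma' x.
Proof. by apply: (@addrI _ (sigma' x)); rewrite -frs'_D !subrr frs'_0. Qed.

Lemma frs'_B : {morph sigma' : x y / x - y}.
Proof. by move=> x y; rewrite frs'_D frs'_N. Qed.

Lemma frs_cont n : exists m, forall x, J m x -> J n (sigma x).
Proof. by exists n => x; apply: (frJs fr). Qed.

Lemma frs'_cont n : exists m, forall x, J m x -> J n (sigma' x).
Proof. by exists n => x; apply: (frJs' fr). Qed.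

Lemma wordD w : {morph wd w : x y / x + y}.
Proof.
elim: w => [//|[] w IHw] x y /=; rewrite IHw;
by [rewrite (frd_D fr) | rewrite (frs_D fr) | rewrite frs'_D].
Qed.

Lemma word0 w : wd w 0 = 0.
Proof. by apply: (@addrI _ (wd w 0)); rewrite -wordD !addr0. Qed.

Lemma wordB w x y : wd w (x - y) = wd w x - wd w y.
Proof. by apply: (@addIr _ (wd w y)); rewrite -wordD !subrK. Qed.

Lemma word_rcons w l x :
  wd (rcons w l) x = wd w (match l with
    Yletter => delta x | Zletter => sigma x | Z'letter => sigma' x end).
Proof. by rewrite /word foldr_rcons; case: l. Qed.

Lemma count_rcons_Y w l : count is_Y (rcons w l) = (count is_Y w + is_Y l)%N.
Proof. by rewrite -cats1 count_cat /= addn0. Qed.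

Lemma word_bounded_small c n : exists m, forall w x,
  (count is_Y w <= c)%N -> J m x -> J n (wd w x).
Proof.
elim: c n => [|c IHc] n.
  exists n => w x; elim: w => [//|[] w IHw] //= cw Jx.
    by apply: (frJs fr); apply: IHw.
  by apply: (frJs' fr); apply: IHw.
have [n1 n1P] := frJd fr n; have [m mP] := IHc n1.
have [m0 m0P] := IHc n.
exists (maxn m m0) => w x.
have Jm y : J (maxn m m0) y -> J m y by apply: (frJ_le fr); apply: leq_maxl.
have Jm0 y : J (maxn m m0) y -> J m0 y by apply: (frJ_le fr); apply: leq_maxr.
elim: w => [_ /Jm0 /(m0P [::] x) H|[] w IHw] //=; first exact: H.
- by rewrite add1n ltnS => cw /Jm Jx; apply: n1P; apply: mP.
- by rewrite add0n => cw Jx; apply: (frJs fr); apply: IHw.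
by rewrite add0n => cw Jx; apply: (frJs' fr); apply: IHw.
Qed.

(** Equicontinuity of all words at once: a word with many letters [delta] has small values anyway,
    and one with few is handled by continuity of [delta], the letters [sigma] and [sigma']
    preserving each [J n]. *)
Lemma word_small n : exists m, forall w x, J m x -> J n (wd w x).
Proof.
have [c cP] := frnil fr n; have [m mP] := word_bounded_small c n.
exists m => w x Jx; have [lecw|/ltnW lewc] := leqP c (count is_Y w).
  exact: cP.
exact: mP.
Qed.

(** For the series with right expansion [\sum_k t ^+ k * sigma (b k)] this is right multiplication
    by [t], as [sigma b * t = t * b - delta b]. *)
Definition shift_twist (b : nat -> R) (k : nat) : R :=
  sigma' ((if k is j.+1 then b j else 0) - delta (b k)).

Local Notation tau := shift_twist.

(** Unfolding [j] applications of [tau] at index [k], each one either lowers the index by one or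
    contributes a [delta]. A term ending at an index at least [K], where [b] may be nonzero, used at
    most [k - K] shifts and so carries at least [j + K - k] letters [delta]. *)
Lemma shift_twist_small n m K b :
  (forall w, (m <= count is_Y w)%N -> forall a, J n (wd w a)) ->
  (forall k, (k < K)%N -> b k = 0) ->
  forall j w k, (m + k <= count is_Y w + j + K)%N ->
    J n (wd w (iter j tau b k)).
Proof.
move=> mP b0; elim=> [|j IHj] w k.
  rewrite addn0 => le; have [/b0 bk0|leKk] := ltnP k K.
    by rewrite /= bk0 word0; apply: (lideal0 (Jl n)).
  apply: mP; rewrite -(leq_add2r K) (leq_trans _ le) //.
  by rewrite leq_add2l.
move=> le; rewrite iterS /shift_twist.
have -> x y : wd w (sigma' (x - delta y)) =
    wd (rcons w Z'letter) x - wd (rcons (rcons w Z'letter) Yletter) y.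
  by rewrite !word_rcons frs'_B wordB.
apply: (lidealB (Jl n)).
  case: k le => [_|k le]; first by rewrite word0; apply: (lideal0 (Jl n)).
  apply: IHj; rewrite count_rcons_Y /= addn0.
  by move: le; rewrite !addnS addSn ltnS.
by apply: IHj; rewrite !count_rcons_Y /= addn0 addn1 (leq_trans le) // addnS addSn.
Qed.

Lemma iter_shift_twist_small n : exists m, forall b j k,
  (m + k <= j)%N -> J n (iter j tau b k).
Proof.
have [m mP] := frnil fr n; exists m => b j k le.
by apply: (@shift_twist_small n m 0%N b mP _ j [::] k); rewrite //= add0n addn0.
Qed.

Section Functions.
Variables (P : Type) (tp : P -> P).
Implicit Types (f g : P -> R) (b c : nat -> R).

Definition Top (f : P -> R) : P -> R := fun p => sigma' (f (tp p) - delta (f p)).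

Lemma TopP f p : f (tp p) = sigma (Top f p) + delta (f p).
Proof. by rewrite /Top (frs'_K fr) subrK. Qed.

Lemma TopD f g : Top (f + g) = Top f + Top g.
Proof.
apply/funext => p; rewrite /Top -[(f + g) _]/(f _ + g _) -[(f + g) p]/(f _ + g _).
by rewrite (frd_D fr) opprD addrACA frs'_D.
Qed.

Lemma Top0 : Top 0 = 0.
Proof. by apply: (@addrI _ (Top 0)); rewrite -TopD !addr0. Qed.

Lemma TopB f g : Top (f - g) = Top f - Top g.
Proof. by apply: (@addIr _ (Top g)); rewrite -TopD !subrK. Qed.

Lemma iter_TopB i f g : iter i Top (f - g) = iter i Top f - iter i Top g.
Proof. by elim: i => //= i ->; rewrite TopB. Qed.

Definition vanishing (f : P -> R) :=
  forall n, exists N, forall i, (N <= i)%N -> forall p, J n (iter i Top f p).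

(* For [x = \sum_k t ^+ k * a k] this is [f^x], with [b k = sigma' (a k)]. *)
Definition theta (f : P -> R) (b : nat -> R) : P -> R :=
  fun p => sm (fun k => iter k Top f p * b k).

Lemma vanishing_null f p : vanishing f -> nul (fun k => iter k Top f p).
Proof. by move=> vf n; have [N NP] := vf n; exists N => k Nk; apply: NP. Qed.

Lemma theta_null f b p : vanishing f -> nul (fun k => iter k Top f p * b k).
Proof. by move=> /vanishing_null vf; apply: (null_mulr fr); apply: vf. Qed.

Lemma vanishing0 : vanishing 0.
Proof.
move=> n; exists 0%N => i _ p; suff -> : iter i Top 0 = 0.
  exact: (lideal0 (Jl n)).
by elim: i => //= i ->; rewrite Top0.
Qed.

Lemma thetaB f g b : vanishing f -> vanishing g ->
  theta (f - g) b = theta f b - theta g b.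
Proof.
move=> vf vg; apply/funext => p; rewrite -[RHS]/(theta f b p - theta g b p).
rewrite /theta (SumB fr); [|exact: theta_null..].
apply: eq_Sum => k; rewrite iter_TopB -mulrBl.
by [].
Qed.

Lemma theta0 b : theta 0 b = 0.
Proof.
have := thetaB b vanishing0 vanishing0.
by rewrite subrr => ->; rewrite subrr.
Qed.

Lemma thetaDr f b c : vanishing f ->
  theta f (fun k => b k + c k) = theta f b + theta f c.
Proof.
move=> vf; apply/funext => p; rewrite -[RHS]/(theta f b p + theta f c p).
rewrite /theta (SumD fr); [|exact: theta_null..].
by apply: eq_Sum => k; rewrite mulrDr.
Qed.

Lemma thetaBr f b c : vanishing f ->
  theta f (fun k => b k - c k) = theta f b - theta f c.
Proof.
move=> vf; apply/funext => p; rewrite -[RHS]/(theta f b p - theta f c p).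
rewrite /theta (SumB fr); [|exact: theta_null..].
by apply: eq_Sum => k; rewrite mulrBr.
Qed.

Definition delta_seq (j : nat) (c : R) (k : nat) : R := if k == j then c else 0.

Lemma theta_delta f j (c : R) : theta f (delta_seq j c) = fun p => iter j Top f p * c.
Proof.
apply/funext => p; rewrite /theta (@Sum_finite R _ _ _ J fr _ j.+1).
  rewrite /psum big_ord_recr /= /delta_seq eqxx big1 ?add0r // => i _.
  by rewrite ltn_eqF ?mulr0.
by move=> i ltji; rewrite /delta_seq gtn_eqF ?mulr0.
Qed.

(** This is the rule that acting by [x] and then by [t] is acting by [x * t]. In each term the
    summand [delta (iter k Top f p) * b k] appears twice and cancels by the skew Leibniz rule; an
    index shift of the first part then produces [tau b]. *)
Lemma Top_theta f b : vanishing f -> Top (theta f b) = theta f (tau b).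
Proof.
move=> vf; apply/funext => p; rewrite /Top /theta.
have n1 c q : nul (fun k => iter k.+1 Top f q * c k).
  by apply: (null_mulr fr); exact: (null_shift (vanishing_null q vf)).
have nd : nul (fun k => delta (iter k Top f p * b k)).
  by apply: (null_map (frJd fr)); apply: theta_null.
rewrite (Sum_map fr (frd_D fr) (frJd fr)); last exact: theta_null.
rewrite (SumB fr) //; last exact: theta_null.
rewrite (Sum_map fr frs'_D frs'_cont); last first.
  by apply: (nullB fr) => //; apply: theta_null.
have E k : sigma' (iter k Top f (tp p) * b k - delta (iter k Top f p * b k)) =
    iter k.+1 Top f p * sigma' (b k) - iter k Top f p * sigma' (delta (b k)).
  rewrite TopP -iterS (frd_M fr) mulrDl [X in _ - X]addrC opprD addrACA subrr addr0.
  by rewrite frs'_B !frs'_M !(frs_K fr).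
rewrite (eq_Sum _ E) -(SumB fr) //; last exact: theta_null.
have -> : sm (fun k => iter k.+1 Top f p * sigma' (b k)) =
    sm (fun k => iter k Top f p * sigma' (if k is j.+1 then b j else 0)).
  by rewrite [RHS](Sum_recl fr) ?frs'_0 ?mulr0 ?add0r //; apply: theta_null.
rewrite (SumB fr); [|exact: theta_null..].
by apply: eq_Sum => k; rewrite -mulrBr -frs'_B.
Qed.

Lemma iter_Top_theta j f b :
  vanishing f -> iter j Top (theta f b) = theta f (iter j tau b).
Proof. by move=> vf; elim: j => //= j ->; rewrite Top_theta. Qed.

Lemma iter_prod_small f n : vanishing f -> exists N, forall j k b p,
  (N <= j)%N || (N <= k)%N -> J n (iter k Top f p * iter j tau b k).
Proof.
move=> vf; have [N1 N1P] := vf n; have [m mP] := iter_shift_twist_small n.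
exists (m + N1)%N => j k b p; have [N1k _|ltkN1] := leqP N1 k.
  by apply: (frJr fr); apply: N1P.
rewrite [(_ <= k)%N]leqNgt (leq_trans ltkN1) ?leq_addl //= orbF => Nj.
apply: (lidealM (Jl n)); apply: mP; apply: leq_trans Nj.
by rewrite leq_add2l ltnW.
Qed.

Lemma vanishing_theta f b : vanishing f -> vanishing (theta f b).
Proof.
move=> vf n; have [N NP] := iter_prod_small n vf.
exists N => j Nj p; rewrite iter_Top_theta //.
by apply: (Sum_J fr); [apply: theta_null | move=> k; apply: NP; rewrite Nj].
Qed.

(* The product of power series with right coefficients [sigma (b k)] and
   [sigma (c k)], up to [sigma']. *)
Definition star (b c : nat -> R) (k : nat) : R :=
  sm (fun j => iter j tau b k * c j).

Lemma star_null b c k : nul (fun j => iter j tau b k * c j).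
Proof.
apply: (null_mulr fr) => n; have [m mP] := iter_shift_twist_small n.
by exists (m + k)%N => j; apply: mP.
Qed.

Lemma theta_theta f b c : vanishing f ->
  theta (theta f b) c = theta f (star b c).
Proof.
move=> vf; apply/funext => p; rewrite /theta.
have -> : (fun k => iter k Top (theta f b) p * c k) =
    fun j => sm (fun k => iter k Top f p * iter j tau b k * c j).
  apply/funext => j; rewrite iter_Top_theta // /theta (Sum_mulr fr) //.
  exact: theta_null.
rewrite (Sum_exchange fr) => [|n].
  apply: eq_Sum => k; rewrite /star (Sum_mull fr); last exact: star_null.
  by apply: eq_Sum => j; rewrite mulrA.
have [N NP] := iter_prod_small n vf.
by exists N => j k H; apply: (frJr fr); apply: NP.
Qed.

End Functions.

Section Resolvent.
Variables (beta : nat -> R) (K : nat).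
Hypothesis Kbig : forall w, (K <= count is_Y w)%N -> forall a, J 1%N (wd w a).
Hypothesis beta0 : forall k, (k < K)%N -> beta k = 0.

(* Modulo [J 1] the matrix of [star beta] is strictly triangular. *)
Lemma iter_star_small n l : exists i0, forall i x, (i0 <= i)%N ->
  J n (iter i (star beta) x l).
Proof.
elim: n l => [|n IHn] l; first by exists 0%N => i x _; apply: (frJ0 fr).
elim/ltn_ind: l => l IHl.
have [m mP] := iter_shift_twist_small n.+1.
pose Q j i0 := forall i x, (i0 <= i)%N ->
  J n.+1 (iter j tau beta l * iter i (star beta) x j).
have [|j _|i0 i0P] := @finite_uniform Q (m + l)%N.
- by move=> j i i' le H k x le'; apply: H; apply: leq_trans le'.
(* For [j < l] the inner induction applies at the same level. For [l <= j] the coefficient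
   [iter j tau beta l] lies in [J 1], so it raises the level [n] of the outer hypothesis by one. *)
- have [/IHl [i iP]|lelj] := ltnP j l.
    by exists i => k x le; apply: (lidealM (Jl _)); apply: iP.
  have [i iP] := IHn j; exists i => k x le; apply: (frJM fr); last exact: iP.
  apply: (shift_twist_small Kbig beta0 (w := [::])).
  by rewrite /= add0n addnC leq_add2r.
exists i0.+1 => -[//|i] x le; rewrite iterS.
apply: (Sum_J fr); first exact: star_null.
move=> j; have [/i0P|lej] := ltnP j (m + l)%N; first exact.
by apply: (frJr fr); apply: mP.
Qed.

(** The Neumann series [\sum_i x ^+ i], whose sum [y] satisfies [y - x * y = 1]. *)
Definition resolvent (l : nat) : R :=
  sm (fun i => iter i (star beta) (delta_seq 0 1) l).

Lemma resolventP l :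
  resolvent l - star beta resolvent l = delta_seq 0 1 l.
Proof.
have nu k : nul (fun i => iter i (star beta) (delta_seq 0 1) k).
  by move=> n; have [i0 i0P] := iter_star_small n k; exists i0 => i; apply: i0P.
have -> : star beta resolvent l =
    sm (fun i => iter i.+1 (star beta) (delta_seq 0 1) l).
  rewrite {1}/star /resolvent.
  under eq_Sum => j do rewrite (Sum_mull fr _ (nu j)).
  rewrite (Sum_exchange fr) // => n.
  have [m mP] := iter_shift_twist_small n.
  pose Q j i0 := forall i, (i0 <= i)%N ->
    J n (iter i (star beta) (delta_seq 0 1) j).
  have [|j _|i0 i0P] := @finite_uniform Q (m + l)%N.
  - by move=> j i i' le H k le'; apply: H; apply: leq_trans le'.
  - by have [i iP] := iter_star_small n j; exists i => k; apply: iP.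
  exists (m + l + i0)%N => j i; have [ltj|lej _] := ltnP j (m + l)%N.
    rewrite [(_ <= j)%N]leqNgt (leq_trans ltj) ?leq_addr //= => lei.
    apply: (lidealM (Jl n)); apply: i0P => //.
    by apply: leq_trans lei; apply: leq_addl.
  by apply: (frJr fr); apply: mP.
by rewrite {1}/resolvent (Sum_recl fr) // addrK.
Qed.

End Resolvent.

(** * Compatible sequences of functions modulo a stable subgroup *)

Section Limit.
Variables (P : Type) (tp : P -> P).
Local Notation T := (Top tp).
Variable Bd : (P -> R) -> Prop.
Hypothesis Bd0 : Bd 0.
Hypothesis Bd_sub : forall f g, Bd f -> Bd g -> Bd (f - g).
Hypothesis Bd_theta : forall f b, Bd f -> Bd (theta tp f b).

Lemma Bd_add f g : Bd f -> Bd g -> Bd (f + g).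
Proof.
by move=> Bf Bg; rewrite -[g]opprK -[- g]sub0r; apply/Bd_sub => //; apply: Bd_sub.
Qed.

(* [theta f beta] is [f^x] for a series [x] divisible by [t ^+ K]; the resolvent
   inverts [1 - x]. *)
Lemma theta_absorb f beta K :
  (forall w, (K <= count is_Y w)%N -> forall a, J 1%N (wd w a)) ->
  (forall k, (k < K)%N -> beta k = 0) -> vanishing tp f ->
  Bd (f - theta tp f beta) -> Bd f.
Proof.
move=> Kb b0 vf Bf.
suff -> : f = theta tp (f - theta tp f beta) (resolvent beta) by apply: Bd_theta.
rewrite thetaB //; last exact: vanishing_theta.
rewrite theta_theta // -thetaBr // (funext (resolventP Kb b0)).
by rewrite theta_delta; apply/funext => p; rewrite mulr1.
Qed.

(* A relation [f N = \sum_(l < b) f l * c l] modulo [Bd] with [N] large reads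
   [f N = theta (f N) beta], as [f l] is an iterate of [T] at [f N]. *)
Lemma limit_absorb (f : nat -> P -> R) :
  (forall n, vanishing tp (f n)) -> (forall n, Bd (f n - T (f n.+1))) ->
  (exists b, forall n, exists c : 'I_b -> R,
     Bd (f n - fun p => \sum_(l < b) f l p * c l)) ->
  forall n, Bd (f n).
Proof.
move=> vf cf [b bP] n.
have BdT g : Bd g -> Bd (T g).
  move=> Bg; have := Bd_theta (delta_seq 1 1) Bg.
  by rewrite theta_delta; congr Bd; apply/funext => p; rewrite mulr1.
have BT k i : Bd (f i - iter k T (f (i + k)%N)).
  elim: k i => [|k IHk] i; first by rewrite addn0 subrr.
  rewrite -(subrK (T (f i.+1)) (f i)) -addrA; apply: Bd_add => //.
  by rewrite iterS -TopB addnS -addSn; apply: BdT.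
have [K KP] := frnil fr 1%N.
(* For [l < b] one has [N - l > K], so the series below is divisible by the required power of [t];
   and [n <= N] makes [f n] an iterate of [T] at [f N] modulo [Bd]. *)
pose N := (b + K + n)%N; have [c cP] := bP N.
suff BN : Bd (f N).
  have := BT (N - n)%N n; rewrite subnKC ?leq_addl // => H.
  rewrite -(subrK (iter (N - n) T (f N)) (f n)); apply: Bd_add => //.
  by elim: (N - n)%N => //= k IHk; apply: BdT.
pose be l := delta_seq (N - l) (if insub l is Some i then c i else 0).
pose beta M k := \sum_(l < M) be l k.
have betaE M : theta tp (f N) (beta M) =
    fun p => \sum_(l < M) theta tp (f N) (be l) p.
  elim: M => [|M IHM].
    have -> : beta 0%N = fun k => 0 - 0.
      by apply/funext => k; rewrite /beta big_ord0 subr0.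
    rewrite thetaBr // subrr; apply/funext => p; rewrite big_ord0.
    by [].
  have -> : beta M.+1 = fun k => beta M k + be M k.
    by apply/funext => k; rewrite /beta big_ord_recr.
  rewrite thetaDr // IHM; apply/funext => p; rewrite big_ord_recr.
  by [].
apply: (@theta_absorb _ (beta b) K KP) => // [k ltkK|].
  rewrite /beta big1 // => l _; rewrite /be /delta_seq ltn_eqF //.
  rewrite ltn_subRL; apply: (@leq_trans (b + K)%N); last exact: leq_addr.
  by rewrite -addSn leq_add // ltnW.
rewrite betaE -[X in Bd X](subrKA (fun p => \sum_(l < b) f l p * c l)).
apply: Bd_add => //.
have Bsum M (g : nat -> P -> R) : (forall l, (l < M)%N -> Bd (g l)) ->
    Bd (fun p => \sum_(l < M) g l p).
  elim: M => [|M IHM] Bg.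
    by congr Bd : Bd0; apply/funext => p; rewrite big_ord0.
  have -> : (fun p => \sum_(l < M.+1) g l p) =
      (fun p => \sum_(l < M) g l p) + g M.
    by apply/funext => p; rewrite big_ord_recr.
  by apply: Bd_add; [apply: IHM => l ltl; apply: Bg; apply: ltnW | apply: Bg].
pose g l := theta tp (f l - iter (N - l) T (f N))
  (delta_seq 0 (if insub l is Some i then c i else 0)).
have -> : (fun p => \sum_(l < b) f l p * c l) -
    (fun p => \sum_(l < b) theta tp (f N) (be l) p) = fun p => \sum_(l < b) g l p.
  apply/funext => p; rewrite -[LHS]/(_ p - _ p) /= -sumrB; apply: eq_bigr => l _.
  rewrite /be /g !theta_delta /= -[(_ - iter _ _ _) p]/(_ p - _ p) mulrBl.
  by rewrite insubT //= => ltl; congr (_ * c _ - _ * c _); apply: val_inj.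
apply: (Bsum b g) => l ltl; apply: Bd_theta.
have := BT (N - l)%N l; rewrite subnKC //.
by rewrite /N; apply: leq_trans (ltnW ltl) _; rewrite -addnA leq_addr.
Qed.

End Limit.

End TwistedOperators.

(** * Skew power series *)

(* The series [x] with coefficients [coef x], through the multiplications by
   constants and by [t] only. *)
Record series_frame (R S : pzRingType) (sigma sigma' delta : R -> R)
    (J : nat -> set R) (C : R -> S) (t : S) (coef : S -> nat -> R) : Prop :=
  SeriesFrame {
  srB : bijective coef ;
  srD : forall x y i, coef (x + y) i = coef x i + coef y i ;
  srC : forall a x i, coef (C a * x) i = a * coef x i ;
  srC1 : forall a i, coef (C a) i = if i == 0%N then a else 0 ;
  srt : forall x i, coef (t * x) i =
    sigma (if i is j.+1 then coef x j else 0) + delta (coef x i) ;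
  srM : forall y n, exists m, forall x,
    (forall i, (i < m)%N -> J m (coef x i)) ->
    forall i, (i < n)%N -> J n (coef (x * y) i) }.

Definition coef_ball (R S : Type) (J : nat -> set R) (coef : S -> nat -> R)
    (n : nat) : set S :=
  [set x | forall i, (i < n)%N -> J n (coef x i)].

Section SeriesFrame.
Variables (R S : uniformRing) (sigma : {rmorphism R -> R}) (sigma' : R -> R).
Variables (delta : {additive R -> R}).
Variables (C : {rmorphism R -> S}) (t : S) (coef : S -> nat -> R).
Hypotheses (pcR : left_pseudocompact_ring R) (noethR : noetherian_ring R).
Hypothesis hS : skew_power_series sigma delta C t coef.

Local Notation J := (@Rpow R).
Local Notation ball := (coef_ball J coef).

Lemma coef0 i : coef 0 i = 0.
Proof. by apply: (@addrI _ (coef 0 i)); rewrite -(sps_add hS) !addr0. Qed.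

Lemma ball_nbhs n : nbhs 0 (ball n).
Proof.
suff H k : nbhs 0 [set x : S | forall i, (i < k)%N -> J n (coef x i)] by apply: H.
elim: k => [|k IHk]; first by apply: filterS filterT.
have : nbhs 0 [set x : S | J n (coef x k)].
  have := Rpow_nbhs pcR noethR n; rewrite nbhsE => -[O [oO O0] OJ].
  rewrite nbhsE; exists (coef @^-1` (proj k @^-1` O)); last by move=> x /OJ.
  split; last by rewrite /= /proj coef0.
  apply/(sps_top hS); exists (proj k @^-1` O) => //.
  have ck := @proj_continuous nat (fun _ => R : topologicalType) k.
  exact: ((@continuousP (prod_topology (fun _ : nat => R)) R (proj k)).1 ck O oO).
move=> H; apply: filterS (filterI H IHk) => x [/= Jk IH] i.
by rewrite ltnS leq_eqVlt => /orP [/eqP ->|/IH].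
Qed.

Lemma nbhs_ball (U : set S) : nbhs 0 U -> exists n, ball n `<=` U.
Proof.
have Jl n : left_ideal (J n) := radical_pow_left (@open_ideals R) n.
rewrite nbhsE => -[U' [/(sps_top hS) [V oV ->]] V0 UU].
pose F := filter_from [set: nat]
  (fun n => [set b : nat -> R | forall i, (i < n)%N -> J n (b i)]).
have Jle m n : (m <= n)%N -> J n `<=` J m.
  elim: n => [|n IHn]; first by rewrite leqn0 => /eqP ->.
  rewrite leq_eqVlt => /orP [/eqP -> //|ltmn] x.
  by move=> /(@radical_powS R (@open_ideals R)); apply: IHn.
have FF : Filter F.
  apply: filter_fromT_filter; first by exists 0%N.
  move=> m n; exists (maxn m n) => b Jb; split => i lei.
    by apply: Jle (Jb i _); [apply: leq_maxl | rewrite leq_max lei].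
  by apply: Jle (Jb i _); [apply: leq_maxr | rewrite leq_max lei orbT].
have : F --> ((coef 0) : prod_topology (fun _ : nat => R)).
  apply/cvg_sup => i A [B [[O oO <-] Oi] BA].
  apply: filterS BA _.
  have : nbhs 0 O.
    by rewrite /= coef0 in Oi; apply: open_nbhs_nbhs.
  move=> /(Rpow_base pcR) [n nO].
  exists (maxn n i.+1) => // b /= Jb; apply: nO.
  by apply: Jle (Jb i _); [apply: leq_maxl | apply: leq_maxr].
move=> /(_ V) [|n _ nV]; first by apply: open_nbhs_nbhs.
by exists n => x bx; apply: UU; apply: nV.
Qed.

Lemma series_cvg (u : nat -> S) (x : S) :
  u @ \oo --> x <-> forall n, exists N, forall k, (N <= k)%N -> ball n (u k - x).
Proof.
split=> [ux n|ux U].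
  have : nbhs x [set y | ball n (y - x)].
    apply/nbhs_translate; apply: filterS (ball_nbhs n) => y /=.
    by rewrite addrC addKr.
  by move=> /ux [N _ NP]; exists N => k Nk; apply: NP.
move=> /nbhs_translate /nbhs_ball [n nU]; have [N NP] := ux n.
by exists N => // k Nk; have := nU _ (NP k Nk); rewrite /= addrC subrK.
Qed.

Hypothesis fr : skew_frame sigma sigma' delta J.

Let Jl := frJl fr.

Local Notation M := (monomial_sum sigma delta).

Lemma monomial_sum_small n : exists m, forall k l b, (m <= k)%N -> J n (M k l b).
Proof.
have [m mP] := frnil fr n; exists m => k l b lemk.
apply: (lideal_sum (Jl n)) => w /eqP cw.
have := mP [seq if y then Yletter else Zletter | y <- w].
rewrite count_map (eq_count (a2 := id)); last by case.
rewrite cw => /(_ lemk b); congr J.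
by rewrite /word; elim: (tval w) => //= y s ->; case: y.
Qed.

Lemma monomial_sum00 b : M 0 0 b = b.
Proof.
rewrite /monomial_sum (big_pred1 [tuple]) //= => w.
by rewrite (tuple0 w).
Qed.

Lemma monomial_sum10 b : M 1 0 b = delta b.
Proof.
rewrite /monomial_sum (big_pred1 [tuple true]) //= => w.
by case/tupleP: w => x w; rewrite (tuple0 w); case: x.
Qed.

Lemma monomial_sum01 b : M 0 1 b = sigma b.
Proof.
rewrite /monomial_sum (big_pred1 [tuple false]) //= => w.
by case/tupleP: w => x w; rewrite (tuple0 w); case: x.
Qed.

Let part x y m N := \sum_(n < m.+1) \sum_(n <= j < N)
  coef x j * M (j - n)%N n (coef y (m - n)%N).

Lemma coef_mul_unique x y m l :
  (exists N0, forall N, (N0 <= N)%N -> part x y m N = l) -> coef (x * y) m = l.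
Proof.
move=> [N0 N0P]; have lim := (Rpow_cvg pcR noethR (part x y m) _).1 (@sps_mul _ _ _ _ _ _ _ hS x y m).
apply: (conv_unique fr lim) => n; exists N0 => N /N0P.
by rewrite /part => ->; rewrite subrr; apply: (lideal0 (Jl n)).
Qed.

Lemma coef_mul_small x y m n :
  (forall N, J n (part x y m N)) -> J n (coef (x * y) m).
Proof.
move=> H; have lim := (Rpow_cvg pcR noethR (part x y m) _).1 (@sps_mul _ _ _ _ _ _ _ hS x y m).
have [N NP] := lim n; have := lidealB (Jl n) (H N) (NP N (leqnn N)).
by rewrite subKr.
Qed.

Lemma series : series_frame sigma sigma' delta J C t coef.
Proof.
split.
- exact: (sps_bij hS).
- exact: (sps_add hS).
- move=> a x m; apply: coef_mul_unique; exists 1%N => N N1; rewrite /part.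
  have E (n : 'I_m.+1) : \sum_(n <= j < N) coef (C a) j * M (j - n) n (coef x (m - n)) =
      if n == 0%N :> nat then a * coef x m else 0.
    pose g j := a * M (j - n) n (coef x (m - n)).
    rewrite (eq_bigr (fun j => if j == 0%N then g j else 0)); last first.
      by move=> j _; rewrite (sps_C hS) /g; case: (j == 0%N); rewrite ?mul0r.
    rewrite -big_mkcond big_nat1_eq leqn0 N1 andbT; case: eqP => // n0.
    by rewrite /g n0 monomial_sum00 subn0.
  rewrite (eq_bigr _ (fun n _ => E n)) big_ord_recl /= big1 ?addr0 // => i _.
- exact: (sps_C hS).
- move=> x m; apply: coef_mul_unique; exists 2%N => N N2; rewrite /part.
  have E (n : 'I_m.+1) : \sum_(n <= j < N) coef t j * M (j - n) n (coef x (m - n)) =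
      if (n <= 1)%N then M (1 - n)%N n (coef x (m - n)) else 0.
    pose g j := M (j - n) n (coef x (m - n)).
    rewrite (eq_bigr (fun j => if j == 1%N then g j else 0)); last first.
      by move=> j _; rewrite (sps_t hS) /g; case: (j == 1%N); rewrite ?mul0r ?mul1r.
    by rewrite -big_mkcond big_nat1_eq N2 andbT.
  rewrite (eq_bigr _ (fun n _ => E n)) big_ord_recl /= !subn0 monomial_sum10.
  rewrite addrC; congr (_ + _).
  case: m E => [|m] _; first by rewrite big_ord0 rmorph0.
  rewrite big_ord_recl /= monomial_sum01 subn1 /= big1 ?addr0 // => i _.
(* In coefficient [i < n] the terms with [j >= n + m0] involve at least [m0] letters [delta],
   whatever [x] is; the others are small because the coefficients of [x] of index below [n + m0]
   are. *)
- move=> y n; have [m0 m0P] := monomial_sum_small n.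
  exists (n + m0)%N => x bx i ltin; apply: coef_mul_small => N.
  apply: (lideal_sum (Jl n)) => k _; rewrite big_nat; apply: (lideal_sum (Jl n)) => j /andP [kj _].
  have [ltj|lej] := ltnP j (n + m0)%N.
    by apply: (frJr fr); apply: (frJ_le fr) (bx j ltj); apply: leq_addr.
  apply: (lidealM (Jl n)); apply: m0P; rewrite leq_subRL // (leq_trans _ lej) //.
  by rewrite leq_add2r (leq_trans _ (ltnW ltin)) // -ltnS.
Qed.

End SeriesFrame.

Section RightExpansion.
Variables (R S : pzRingType) (sigma sigma' delta : R -> R) (J : nat -> set R).
Variables (C : {rmorphism R -> S}) (t : S) (coef : S -> nat -> R).
Hypothesis fr : skew_frame sigma sigma' delta J.
Hypothesis sf : series_frame sigma sigma' delta J C t coef.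

Local Notation wd := (word sigma sigma' delta).
Local Notation nul := (null J).
Local Notation sm := (Sum J).
Local Notation ball := (coef_ball J coef).

Let Jl := frJl fr.

Lemma series_inj x y : (forall i, coef x i = coef y i) -> x = y.
Proof. by move=> E; apply: (bij_inj (srB sf)); apply/funext. Qed.

Definition series_of (a : nat -> R) : S := xget 0 [set x | coef x = a].

Lemma coef_series_of a i : coef (series_of a) i = a i.
Proof.
have [g _ gK] := srB sf.
have : [set x | coef x = a] (series_of a) by apply: xgetPex; exists (g a); apply: gK.
by move=> /= ->.
Qed.

Lemma scoef0 i : coef 0 i = 0.
Proof. by apply: (@addrI _ (coef 0 i)); rewrite -(srD sf) !addr0. Qed.

Lemma scoefN x i : coef (- x) i = - coef x i.
Proof. by apply: (@addrI _ (coef x i)); rewrite -(srD sf) !subrr scoef0. Qed.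

Lemma scoefB x y i : coef (x - y) i = coef x i - coef y i.
Proof. by rewrite (srD sf) scoefN. Qed.

Lemma scoef_sum (I : Type) (r : seq I) (P : pred I) (F : I -> S) i :
  coef (\sum_(j <- r | P j) F j) i = \sum_(j <- r | P j) coef (F j) i.
Proof.
by apply: (big_morph (coef^~ i)); [move=> x y; apply: (srD sf) | apply: scoef0].
Qed.

Lemma coef_ballB n x y : ball n x -> ball n y -> ball n (x - y).
Proof.
by move=> bx b_y i ltin; rewrite scoefB; apply: (lidealB (Jl n)); [apply: bx | apply: b_y].
Qed.

Lemma coef_ball0 n : ball n 0.
Proof. by move=> i _; rewrite scoef0; apply: (lideal0 (Jl n)). Qed.

Lemma coef_ballD n x y : ball n x -> ball n y -> ball n (x + y).
Proof.
by move=> bx b_y i ltin; rewrite (srD sf); apply: (lidealD (Jl n)); [apply: bx | apply: b_y].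
Qed.

Lemma coef_ball_sum n (I : Type) (r : seq I) (F : I -> S) :
  (forall i, ball n (F i)) -> ball n (\sum_(i <- r) F i).
Proof.
move=> bF; apply: (big_ind (ball n)) => // [|x y]; first exact: coef_ball0.
exact: coef_ballD.
Qed.

Lemma coef_ball_le m n x : (m <= n)%N -> ball n x -> ball m x.
Proof.
move=> lemn bx i ltim; apply: (frJ_le fr lemn); apply: bx.
exact: leq_trans ltim lemn.
Qed.

Lemma coef_ball_t n : exists m, forall x, ball m x -> ball n (t * x).
Proof.
have [m mP] := frJd fr n; exists (maxn m n) => x bx i ltin; rewrite (srt sf).
have Jx k : (k < n)%N -> J (maxn m n) (coef x k).
  by move=> ltk; apply: bx; rewrite leq_max ltk orbT.
apply: (lidealD (Jl n)).
  apply: (frJs fr); case: i ltin => [_|i ltin]; first exact: (lideal0 (Jl n)).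
  by apply: (frJ_le fr (leq_maxr m n)); apply: Jx; apply: ltnW.
by apply: mP; apply: (frJ_le fr (leq_maxl m n)); apply: Jx.
Qed.

(** Same count as in [shift_twist_small]: each factor [t] either lowers the index [q] or adds a
    letter [delta] to the word. *)
Lemma coef_tpow_word n m : (forall w, (m <= count is_Y w)%N -> forall a, J n (wd w a)) ->
  forall j w q x, (m + q <= count is_Y w + j)%N -> J n (wd w (coef (t ^+ j * x) q)).
Proof.
move=> mP; elim=> [|j IHj] w q x le.
  by apply: mP; rewrite addn0 in le; apply: leq_trans le; apply: leq_addr.
rewrite exprS -mulrA (srt sf) (wordD fr); apply: (lidealD (Jl n)).
  case: q le => [_|q le].
    by rewrite (frs_0 fr) (word0 fr); apply: (lideal0 (Jl n)).
  have -> y : wd w (sigma y) = wd (rcons w Zletter) y by rewrite word_rcons.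
  by apply: IHj; rewrite count_rcons_Y addn0; move: le; rewrite !addnS ltnS.
have -> y : wd w (delta y) = wd (rcons w Yletter) y by rewrite word_rcons.
by apply: IHj; rewrite count_rcons_Y addn1 addSn -addnS.
Qed.

Lemma tpow_ball n : exists m, forall j x, (m <= j)%N -> ball n (t ^+ j * x).
Proof.
have [m mP] := frnil fr n; exists (m + n)%N => j x le q ltq.
apply: (coef_tpow_word mP (w := [::])); rewrite /= add0n.
by apply: leq_trans le; rewrite leq_add2l ltnW.
Qed.

Let negop z := - sigma' (delta z).

Lemma negop_small n : exists m, forall k z, (m <= k)%N -> J n (iter k negop z).
Proof.
have [m mP] := frnil fr n.
suff H k w z : (m <= count is_Y w + k)%N -> J n (wd w (iter k negop z)).
  by exists m => k z le; apply: (H k [::]).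
elim: k w z => [|k IHk] w z le; first by apply: mP; rewrite addn0 in le.
rewrite iterS /negop -[- _]sub0r (wordB fr) (word0 fr) sub0r -mulN1r.
have -> y : wd w (sigma' (delta y)) = wd (rcons (rcons w Z'letter) Yletter) y.
  by rewrite !word_rcons.
apply: (lidealM (Jl n)); apply: IHk.
by rewrite !count_rcons_Y addn0 addn1 addSn -addnS.
Qed.

Lemma negop_null (u : nat -> R) : nul (fun k => iter k negop (u k)).
Proof. by move=> n; have [m mP] := negop_small n; exists m => k; apply: mP. Qed.

(** The quotient [y] in [x = C a + t * y]. Comparing coefficients gives [y_n = sigma' x_(n+1) -
    sigma' (delta y_(n+1))], a recursion running upwards in [n]; substituting it into itself forever
    yields this series, which converges by sigma-nilpotency. *)
Definition left_div (x : S) : S :=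
  series_of (fun n => sm (fun k => iter k negop (sigma' (coef x (n + k).+1)))).

Lemma coef_left_div x n :
  coef x n.+1 = sigma (coef (left_div x) n) + delta (coef (left_div x) n.+1).
Proof.
rewrite !coef_series_of; set y' := sm _; set y := sm _.
suff -> : y' = sigma' (coef x n.+1 - delta y).
  by rewrite (frs'_K fr) subrK.
rewrite /y' (Sum_recl fr); last exact: negop_null.
rewrite addn0 /= (frs'_B fr); congr (_ + _).
have nD f g : {morph f : a b / a + b} -> {morph g : a b / a + b} ->
    {morph (fun z : R => g (f z)) : a b / a + b}.
  by move=> fD gD a b; rewrite fD gD.
have cont n1 : exists m, forall z, J m z -> J n1 (negop z).
  have [m mP] := frJd fr n1; exists m => z /mP /(frJs' fr) H.
  by rewrite /negop -mulN1r; apply: (lidealM (Jl n1)).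
rewrite -[RHS]/(negop y) /y (Sum_map fr (f := negop)) //.
- apply: eq_Sum => k; congr (negop (iter k _ (sigma' (coef x _)))).
  by rewrite addnS addSn.
- by move=> a b; rewrite /negop (frd_D fr) (frs'_D fr) opprD.
exact: negop_null.
Qed.

Definition right_coef0 (x : S) : R := coef x 0 - delta (coef (left_div x) 0).

Lemma left_divP x : x = C (right_coef0 x) + t * left_div x.
Proof.
apply: series_inj => -[|n]; rewrite (srD sf) (srC1 sf) (srt sf) /=.
  by rewrite (frs_0 fr) add0r subrK.
by rewrite add0r -coef_left_div.
Qed.

Definition right_coef (x : S) (i : nat) : R := right_coef0 (iter i left_div x).

Lemma right_expansion_rem x n :
  x = \sum_(i < n) t ^+ i * C (right_coef x i) + t ^+ n * iter n left_div x.
Proof.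
elim: n => [|n IHn]; first by rewrite big_ord0 add0r expr0 mul1r.
rewrite big_ord_recr /= exprSr -mulrA -addrA -mulrDr -left_divP.
exact: IHn.
Qed.

Lemma right_expansion_cvg x n : exists N, forall k, (N <= k)%N ->
  ball n (\sum_(i < k) t ^+ i * C (right_coef x i) - x).
Proof.
have [m mP] := tpow_ball n; exists m => k le.
rewrite {2}(right_expansion_rem x k) opprD addrA subrr sub0r -[- _]sub0r.
by apply: coef_ballB; [apply: coef_ball0 | apply: mP].
Qed.

Lemma coef_tpow i k : coef (t ^+ i) k = if k == i then 1 else 0.
Proof.
elim: i k => [|i IHi] k.
  by rewrite expr0 -(rmorph1 C) (srC1 sf).
rewrite exprS (srt sf) !IHi.
have d1 : delta 1 = 0.
  have := frd_M fr 1 1; rewrite !mulr1 (frs_1 fr) mul1r => H.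
  by apply: (@addrI _ (delta 1)); rewrite -H addr0.
have -> : delta (if k == i then 1 else 0) = 0 by case: ifP; rewrite ?(frd_0 fr).
rewrite addr0; case: k => [|k]; first exact: (frs_0 fr).
by rewrite IHi eqSS; case: ifP; rewrite ?(frs_1 fr) ?(frs_0 fr).
Qed.

Lemma left_expansion_ball x n :
  ball n (x - \sum_(i < n) C (coef x i) * t ^+ i).
Proof.
move=> k ltkn; rewrite scoefB scoef_sum.
rewrite (eq_bigr (fun i : 'I_n => if i == Ordinal ltkn then coef x k else 0)).
  rewrite -big_mkcond big_pred1_eq subrr; exact: (lideal0 (Jl n)).
move=> i _; rewrite (srC sf) coef_tpow -val_eqE /= [k == _]eq_sym.
by case: eqP => [->|]; rewrite ?mulr1 ?mulr0.
Qed.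

End RightExpansion.

(** * Solving the lim^1 equations for coefficient sequences *)

Section MittagLeffler.
Variables (R : pzRingType) (sigma sigma' delta : R -> R) (J : nat -> set R).
Hypothesis fr : skew_frame sigma sigma' delta J.
Local Notation tau := (shift_twist sigma' delta).

(** The solution is [b n = \sum_j tau ^ j (c (n + j))], each [c] being viewed as a constant
    sequence. Through [theta] it solves [y n - T (y n.+1) = z n] when [z n] is a cocycle [g]
    multiplied by [c n]. *)
Lemma shift_twist_telescope (c : nat -> R) : exists b : nat -> nat -> R,
  forall n k, b n k - tau (b n.+1) k = delta_seq 0 (c n) k.
Proof.
pose X n k j := iter j tau (delta_seq 0 (c (n + j)%N)) k.
have nX n k : null J (X n k).
  move=> N; have [m mP] := iter_shift_twist_small fr N.
  by exists (m + k)%N => j; apply: mP.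
exists (fun n k => Sum J (X n k)) => n k.
suff -> : tau (fun k => Sum J (X n.+1 k)) k = Sum J (fun j => X n k j.+1).
  by rewrite (Sum_recl fr) // addrK /X addn0.
have cd := null_map (frJd fr) (nX n.+1 k).
rewrite /shift_twist (Sum_map fr (frd_D fr) (frJd fr)) //.
have -> : (if k is j.+1 then Sum J (X n.+1 j) else 0) =
    Sum J (fun i => if k is j.+1 then X n.+1 j i else 0).
  by case: k {cd} => // ; rewrite (@Sum_finite R _ _ _ J fr _ 0%N) // /psum big_ord0.
have nk : null J (fun i => if k is j.+1 then X n.+1 j i else 0).
  by case: k {cd} => //; apply: null0 fr.
rewrite (SumB fr) // (Sum_map fr (frs'_D fr) (frs'_cont fr)); last exact: (nullB fr).
by apply: eq_Sum => j; rewrite /X iterS addnS -addSn; case: k {cd nk}.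
Qed.

End MittagLeffler.

Record dual_basis (S : pzRingType) (P : lmodType S) := DualBasis {
  db_size : nat ;
  db_vec : 'I_db_size -> P ;
  db_coord : 'I_db_size -> {linear P -> S^o} ;
  db_expand : forall p, p = \sum_j (db_coord j p : S) *: db_vec j }.
Arguments db_vec {S P} d _.
Arguments db_coord {S P} d _.
Arguments db_expand {S P} d _.

Lemma projective_dual_basis (S : pzRingType) (P : lmodType S) :
  projective P -> finitely_generated P -> exists _ : dual_basis P, True.
Proof.
move=> projP [r [e [_ gen]]].
pose U : lmodType S := ('I_r -> S^o)%type.
pose pi (a : U) : P := \sum_j (a j : S) *: e j.
have lpi : linear pi.
  move=> a u v; rewrite /pi scaler_sumr -big_split /=; apply: eq_bigr => j _.
  by rewrite scalerA -scalerDl.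
pose piL : {linear U -> P} := HB.pack pi (GRing.isLinear.Build _ _ _ _ pi lpi).
have lid : linear (fun p : P => p) by [].
pose idL : {linear P -> P} :=
  HB.pack (fun p : P => p) (GRing.isLinear.Build _ _ _ _ (fun p : P => p) lid).
have [|h hP] := projP U P piL idL.
  by move=> v; have [a ->] := gen v I; exists a.
have lc j : linear (fun p => h p j : S^o) by move=> a u v; rewrite linearP.
pose c j : {linear P -> S^o} :=
  HB.pack (fun p => h p j : S^o) (GRing.isLinear.Build _ _ _ _ (fun p => h p j : S^o) (lc j)).
by unshelve eexists (@DualBasis S P r e c _) => // p; rewrite -{1}[p]hP.
Qed.

(** * Continuous functionals on projective modules *)

Section ContinuousDual.
Variables (R S : pzRingType) (sigma sigma' delta : R -> R) (J : nat -> set R).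
Variables (C : {rmorphism R -> S}) (t : S) (coef : S -> nat -> R).
Hypothesis fr : skew_frame sigma sigma' delta J.
Hypothesis sf : series_frame sigma sigma' delta J C t coef.

Local Notation wd := (word sigma sigma' delta).
Local Notation nul := (null J).
Local Notation sm := (Sum J).
Local Notation ball := (coef_ball J coef).

Let Jl := frJl fr.

Definition rlinear (P : lmodType S) (f : P -> R) :=
  linear (f : resScalars C P -> R^o).

Section RLinear.
Variables (P : lmodType S) (f : P -> R).
Hypothesis lf : rlinear f.

Lemma rlinearP a p q : f (C a *: p + q) = a * f p + f q.
Proof. exact: lf. Qed.

Lemma rlinearD p q : f (p + q) = f p + f q.
Proof. by have := rlinearP 1 p q; rewrite rmorph1 scale1r mul1r. Qed.

Lemma rlinear0 : f 0 = 0.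
Proof. by apply: (@addrI _ (f 0)); rewrite -rlinearD !addr0. Qed.

Lemma rlinearZ a p : f (C a *: p) = a * f p.
Proof. by have := rlinearP a p 0; rewrite !addr0 rlinear0 addr0. Qed.

Lemma rlinearB p q : f (p - q) = f p - f q.
Proof. by apply: (@addIr _ (f q)); rewrite -rlinearD !subrK. Qed.

Lemma rlinear_sum (I : Type) (r : seq I) (F : I -> P) :
  f (\sum_(i <- r) F i) = \sum_(i <- r) f (F i).
Proof. by apply: (big_morph f); [apply: rlinearD | apply: rlinear0]. Qed.

End RLinear.

Lemma tC a : t * C a = C (sigma a) * t + C (delta a).
Proof.
apply: (series_inj sf) => i; rewrite (srt sf) (srD sf) (srC sf) !(srC1 sf).
have -> : coef t i = if i == 1%N then 1 else 0.
  by rewrite -[t]expr1 (coef_tpow fr sf).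
by case: i => [|[|i]]; rewrite ?(srC1 sf) /= ?mulr0 ?mulr1 ?(frd_0 fr) ?(frs_0 fr) ?addr0 ?add0r.
Qed.

Section Module.
Variables (P : lmodType S) (db : dual_basis P).

Definition mod_ball (n : nat) : set P :=
  [set p | forall j, ball n (db_coord db j p)].

Lemma mod_ball_le m n p : (m <= n)%N -> mod_ball n p -> mod_ball m p.
Proof. by move=> le bp j; apply: (coef_ball_le fr le). Qed.

Definition continuous_dual (f : P -> R) :=
  rlinear f /\ forall n, exists m, forall p, mod_ball m p -> J n (f p).

Local Notation T := (Top sigma' delta (fun p : P => t *: p)).
Local Notation van := (vanishing sigma' delta J (fun p : P => t *: p)).
Local Notation th := (theta sigma' delta J (fun p : P => t *: p)).

Lemma cd0 : continuous_dual 0.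
Proof.
split; first by move=> a u v; rewrite /= scaler0 addr0.
by move=> n; exists 0%N => p _; apply: (lideal0 (Jl n)).
Qed.

Lemma cdB f g : continuous_dual f -> continuous_dual g -> continuous_dual (f - g).
Proof.
move=> [lf cf] [lg cg]; split; first exact: linear_sub.
move=> n; have [m mP] := cf n; have [k kP] := cg n; exists (maxn m k) => p bp.
apply: (lidealB (Jl n)).
  by apply: mP; apply: mod_ball_le bp; apply: leq_maxl.
by apply: kP; apply: mod_ball_le bp; apply: leq_maxr.
Qed.

Lemma cdD f g : continuous_dual f -> continuous_dual g -> continuous_dual (f + g).
Proof.
move=> cf cg; have := cdB cf (cdB cd0 cg).
by rewrite sub0r opprK.
Qed.

Lemma rlinear_Top f : rlinear f -> rlinear (T f).
Proof.
move=> lf a u v; change (T f (C a *: u + v) = a * T f u + T f v).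
rewrite /Top scalerDr scalerA tC scalerDl -scalerA.
rewrite -addrA !(rlinearP lf) (frd_D fr) (frd_M fr).
have -> (x y z w c : R) : x + (y + z) - (y + w + c) = (x - w) + (z - c).
  by rewrite addrCA -[y + w + c]addrA opprD addrACA subrr add0r opprD addrACA.
rewrite -mulrBr.
by rewrite (frs'_D fr) (frs'_M fr) (frs_K fr).
Qed.

Lemma mod_ball_t n : exists m, forall p, mod_ball m p -> mod_ball n (t *: p).
Proof.
have [m mP] := coef_ball_t fr sf n; exists m => p bp j.
by rewrite linearZ; apply: mP; apply: bp.
Qed.

Lemma cd_Top f : continuous_dual f -> continuous_dual (T f).
Proof.
move=> [lf cf]; split; first exact: rlinear_Top.
move=> n; have [m mP] := cf n; have [k kP] := mod_ball_t m.
have [n1 n1P] := frJd fr n; have [m1 m1P] := cf n1.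
exists (maxn k m1) => p bp; apply: (frJs' fr); apply: (lidealB (Jl n)).
  by apply: mP; apply: kP; apply: mod_ball_le bp; apply: leq_maxl.
by apply: n1P; apply: m1P; apply: mod_ball_le bp; apply: leq_maxr.
Qed.

Lemma cd_word f n : continuous_dual f -> exists N, forall w j p,
  (N <= count is_Y w + j)%N -> J n (wd w (f (t ^+ j *: p))).
Proof.
move=> [lf cf]; have [m0 m0P] := frnil fr n; have [n1 n1P] := word_small fr n.
have [m mP] := cf n1; have [j0 j0P] := tpow_ball fr sf m.
exists (m0 + j0)%N => w j p le; have [lem0|ltm0] := leqP m0 (count is_Y w).
  exact: m0P.
apply: n1P; apply: mP => k; rewrite linearZ; apply: j0P.
rewrite -(leq_add2l m0); apply: leq_trans le _.
by rewrite leq_add2r ltnW.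
Qed.

(** Expanding [T], the value [iter i T f p] is a sum of words in [sigma'] and [delta] at
    [f (t ^+ j *: p)] in which [j] and the number of letters [delta] add up to [i]. If [j] is large,
    [t ^+ j *: p] is small uniformly in [p]; otherwise there are many letters [delta]. *)
Lemma cd_vanishing f : continuous_dual f -> van f.
Proof.
move=> cf n; have [N NP] := cd_word n cf.
suff H i w j p : (N <= count is_Y w + j + i)%N ->
    J n (wd w (iter i T f (t ^+ j *: p))).
  by exists N => i le p; have := H i [::] 0%N p; rewrite expr0 scale1r; apply.
elim: i w j p => [|i IHi] w j p le; first by apply: NP; rewrite addn0 in le.
rewrite iterS {1}/Top.
have -> x y : wd w (sigma' (x - delta y)) =
    wd (rcons w Z'letter) x - wd (rcons (rcons w Z'letter) Yletter) y.
  by rewrite !word_rcons (frs'_B fr) (wordB fr).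
apply: (lidealB (Jl n)).
  rewrite scalerA -exprS; apply: IHi.
  by rewrite count_rcons_Y addn0 addnS addSnnS.
by apply: IHi; rewrite !count_rcons_Y addn0 addn1 !addSn -addnS.
Qed.

Lemma cd_iter_Top i f : continuous_dual f -> continuous_dual (iter i T f).
Proof. by move=> cf; elim: i => //= i; apply: cd_Top. Qed.

Lemma cd_theta f b : continuous_dual f -> continuous_dual (th f b).
Proof.
move=> cf; have vf := cd_vanishing cf; split.
  move=> a u v; change (th f b (C a *: u + v) = a * th f b u + th f b v).
  rewrite /theta (Sum_mull fr); last exact: (theta_null fr).
  rewrite (SumD fr); [|apply: (null_mull fr)|]; try exact: (theta_null fr).
  apply: eq_Sum => k; have [lk _] := cd_iter_Top k cf.
  by rewrite (rlinearP lk) mulrDl mulrA.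
move=> n; have [N NP] := vf n.
pose Q k m := forall p, mod_ball m p -> J n (iter k T f p).
have [|k _|m mP] := @finite_uniform Q N.
- by move=> k m m' le H p bp; apply: H; apply: mod_ball_le bp.
- by have [_ /(_ n)] := cd_iter_Top k cf.
exists m => p bp; apply: (Sum_J fr); first exact: (theta_null fr).
move=> k; apply: (frJr fr); have [ltkN|leNk] := ltnP k N; first exact: mP.
exact: NP.
Qed.

Lemma ball_finite (I : finType) (Q : I -> nat -> Prop) :
  (forall i m m', (m <= m')%N -> Q i m -> Q i m') ->
  (forall i, exists m, Q i m) -> exists m, forall i, Q i m.
Proof.
move=> mono /choice [f fP]; exists (\max_i f i) => i.
by apply: mono (fP i); apply: leq_bigmax.
Qed.

Lemma cd_coef (f : P -> S) n : linear (f : P -> S^o) ->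
  continuous_dual (fun p => coef (f p) n).
Proof.
move=> lf; pose fL : {linear P -> S^o} := HB.pack f (GRing.isLinear.Build _ _ _ _ f lf).
split.
  move=> a u v; change (coef (f (C a *: u + v)) n = a * coef (f u) n + coef (f v) n).
  by rewrite lf (srD sf) (srC sf).
move=> k.
have [| |m mP] := @ball_finite _ (fun j m => forall x, ball m x ->
    ball (maxn k n.+1) (x * f (db_vec db j))).
- by move=> j m m' le H x bx; apply: H; apply: (coef_ball_le fr le).
- by move=> j; apply: (srM sf).
exists m => p bp; rewrite {1}(db_expand db p) -[f _]/(fL _) linear_sum.
rewrite (scoef_sum sf); apply: (lideal_sum (Jl k)) => j _; rewrite linearZ.
by apply: (frJ_le fr (leq_maxl k n.+1)); apply: mP; rewrite ?leq_max ?leqnn ?orbT //; apply: bp.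
Qed.

Lemma Top_coef (f : P -> S) n : linear (f : P -> S^o) ->
  T (fun p => coef (f p) n) =
  (if n is k.+1 then fun p => coef (f p) k else 0).
Proof.
move=> lf; pose fL : {linear P -> S^o} := HB.pack f (GRing.isLinear.Build _ _ _ _ f lf).
apply/funext => p; rewrite /Top -[f _]/(fL _) linearZ (srt sf) addrK (frs_K fr).
by case: n.
Qed.

Lemma ball_scale n (e : P) : exists m, forall x, ball m x -> mod_ball n (x *: e).
Proof.
have [| |m mP] := @ball_finite _ (fun j m => forall x, ball m x ->
    ball n (x * db_coord db j e)).
- by move=> j m m' le H x bx; apply: H; apply: (coef_ball_le fr le).
- by move=> j; apply: (srM sf).
by exists m => x bx j; rewrite linearZ; apply: mP.
Qed.

Lemma cd_null f (e : P) : continuous_dual f -> nul (fun k => f (t ^+ k *: e)).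
Proof.
move=> [_ cf] n; have [m mP] := cf n; have [N NP] := tpow_ball fr sf m.
by exists N => k le; apply: mP => j; rewrite linearZ; apply: NP.
Qed.

Lemma cd_expand f x (e : P) : continuous_dual f ->
  f (x *: e) = sm (fun k => coef x k * f (t ^+ k *: e)).
Proof.
move=> cf; apply/esym/(Sum_unique fr) => n.
have [lf cf'] := cf; have [m mP] := cf' n; have [k kP] := ball_scale m e.
exists k => i le; apply: (lidealBC (Jl n)).
have -> : f (x *: e) - psum (fun k => coef x k * f (t ^+ k *: e)) i =
    f ((x - \sum_(j < i) C (coef x j) * t ^+ j) *: e).
  rewrite scalerBl (rlinearB lf) scaler_suml (rlinear_sum lf).
  by congr (_ - _); apply: eq_bigr => j _; rewrite -scalerA (rlinearZ lf).
apply: mP; apply: kP; apply: (coef_ball_le fr le).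
exact: (left_expansion_ball fr sf).
Qed.

(** The equation reads [f (t *: p) = sigma (g p) + delta (f p)]. On the powers [t ^+ k *: e j] it
    becomes the recursion [phi], started at 0. Here [f] is the functional with these values on the
    free module, pulled back along the coordinates of the dual basis, so relations among the [e j]
    put no constraint on [phi]. *)
Lemma Top_surjective g : continuous_dual g ->
  exists2 f, continuous_dual f & T f = g.
Proof.
move=> cg; have [lg _] := cg.
pose phi (e : P) := fix phi k := if k is i.+1 then
  sigma (g (t ^+ i *: e)) + delta (phi i) else 0.
have nphi e : nul (phi e).
  move=> n; have [N NP] := cd_word n cg.
  suff H k w : (N.+1 <= count is_Y w + k)%N -> J n (wd w (phi e k)).
    by exists N.+1 => k le; apply: (H k [::]).
  elim: k w => [|k IHk] w le; first by rewrite /= (word0 fr); apply: (lideal0 (Jl n)).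
  rewrite /= (wordD fr); apply: (lidealD (Jl n)).
    have -> y : wd w (sigma y) = wd (rcons w Zletter) y by rewrite word_rcons.
    by apply: NP; rewrite count_rcons_Y addn0; move: le; rewrite addnS ltnS.
  have -> y : wd w (delta y) = wd (rcons w Yletter) y by rewrite word_rcons.
  by apply: IHk; rewrite count_rcons_Y addn1 addSn -addnS.
pose x j p := db_coord db j p : S; pose e j := db_vec db j.
have nxp j p : nul (fun k => coef (x j p) k * phi (e j) k) by apply: (null_mulrr fr).
pose f p := \sum_j sm (fun k => coef (x j p) k * phi (e j) k).
exists f.
  split.
    move=> a u v; change (f (C a *: u + v) = a * f u + f v).
    rewrite /f mulr_sumr -big_split; apply: eq_bigr => j _.
    rewrite /= (Sum_mull fr) // (SumD fr) //; last exact: (null_mull fr).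
    apply: eq_Sum => k; rewrite mulrA -mulrDl /x linearP (srD sf).
    by rewrite -[_ *: _]/(C a * _) (srC sf).
  move=> n; have [| |N NP] := @ball_finite _ (fun j N => forall k, (N <= k)%N -> J n (phi (e j) k)).
  - by move=> j m m' le H k le'; apply: H; apply: leq_trans le'.
  - by move=> j; apply: nphi.
  exists (maxn n N) => p bp; apply: (lideal_sum (Jl n)) => j _.
  apply: (Sum_J fr) => // k; have [ltkN|leNk] := ltnP k N.
    apply: (frJr fr); apply: (frJ_le fr (leq_maxl n N)); apply: bp.
    by rewrite leq_max ltkN orbT.
  by apply: (lidealM (Jl n)); apply: NP.
apply/funext => p; rewrite /Top.
have nsx j : nul (fun k => sigma (coef (x j p) k) * phi (e j) k.+1).
  by apply: (null_mulrr fr); apply: null_shift.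
have ndp j : nul (fun k => sigma (coef (x j p) k) * delta (phi (e j) k)).
  by apply: (null_mulrr fr); apply: (null_map (frJd fr)).
have ndx j : nul (fun k => delta (coef (x j p) k) * phi (e j) k).
  exact: (null_mulrr fr).
have ncg j : nul (fun k => coef (x j p) k * g (t ^+ k *: e j)).
  by apply: (null_mulrr fr); apply: cd_null.
suff -> : f (t *: p) - delta (f p) = sigma (g p) by rewrite (frs_K fr).
have dsum (F : 'I_(db_size db) -> R) : delta (\sum_j F j) = \sum_j delta (F j).
  by apply: (big_morph delta); [apply: (frd_D fr) | apply: (frd_0 fr)].
have ssum (F : 'I_(db_size db) -> R) : sigma (\sum_j F j) = \sum_j sigma (F j).
  by apply: (big_morph sigma); [apply: (frs_D fr) | apply: (frs_0 fr)].
rewrite {3}(db_expand db p) (rlinear_sum lg) ssum /f dsum -sumrB.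
apply: eq_bigr => j _; rewrite cd_expand // -/(x j p) -/(e j).
rewrite (Sum_map fr (frs_D fr) (frs_cont fr)) //.
rewrite (Sum_map fr (frd_D fr) (frJd fr)) //.
have -> : sm (fun k => coef (x j (t *: p)) k * phi (e j) k) =
    sm (fun k => sigma (coef (x j p) k) * phi (e j) k.+1) +
    sm (fun k => delta (coef (x j p) k) * phi (e j) k).
  have nb : nul (fun k => sigma (if k is i.+1 then coef (x j p) i else 0) * phi (e j) k).
    exact: (null_mulrr fr).
  have -> : sm (fun k => sigma (coef (x j p) k) * phi (e j) k.+1) =
      sm (fun k => sigma (if k is i.+1 then coef (x j p) i else 0) * phi (e j) k).
    by rewrite [RHS](Sum_recl fr) //= (frs_0 fr) mul0r add0r.
  rewrite (SumD fr) //; apply: eq_Sum => k.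
  by rewrite /x linearZ (srt sf) mulrDl.
have -> : sm (fun k => delta (coef (x j p) k * phi (e j) k)) =
    sm (fun k => delta (coef (x j p) k) * phi (e j) k) +
    sm (fun k => sigma (coef (x j p) k) * delta (phi (e j) k)).
  by rewrite (SumD fr) //; apply: eq_Sum => k; rewrite (frd_M fr).
rewrite opprD addrA addrK.
rewrite (SumB fr) //; apply: eq_Sum => k.
by rewrite -mulrBr /= addrK (frs_M fr).
Qed.

End Module.

Lemma mod_ball_linear (P P' : lmodType S) (db : dual_basis P) (db' : dual_basis P')
    (d : {linear P' -> P}) n :
  exists m, forall p, mod_ball db' m p -> mod_ball db n (d p).
Proof.
have [| |m mP] := @ball_finite _ (fun j m => forall x, ball m x ->
    mod_ball db n (x *: d (db_vec db' j))).
- by move=> j m m' le H x bx; apply: H; apply: (coef_ball_le fr le).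
- by move=> j; apply: ball_scale.
exists m => p bp k; rewrite (db_expand db' p) !linear_sum.
apply: (coef_ball_sum fr sf) => j; rewrite linearZ; apply: mP.
exact: bp.
Qed.

Lemma cd_comp (P P' : lmodType S) (db : dual_basis P) (db' : dual_basis P')
    (d : {linear P' -> P}) (f : P -> R) :
  continuous_dual db f -> continuous_dual db' (f \o d).
Proof.
move=> [lf cf]; split.
  move=> a u v; change (f (d (C a *: u + v)) = a * f (d u) + f (d v)).
  by rewrite linearP (rlinearP lf).
move=> n; have [m mP] := cf n; have [k kP] := mod_ball_linear db db' d m.
by exists k => p bp; apply: mP; apply: kP.
Qed.

Lemma Top_comp (P P' : lmodType S) (d : {linear P' -> P}) (f : P -> R) :
  Top sigma' delta (fun p : P' => t *: p) (f \o d) =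
  Top sigma' delta (fun p : P => t *: p) f \o d.
Proof. by apply/funext => p; rewrite /Top /= linearZ. Qed.

Lemma iter_Top_comp (P P' : lmodType S) (d : {linear P' -> P}) (f : P -> R) i :
  iter i (Top sigma' delta (fun p : P' => t *: p)) (f \o d) =
  iter i (Top sigma' delta (fun p : P => t *: p)) f \o d.
Proof. by elim: i => //= i ->; rewrite Top_comp. Qed.

Lemma theta_comp (P P' : lmodType S) (d : {linear P' -> P}) (f : P -> R) b :
  theta sigma' delta J (fun p : P' => t *: p) (f \o d) b =
  theta sigma' delta J (fun p : P => t *: p) f b \o d.
Proof.
by apply/funext => p; rewrite /theta; apply: eq_Sum => k; rewrite iter_Top_comp.
Qed.

End ContinuousDual.

(** * Mapping cones and continuous splittings *)

Section FilteredMaps.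
Variable R : pzRingType.

Definition lcont (X Y : lmodType R) (F : nat -> set X) (G : nat -> set Y)
    (phi : X -> Y) :=
  linear phi /\ forall n, exists m, forall x, F m x -> G n (phi x).

Definition filtration (X : lmodType R) (F : nat -> set X) :=
  (forall n, submodule (F n)) /\ forall m n, (m <= n)%N -> F n `<=` F m.

Lemma lcont_comp (X Y Z : lmodType R) (F : nat -> set X) (G : nat -> set Y)
    (H : nat -> set Z) (phi : X -> Y) (psi : Y -> Z) :
  lcont F G phi -> lcont G H psi -> lcont F H (psi \o phi).
Proof.
move=> [lp cp] [lq cq]; split; first by move=> a u v; rewrite /= lp lq.
move=> n; have [m mP] := cq n; have [k kP] := cp m.
by exists k => x Fx; apply: mP; apply: kP.
Qed.

Lemma lcont_id (X : lmodType R) (F : nat -> set X) : lcont F F id.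
Proof. by split => // n; exists n. Qed.

Lemma lcontB (X Y : lmodType R) (F : nat -> set X) (G : nat -> set Y)
    (phi psi : X -> Y) :
  filtration F -> filtration G -> lcont F G phi -> lcont F G psi ->
  lcont F G (phi - psi).
Proof.
move=> [_ Fle] [sG _] [lp cp] [lq cq]; split; first exact: linear_sub.
move=> n; have [m mP] := cp n; have [k kP] := cq n; exists (maxn m k) => x Fx.
apply: (submodB (sG n)).
  by apply: mP; apply: Fle Fx; apply: leq_maxl.
by apply: kP; apply: Fle Fx; apply: leq_maxr.
Qed.

Section LinearFunction.
Variables (X Y : lmodType R) (phi : X -> Y).
Hypothesis lphi : linear phi.

Lemma linear_add x y : phi (x + y) = phi x + phi y.
Proof. by have := lphi 1 x y; rewrite !scale1r. Qed.

Lemma linear_zero : phi 0 = 0.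
Proof. by apply: (@addrI _ (phi 0)); rewrite -linear_add !addr0. Qed.

Lemma linear_opp x : phi (- x) = - phi x.
Proof. by apply: (@addrI _ (phi x)); rewrite -linear_add !subrr linear_zero. Qed.

Lemma linear_minus x y : phi (x - y) = phi x - phi y.
Proof. by rewrite linear_add linear_opp. Qed.

End LinearFunction.

(** The usual inductive contraction of an exact complex: [id - s \o d] takes values in the cycles,
    which are boundaries, and is lifted to define the next [s]. Continuity is passed on by
    [lift]. *)
Lemma splitting (X : nat -> lmodType R) (F : forall i, nat -> set (X i))
    (d : forall i, X i.+1 -> X i) :
  (forall i, filtration (F i)) -> (forall i, lcont (F i.+1) (F i) (d i)) ->
  (forall x, exists y, d 0%N y = x) ->
  (forall i x, d i x = 0 -> exists y, x = d i.+1 y) ->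
  (forall i x, d i (d i.+1 x) = 0) ->
  (forall i (phi : X i -> X i), lcont (F i) (F i) phi ->
     (forall x, exists y, d i y = phi x) ->
     exists2 s : X i -> X i.+1, lcont (F i) (F i.+1) s &
       forall x, d i (s x) = phi x) ->
  forall i, exists2 s : X i -> X i.+1, lcont (F i) (F i.+1) s &
    forall x, d i (s (d i x)) = d i x.
Proof.
move=> fF cd surj exact dd lift; elim=> [|i [s cs sP]].
  have [|s cs sP] := lift 0%N id (lcont_id _); first exact: surj.
  by exists s.
pose phi := id - (s \o d i).
have [||t ct tP] := lift i.+1 phi.
- by apply: lcontB => //; [apply: lcont_id | apply: lcont_comp cs].
- move=> x; have [|y ->] := exact i (phi x); last by exists y.
  have [ld _] := cd i.
  by rewrite -[phi x]/(x - s (d i x)) (linear_minus ld) sP subrr.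
exists t => // x; rewrite tP -[phi _]/(_ - s (d i _)) dd.
by rewrite (linear_zero cs.1) subr0.
Qed.

End FilteredMaps.

Section MappingCone.
Local Unset Implicit Arguments.
Variables (R : pzRingType) (J : nat -> set R^o).
Variables (A B : nat -> lmodType R) (M : lmodType R).
Variables (FA : forall i, nat -> set (A i)) (FB : forall i, nat -> set (B i)).
Variables (dA : forall i, A i.+1 -> A i) (dB : forall i, B i.+1 -> B i).
Variables (f : forall i, A i -> B i).
Variables (augA : A 0%N -> M) (augB : B 0%N -> M).

Hypothesis filtA : forall i, filtration (FA i).
Hypothesis filtB : forall i, filtration (FB i).
Hypothesis ldA : forall i, lcont (FA i.+1) (FA i) (dA i).
Hypothesis ldB : forall i, lcont (FB i.+1) (FB i) (dB i).
Hypothesis lf : forall i, lcont (FA i) (FB i) (f i).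
Hypothesis laugB : linear augB.
Hypothesis surjA : forall m, exists a, augA a = m.
Hypothesis exA0 : forall a, augA a = 0 <-> exists a', a = dA 0%N a'.
Hypothesis exB0 : forall b, augB b = 0 <-> exists b', b = dB 0%N b'.
Hypothesis exA : forall i a, dA i a = 0 <-> exists a', a = dA i.+1 a'.
Hypothesis exB : forall i b, dB i b = 0 <-> exists b', b = dB i.+1 b'.
Hypothesis augf : forall a, augB (f 0%N a) = augA a.
Hypothesis df : forall i a, dB i (f i.+1 a) = f i (dA i a).

(** The mapping cone of [f : A -> B], with [A] shifted by one degree. Both complexes resolve the
    same [M], so the cone is exact, including surjectivity onto degree 0. *)
Definition cone (i : nat) : lmodType R :=
  if i is k.+1 then (B k.+1 * A k)%type : lmodType R else B 0%N.

Definition cone_filt (i : nat) : nat -> set (cone i) :=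
  if i is k.+1 return nat -> set (cone i)
  then fun n => [set x | FB k.+1 n x.1 /\ FA k n x.2] else FB 0%N.

Definition cone_d (i : nat) : cone i.+1 -> cone i :=
  if i is k.+1 return cone i.+1 -> cone i
  then fun x => (dB k.+1 x.1 + f k.+1 x.2, - dA k x.2)
  else fun x => dB 0%N x.1 + f 0%N x.2.
Local Set Implicit Arguments.

Hypothesis lift : forall i (phi : cone i -> cone i),
  lcont (cone_filt i) (cone_filt i) phi ->
  (forall x, exists y, cone_d i y = phi x) ->
  exists2 s : cone i -> cone i.+1, lcont (cone_filt i) (cone_filt i.+1) s &
    forall x, cone_d i (s x) = phi x.

Lemma cone_filtration i : filtration (cone_filt i).
Proof.
case: i => [|i] //=; split.
  move=> n; have [sA _] := filtA i; have [sB _] := filtB i.+1; split.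
    by split; apply: submod0.
  by move=> a u v [u1 u2] [v1 v2]; split; [apply: (sB n).2 | apply: (sA n).2].
move=> m n le x [x1 x2]; split; [have [_ h] := filtB i.+1|have [_ h] := filtA i].
  exact: h x1.
exact: h x2.
Qed.

Lemma cone_d_lcont i : lcont (cone_filt i.+1) (cone_filt i) (cone_d i).
Proof.
have sum k n : exists m, forall x : B k.+1 * A k,
    FB k.+1 m x.1 -> FA k m x.2 -> FB k n (dB k x.1 + f k x.2).
  have [_ /(_ n) [m1 m1P]] := ldB k; have [_ /(_ n) [m2 m2P]] := lf k.
  exists (maxn m1 m2) => x x1 x2; apply: (submodD ((filtB k).1 n)).
    by apply: m1P; apply: (filtB k.+1).2 x1; apply: leq_maxl.
  by apply: m2P; apply: (filtA k).2 x2; apply: leq_maxr.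
have lsum k a u v : dB k (a *: u + v).1 + f k (a *: u + v).2 =
    a *: (dB k u.1 + f k u.2) + (dB k v.1 + f k v.2).
  by rewrite (ldB k).1 (lf k).1 addrACA -scalerDr.
case: i => [|i]; split.
- exact: lsum.
- by move=> n; have [m mP] := sum 0%N n; exists m => x [x1 x2]; apply: mP.
- move=> a u v; rewrite /cone_d lsum (ldA i).1 opprD -scalerN.
  by [].
move=> n; have [m1 m1P] := sum i.+1 n; have [_ /(_ n) [m2 m2P]] := ldA i.
exists (maxn m1 m2) => x [x1 x2]; split.
  by apply: m1P; [apply: (filtB i.+2).2 x1 | apply: (filtA i.+1).2 x2]; apply: leq_maxl.
apply: (submodN ((filtA i).1 n)); apply: m2P; apply: (filtA i.+1).2 x2.
exact: leq_maxr.
Qed.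

Lemma cone_surj x : exists y, cone_d 0 y = x.
Proof.
have [a aE] := surjA (augB x).
have [b bE] : exists b, x - f 0%N a = dB 0%N b.
  by apply/exB0; rewrite (linear_minus laugB) augf aE subrr.
by exists (b, a); rewrite /= -bE subrK.
Qed.

Lemma cone_dd i x : cone_d i (cone_d i.+1 x) = 0.
Proof.
have ddA j a : dA j (dA j.+1 a) = 0 by apply/exA; exists a.
have ddB j b : dB j (dB j.+1 b) = 0 by apply/exB; exists b.
have E j (y : cone j.+2) : dB j (dB j.+1 y.1 + f j.+1 y.2) + f j (- dA j y.2) = 0.
  rewrite (linear_add (ldB j).1) ddB add0r (linear_opp (lf j).1) df subrr.
  by [].
case: i x => [|i] x /=; first exact: E.
by rewrite E (linear_opp (ldA i).1) ddA !oppr0.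
Qed.

Lemma cone_exact i x : cone_d i x = 0 -> exists y, x = cone_d i.+1 y.
Proof.
have E j (b : B j.+1) (a : A j) (a' : A j.+1) : dB j b + f j a = 0 -> a = dA j a' ->
    exists y : cone j.+2, (b, a) = cone_d j.+1 y.
  move=> ba aE; have [b' bE] : exists b', b + f j.+1 a' = dB j.+1 b'.
    by apply/exB; rewrite (linear_add (ldB j).1) df -aE.
  exists (b', - a'); rewrite /= (linear_opp (lf _).1) (linear_opp (ldA j).1).
  by rewrite opprK -bE addrK -aE.
case: i x => [|i] [b a] /=.
  move=> ba; have [|a' aE] := (exA0 a).1; last exact: (E _ _ _ a').
  have augd : augB (dB 0%N b) = 0 by apply/exB0; exists b.
  by rewrite -augf -[LHS]add0r -augd -(linear_add laugB) ba (linear_zero laugB).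
move=> [ba /eqP]; rewrite oppr_eq0 => /eqP a0.
by have [a' aE] := (exA i a).1 a0; apply: (E _ _ _ a').
Qed.

(** As [x - s (d x)] is a cycle, hence a boundary, [phi] does not see it; so [phi] factors through
    [d], and continuously, because [s] is continuous. *)
Lemma cone_functional i (phi : cone i.+1 -> R^o) :
  lcont (cone_filt i.+1) J phi -> (forall y, phi (cone_d i.+1 y) = 0) ->
  exists2 s : cone i -> cone i.+1, lcont (cone_filt i) (cone_filt i.+1) s &
    forall x, phi x = phi (s (cone_d i x)).
Proof.
move=> [lphi _] phi0.
have [s cs sP] := splitting cone_filtration cone_d_lcont cone_surj cone_exact
  cone_dd lift i.
exists s => // x; apply/eqP; rewrite -subr_eq0 -(linear_minus lphi).
have [|y ->] := @cone_exact i (x - s (cone_d i x)); last by rewrite phi0.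
by rewrite (linear_minus (cone_d_lcont i).1) sP subrr.
Qed.

Hypothesis filtJ : filtration J.

Lemma cone_in1 k : lcont (FB k) (cone_filt k)
  (match k return B k -> cone k with k'.+1 => fun b => (b, 0) | _ => id end).
Proof.
case: k => [|k]; first exact: lcont_id.
split; first by move=> a u v; congr pair; rewrite /= scaler0 addr0.
by move=> n; exists n => x Fx; split => //; apply: (submod0 ((filtA k).1 n)).
Qed.

Lemma cone_in2 k : lcont (FA k) (cone_filt k.+1) (fun a => (0, a)).
Proof.
split; first by move=> a u v; congr pair; rewrite /= scaler0 addr0.
by move=> n; exists n => x Fx; split => //; apply: (submod0 ((filtB _).1 n)).
Qed.

Lemma cone_pair k (beta : B k.+1 -> R^o) (alpha : A k -> R^o) :
  lcont (FB k.+1) J beta -> lcont (FA k) J alpha ->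
  lcont (cone_filt k.+1) J (fun x => beta x.1 + alpha x.2).
Proof.
move=> [lb cb] [la ca]; split.
  by move=> a u v; rewrite lb la addrACA -scalerDr.
move=> n; have [m mP] := cb n; have [l lP] := ca n.
exists (maxn m l) => x [x1 x2]; apply: (submodD (filtJ.1 n)).
  by apply: mP; apply: (filtB _).2 x1; apply: leq_maxl.
by apply: lP; apply: (filtA _).2 x2; apply: leq_maxr.
Qed.

Lemma lcont0 (X : lmodType R) (F : nat -> set X) : lcont F J (fun=> 0 : R^o).
Proof.
split; first by move=> a u v; rewrite scaler0 addr0.
by move=> n; exists 0%N => x _; apply: (submod0 (filtJ.1 n)).
Qed.

Lemma cone_inj0 (beta : B 0%N -> R^o) : lcont (FB 0%N) J beta ->
  (forall b, beta (dB 0%N b) = 0) -> (forall a, beta (f 0%N a) = 0) ->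
  forall b, beta b = 0.
Proof.
move=> [lb _] bd bf b; have [[b' a'] <-] := cone_surj b.
by rewrite (linear_add lb) bd bf addr0.
Qed.

(** Injectivity of the restriction along [f] on cohomology: if [beta] restricts to the coboundary of
    [gamma], then [beta] and [gamma] together form a cocycle of the cone, which factors through the
    differential. Restricting the factorisation to [B] gives [beta']. *)
Lemma cone_injS k (beta : B k.+1 -> R^o) (gamma : A k -> R^o) :
  lcont (FB k.+1) J beta -> lcont (FA k) J gamma ->
  (forall b, beta (dB k.+1 b) = 0) ->
  (forall a, beta (f k.+1 a) = gamma (dA k a)) ->
  exists2 beta' : B k -> R^o, lcont (FB k) J beta' &
    forall b, beta b = beta' (dB k b).
Proof.
move=> cb cg bd bf; have cphi := cone_pair cb cg.
have [y|s cs sP] := cone_functional cphi.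
  rewrite /= (linear_add cb.1) bd add0r bf (linear_opp cg.1) subrr.
  by [].
exists ((fun x => beta x.1 + gamma x.2) \o s \o
  (match k return B k -> cone k with k'.+1 => fun b => (b, 0) | _ => id end)).
  by apply: lcont_comp (cone_in1 k) _; apply: lcont_comp cs cphi.
move=> b; have := sP (b, 0); rewrite /= (linear_zero cg.1) addr0 => ->.
case: k beta gamma cb cg bd bf cphi s cs sP b => [|k] /= beta gamma cb cg bd bf cphi s cs sP b.
  by rewrite (linear_zero (lf _).1) addr0.
by rewrite (linear_zero (lf _).1) addr0 (linear_zero (ldA _).1) oppr0.
Qed.

(** Surjectivity on cohomology: [alpha], extended by 0 to the cone, factors through the
    differential. The restriction of the factor to [B k] is [beta]; for positive [k], its negative
    on the second summand is [gamma], and evaluating at [(0, a)] gives the relation. *)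
Lemma cone_surjective k (alpha : A k -> R^o) :
  lcont (FA k) J alpha -> (forall a, alpha (dA k a) = 0) ->
  exists2 beta : B k -> R^o, lcont (FB k) J beta &
    (forall b, beta (dB k b) = 0) /\
    match k return (A k -> R^o) -> (B k -> R^o) -> Prop with
    | 0%N => fun alpha beta => forall a, alpha a = beta (f 0%N a)
    | k'.+1 => fun alpha beta => exists2 gamma : A k' -> R^o, lcont (FA k') J gamma &
        forall a, alpha a = beta (f k'.+1 a) + gamma (dA k' a)
    end alpha beta.
Proof.
move=> ca ad; have cphi := cone_pair (lcont0 (FB k.+1)) ca.
have [y|s cs sP] := cone_functional cphi.
  by rewrite /= add0r (linear_opp ca.1) ad oppr0.
exists ((fun x => 0 + alpha x.2) \o s \o
  (match k return B k -> cone k with k'.+1 => fun b => (b, 0) | _ => id end)).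
  by apply: lcont_comp (cone_in1 k) _; apply: lcont_comp cs cphi.
case: k alpha ca ad cphi s cs sP => [|k] alpha ca ad cphi s cs sP; split.
- move=> b; have := sP (b, 0); rewrite /= (linear_zero (lf _).1) addr0 !add0r => <-.
  exact: (linear_zero ca.1).
- by move=> a; have := sP (0, a); rewrite /= (linear_zero (ldB _).1) !add0r.
- move=> b; have := sP (b, 0); rewrite /= (linear_zero (lf _).1) (linear_zero (ldA _).1).
  by rewrite addr0 oppr0 !add0r => <-; apply: (linear_zero ca.1).
have lphis := (lcont_comp cs cphi).1.
exists (fun a' => - ((fun x => 0 + alpha x.2) \o s) (0, a')).
  have := lcontB (filtA k) filtJ (lcont0 (FA k)) (lcont_comp (cone_in2 k) (lcont_comp cs cphi)).
  by congr lcont; apply/funext => a; rewrite -[LHS]/(0 - _) sub0r.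
move=> a; have := sP (0, a); rewrite /= (linear_zero (ldB _).1) !add0r => ->.
have -> : (f k.+1 a, - dA k a) = (f k.+1 a, 0) - (0, dA k a) :> cone k.+1.
  by congr pair; rewrite /= ?subr0 ?sub0r.
by have := linear_minus lphis (f k.+1 a, 0) (0, dA k a); rewrite /= !add0r.
Qed.

End MappingCone.

(** * Continuous summands of countable products, and lifting along them *)

Section Retracts.
Variables (R : pzRingType) (sigma sigma' delta : R -> R) (J : nat -> set R).
Hypothesis fr : skew_frame sigma sigma' delta J.

Local Notation G := (seqmod R).
Local Notation nul := (null J).
Local Notation sm := (Sum J).

Let Jl := frJl fr.

Definition seq_filt (n : nat) : set G := seq_ball n (J n).

Lemma seq_filtration : filtration seq_filt.
Proof.
split=> [n|m n le a Ja k ltk]; first exact: seq_ball_sub.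
by apply: (frJ_le fr le); apply: Ja; apply: leq_trans ltk le.
Qed.

(** [X] is a direct summand of the product [G] and carries the topology induced by [rt_inj];
    [rt_cont] is continuity of the projection for that topology. *)
Record retract (X : lmodType R) := Retract {
  rt_inj : X -> G ;
  rt_prj : G -> X ;
  rt_injL : linear rt_inj ;
  rt_prjL : linear rt_prj ;
  rt_K : cancel rt_inj rt_prj ;
  rt_cont : forall n, exists m, forall a, seq_filt m a -> seq_filt n (rt_inj (rt_prj a)) }.

Definition rt_filt (X : lmodType R) (r : retract X) (n : nat) : set X :=
  [set x | seq_filt n (rt_inj r x)].

Lemma rt_filtration (X : lmodType R) (r : retract X) : filtration (rt_filt r).
Proof.
have [sG le] := seq_filtration; split=> [n|m n lemn x].
  by apply: submod_preimage => //; apply: rt_injL.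
exact: le.
Qed.

Lemma rt_sep (X : lmodType R) (r : retract X) x :
  (forall n, rt_filt r n x) -> x = 0.
Proof.
move=> Fx; rewrite -[x](rt_K r).
have -> : rt_inj r x = 0.
  apply/funext => k; apply: (frJsep fr) => n.
  by apply: (frJ_le fr (leq_maxl n k.+1)); apply: Fx; apply: leq_maxr.
exact: (linear_zero (rt_prjL r)).
Qed.

Lemma rt_prj_lcont (X : lmodType R) (r : retract X) :
  lcont seq_filt (rt_filt r) (rt_prj r).
Proof. by split; [apply: rt_prjL | apply: rt_cont]. Qed.

Lemma rt_inj_lcont (X : lmodType R) (r : retract X) :
  lcont (rt_filt r) seq_filt (rt_inj r).
Proof. by split; [apply: rt_injL | move=> n; exists n]. Qed.

Lemma rt_open_mapping (X Y : lmodType R) (r : retract X) (U : set (set Y))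
    (phi : X -> Y) :
  linear phi -> U !=set0 -> down_directed U -> (forall K, U K -> submodule K) ->
  (forall y, (forall K, U K -> K y) -> y = 0) ->
  (forall K, U K -> exists n, rt_filt r n `<=` phi @^-1` K) ->
  forall n, exists2 K, U K &
    forall x, K (phi x) -> exists2 x', rt_filt r n x' & phi x' = phi x.
Proof.
move=> lphi U0 dU sU sepU cU n.
have Bsub L : [set J n | n in setT] L -> left_ideal L by move=> [k _ <-].
have Bart L : [set J n | n in setT] L -> artinian_quotient (L : set R^o).
  by move=> [k _ <-]; apply: (frJart fr).
have base k : seq_base [set J n | n in setT] (seq_filt k).
  by exists k; exists (J k) => //; exists k.
have [m mP] := rt_cont r n.
have [| |K UK KP] := @open_mapping R G Y _ U (phi \o rt_prj r)
  (seq_lincompact Bsub Bart (frJcomplete fr)) (seq_base_sub Bsub)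
  (seq_base_art Bsub Bart) _ U0 dU sU sepU _ (seq_filt m) (base m).
- by move=> a u v; rewrite /= (rt_prjL r) lphi.
- move=> K /cU [k kP]; have [l lP] := rt_cont r k.
  by exists (seq_filt l) => // a /lP; apply: kP.
exists K => // x Kx; have [|b Fb bE] := KP (rt_inj r x); first by rewrite /= rt_K.
exists (rt_prj r b); first exact: mP.
by move: bE; rewrite /= rt_K.
Qed.

Lemma rt_open (X Y : lmodType R) (r : retract X) (s : retract Y) (phi : X -> Y) :
  lcont (rt_filt r) (rt_filt s) phi -> forall n, exists m, forall x,
    rt_filt s m (phi x) -> exists2 x', rt_filt r n x' & phi x' = phi x.
Proof.
move=> [lphi cphi] n; have [sF leF] := rt_filtration s.
have [| | | | |_ [m _ <-] mP] := @rt_open_mapping X Y r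
  [set rt_filt s m | m in setT] phi lphi _ _ _ _ _ n.
- by exists (rt_filt s 0%N), 0%N.
- move=> _ _ [k _ <-] [l _ <-]; exists (rt_filt s (maxn k l)); first by exists (maxn k l).
  by move=> y Fy; split; apply: leF Fy; rewrite leq_max leqnn ?orbT.
- by move=> _ [m _ <-].
- by move=> y Fy; apply: (rt_sep (r := s)) => m; apply: Fy; exists m.
- by move=> _ [m _ <-]; have [k kP] := cphi m; exists k.
by exists m.
Qed.

Definition unit_seq (k : nat) : G := fun l => if l == k then 1 else 0.

Lemma unit_seq_sum (a : G) n l : (l < n)%N ->
  (\sum_(k < n) (a k : R) *: unit_seq k : G) l = a l.
Proof.
move=> ltl; rewrite fct_sumE.
rewrite (eq_bigr (fun i : 'I_n => if i == Ordinal ltl then a l else 0)).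
  by rewrite -big_mkcond big_pred1_eq.
move=> i _; rewrite -[(_ *: _) l]/((a i : R) * unit_seq i l) /unit_seq.
rewrite -val_eqE /= [_ == l]eq_sym.
by case: eqP => [->|]; rewrite ?mulr1 ?mulr0.
Qed.

Lemma seq_lcont_unique (Y : lmodType R) (r : retract Y) (phi : G -> Y) :
  lcont seq_filt (rt_filt r) phi -> (forall k, phi (unit_seq k) = 0) ->
  forall a, phi a = 0.
Proof.
move=> [lphi cphi] phi0 a; apply: (rt_sep (r := r)) => n.
have [m mP] := cphi n.
suff -> : phi a = phi (a - \sum_(k < m) (a k : R) *: unit_seq k).
  apply: mP => l ltl.
  rewrite -[(_ - _) l]/(a l - (\sum_(k < m) (a k : R) *: unit_seq k : G) l).
  by rewrite unit_seq_sum // subrr; apply: (lideal0 (Jl m)).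
rewrite (linear_minus lphi) -[LHS]subr0; congr (_ - _).
apply/esym; elim: m {mP} => [|m IHm]; first by rewrite big_ord0 (linear_zero lphi).
by rewrite big_ord_recr /= addrC lphi phi0 IHm scaler0 addr0.
Qed.

(** It suffices to lift the unit vectors by elements [z k] tending to zero, and to send [a] to the
    sum of the [a k *: z k]. Such a choice exists because [phi (unit_seq k)] tends to zero and [d]
    is open onto its image. *)
Lemma lift_seq (Y Z : lmodType R) (r : retract Y) (s : retract Z)
    (phi : G -> Y) (d : Z -> Y) :
  lcont seq_filt (rt_filt r) phi -> lcont (rt_filt s) (rt_filt r) d ->
  (forall x, exists z, d z = phi x) ->
  exists2 psi : G -> Z, lcont seq_filt (rt_filt s) psi & forall x, d (psi x) = phi x.
Proof.
move=> cphi cd im.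
have [sF leF] := rt_filtration s.
(* [z k] is taken as deep in the filtration as any preimage; the bound [n <= k] ensures that a
   deepest level exists, even if preimages occur at all levels. *)
have zex k : exists z, d z = phi (unit_seq k) /\ forall n, (n <= k)%N ->
    (exists2 z', rt_filt s n z' & d z' = phi (unit_seq k)) -> rt_filt s n z.
  suff H N : exists z, d z = phi (unit_seq k) /\ forall n, (n <= N)%N ->
      (exists2 z', rt_filt s n z' & d z' = phi (unit_seq k)) -> rt_filt s n z by apply: H.
  elim: N => [|N [z [zE zF]]].
    have [z zE] := im (unit_seq k); exists z; split => // n.
    by rewrite leqn0 => /eqP -> _ k'.
  have [[z' Fz' z'E]|nz'] := pselect (exists2 z', rt_filt s N.+1 z' & d z' = phi (unit_seq k)).
    by exists z'; split => // n le _; apply: leF le _ Fz'.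
  exists z; split => // n; rewrite leq_eqVlt => /orP [/eqP -> /nz' //|le].
  exact: zF.
have [z zP] := choice zex.
have nz n : exists K, forall k, (K <= k)%N -> rt_filt s n (z k).
  have [m mP] := rt_open cd n; have [l lP] := cphi.2 m.
  exists (maxn n l) => k; rewrite geq_max => /andP [nk lk].
  apply: (zP k).2 => //; rewrite -(zP k).1; apply: mP; rewrite (zP k).1.
  apply: lP => i ltil; rewrite /unit_seq ltn_eqF ?(leq_trans ltil) //.
  exact: (lideal0 (Jl l)).
have nzl l : nul (fun k => rt_inj s (z k) l).
  move=> n; have [K KP] := nz (maxn n l.+1); exists K => k /KP Fz.
  by apply: (frJ_le fr (leq_maxl n l.+1)); apply: Fz; apply: leq_maxr.
(* The series is summed coordinatewise in [G], where [Sum] is available, and projected to [Z]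
   afterwards. *)
pose w (a : G) : G := fun l => sm (fun k => (a k : R) * rt_inj s (z k) l).
have nw a l : nul (fun k => (a k : R) * rt_inj s (z k) l) by apply: (null_mulrr fr).
have cw : lcont seq_filt seq_filt w.
  split.
    move=> c u v; apply/funext => l.
    rewrite -[RHS]/(c * w u l + w v l) /w (Sum_mull fr) // (SumD fr) //.
      by apply: eq_Sum => k; rewrite mulrA -mulrDl.
    exact: (null_mull fr).
  move=> n; have [K KP] := nz n; exists (maxn K n) => a Fa l ltln.
  apply: (Sum_J fr) => // k; have [ltkK|leKk] := ltnP k K.
    apply: (frJr fr); apply: (frJ_le fr (leq_maxr K n)); apply: Fa.
    by rewrite leq_max ltkK.
  by apply: (lidealM (Jl n)); apply: KP.
have cpsi := lcont_comp cw (rt_prj_lcont s).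
exists (rt_prj s \o w) => // x; apply/eqP; rewrite -subr_eq0; apply/eqP.
have cD := lcontB seq_filtration (rt_filtration r) (lcont_comp cpsi cd) cphi.
apply: (seq_lcont_unique cD) => k.
rewrite -[LHS]/(d (rt_prj s (w (unit_seq k))) - phi (unit_seq k)).
suff -> : w (unit_seq k) = rt_inj s (z k) by rewrite rt_K (zP k).1 subrr.
apply/funext => l; rewrite /w (@Sum_finite R _ _ _ J fr _ k.+1).
  rewrite /psum big_ord_recr /= /unit_seq eqxx mul1r big1 ?add0r // => i _.
  by rewrite ltn_eqF ?mul0r.
by move=> i lti; rewrite /unit_seq gtn_eqF ?mul0r.
Qed.

Lemma lift_retract (X Y Z : lmodType R) (q : retract X) (r : retract Y)
    (s : retract Z) (phi : X -> Y) (d : Z -> Y) :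
  lcont (rt_filt q) (rt_filt r) phi -> lcont (rt_filt s) (rt_filt r) d ->
  (forall x, exists z, d z = phi x) ->
  exists2 psi : X -> Z, lcont (rt_filt q) (rt_filt s) psi &
    forall x, d (psi x) = phi x.
Proof.
move=> cphi cd im.
have [|psi cpsi psiP] := lift_seq (lcont_comp (rt_prj_lcont q) cphi) cd.
  by move=> x; apply: im.
exists (psi \o rt_inj q); first exact: lcont_comp (rt_inj_lcont q) cpsi.
by move=> x; rewrite /= psiP /= rt_K.
Qed.

Lemma retract_prod (X Y : lmodType R) (r : retract X) (s : retract Y) :
  exists q : retract (X * Y)%type,
    (forall n, exists m, forall x, rt_filt q m x -> rt_filt r n x.1 /\ rt_filt s n x.2) /\
    (forall n, exists m, forall x, rt_filt r m x.1 -> rt_filt s m x.2 -> rt_filt q n x).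
Proof.
(* The two coordinate sequences are interleaved, so [n] coordinates of each are seen among the first
   [n.*2] of the pair. *)
pose inj (x : X * Y) : G := fun k => if odd k then rt_inj s x.2 k./2 else rt_inj r x.1 k./2.
pose prj (a : G) : X * Y :=
  (rt_prj r (fun k => a k.*2), rt_prj s (fun k => a k.*2.+1)).
have injL : linear inj.
  move=> a u v; apply/funext => k.
  rewrite -[RHS]/(a * inj u k + inj v k) /inj /= (rt_injL r) (rt_injL s).
  by case: (odd k).
have prjL : linear prj.
  by move=> a u v; congr pair; rewrite -?(rt_prjL r) -?(rt_prjL s).
have K : cancel inj prj.
  move=> [x y]; congr pair; [rewrite -[RHS](rt_K r)|rewrite -[RHS](rt_K s)]; congr rt_prj;
  by apply/funext => k; rewrite /inj /= ?odd_double /= ?doubleK ?uphalf_double.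
have c2 n x : rt_filt r n x.1 -> rt_filt s n x.2 -> seq_filt n (inj x).
  move=> Fx Fy k ltk; have ltk2 : (k./2 < n)%N.
    by apply: leq_ltn_trans ltk; rewrite -divn2 leq_div.
  by rewrite /inj; case: (odd k); [apply: Fy | apply: Fx].
have cont n : exists m, forall a, seq_filt m a -> seq_filt n (inj (prj a)).
  have [m1 m1P] := rt_cont r n; have [m2 m2P] := rt_cont s n.
  pose m := maxn m1 m2; exists (m.*2.+1) => a Fa.
  have lem i : (i <= m)%N -> (i <= m.*2.+1)%N.
    by move=> le; rewrite (leq_trans le) // -addnn leqW // leq_addr.
  apply: c2; [apply: m1P | apply: m2P] => k ltk.
    apply: (frJ_le fr (lem _ (leq_maxl m1 m2))); apply: Fa.
    by rewrite ltnS leq_double ltnW // leq_max ltk.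
  apply: (frJ_le fr (lem _ (leq_maxr m1 m2))); apply: Fa.
  by rewrite ltnS ltn_double leq_max ltk orbT.
exists (Retract injL prjL K cont); split=> n; last by exists n => x; apply: c2.
exists n.*2.+1 => x Fx; have le : (n <= n.*2.+1)%N by rewrite -addnn leqW // leq_addr.
split=> k ltk; apply: (frJ_le fr le).
  have := Fx k.*2; rewrite /= /inj odd_double doubleK; apply.
  by rewrite ltnS leq_double ltnW.
have := Fx k.*2.+1; rewrite /= /inj /= odd_double /= uphalf_double; apply.
by rewrite ltnS ltn_double.
Qed.

Lemma retract_row (m : nat) : exists q : retract 'rV[R]_m,
  (forall n, exists k, forall v : 'rV[R]_m, rt_filt q k v -> forall j, J n (v 0 j)) /\
  (forall n, exists k, forall v : 'rV[R]_m, (forall j, J k (v 0 j)) -> rt_filt q n v).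
Proof.
pose inj (v : 'rV[R]_m) : G := fun k => if insub k is Some j then v 0 j else 0.
pose prj (a : G) : 'rV[R]_m := \row_j a j.
have injL : linear inj.
  move=> a u v; apply/funext => k; rewrite -[RHS]/(a * inj u k + inj v k) /inj.
  by case: insubP => [j _ _|_]; rewrite ?mxE // mulr0 addr0.
have prjL : linear prj by move=> a u v; apply/rowP => j; rewrite !mxE.
have K : cancel inj prj.
  by move=> v; apply/rowP => j; rewrite mxE /inj valK.
have cont n : exists k, forall a, seq_filt k a -> seq_filt n (inj (prj a)).
  exists (maxn n m) => a Fa k ltk; rewrite /inj; case: insubP => [j _ jk|_].
    rewrite mxE; apply: (frJ_le fr (leq_maxl n m)); apply: Fa.
    by rewrite leq_max ltn_ord orbT.
  exact: (lideal0 (Jl n)).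
exists (Retract injL prjL K cont); split=> n.
  exists (maxn n m) => v Fv j; apply: (frJ_le fr (leq_maxl n m)).
  have := Fv j; rewrite /= /inj valK; apply.
  by rewrite leq_max ltn_ord orbT.
exists n => v Jv k ltk /=.
by rewrite /inj; case: insubP => [j _ _|_]; [apply: Jv | apply: (lideal0 (Jl n))].
Qed.

Section ModuleRetract.
Variables (S : pzRingType) (C : {rmorphism R -> S}) (t : S) (coef : S -> nat -> R).
Hypothesis sf : series_frame sigma sigma' delta J C t coef.
Variables (P : lmodType S) (db : dual_basis P).

Local Notation mball := (mod_ball J coef db).

Lemma retract_module : exists q : retract (resScalars C P),
  (forall n, exists m, forall p, rt_filt q m p -> mball n p) /\
  (forall n, exists m, forall p, mball m p -> rt_filt q n p).
Proof.
pose r := db_size db.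
(* Index [k] encodes a pair by division with remainder by [r]: the quotient is the degree of the
   coefficient, the remainder the coordinate of the dual basis. *)
pose inj (p : resScalars C P) : G := fun k =>
  if insub (k %% r)%N is Some j then coef (db_coord db j p) (k %/ r)%N else 0.
pose prj (a : G) : resScalars C P :=
  \sum_(j < r) (series_of coef (fun l => a (l * r + j)%N) : S) *: (db_vec db j : P).
have sofE a i := coef_series_of sf a i.
have injL : linear inj.
  move=> a u v; apply/funext => k; rewrite -[RHS]/(a * inj u k + inj v k) /inj.
  case: insubP => [j _ _|_]; last by rewrite mulr0 addr0.
  have -> : db_coord db j (a *: u + v) = C a * db_coord db j u + db_coord db j v.
    exact: (linearP (db_coord db j)).
  by rewrite (srD sf) (srC sf).
have prjL : linear prj.
  move=> a u v; change (prj (a *: u + v) = C a *: (prj u : P) + prj v).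
  rewrite /prj scaler_sumr -big_split; apply: eq_bigr => j _ /=.
  rewrite scalerA -scalerDl.
  apply: (congr1 (fun x : S => x *: db_vec db j)); apply: (series_inj sf) => i.
  by rewrite (srD sf) (srC sf) !sofE.
have coord p (j : 'I_r) l : inj p (l * r + j)%N = coef (db_coord db j p) l.
  have r0 : (0 < r)%N := leq_ltn_trans (leq0n j) (ltn_ord j).
  rewrite /inj modnMDl modn_small ?ltn_ord // divnMDl // divn_small ?ltn_ord // addn0.
  by rewrite valK.
have K : cancel inj prj.
  move=> p; rewrite /prj [RHS](db_expand db); apply: eq_bigr => j _.
  apply: (congr1 (fun x : S => x *: db_vec db j)); apply: (series_inj sf) => i.
  by rewrite sofE coord.
have c1 n p : mball n p -> seq_filt n (inj p).
  move=> bp k ltk; rewrite /inj; case: insubP => [j _ _|_].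
    by apply: bp; apply: leq_ltn_trans ltk; apply: leq_div.
  exact: (lideal0 (Jl n)).
have c2 n p : seq_filt (n * r + n + r) (inj p) -> mball n p.
  move=> Fp j l ltl; rewrite -coord.
  apply: (@frJ_le _ _ _ _ _ fr n (n * r + n + r)).
    by rewrite addnAC leq_addl.
  apply: Fp; apply: leq_trans (_ : (l * r + r <= _)%N); first by rewrite ltn_add2l.
  by rewrite leq_add2r (leq_trans _ (leq_addr _ _)) // leq_mul2r ltnW ?orbT.
have cont n : exists m, forall a, seq_filt m a -> seq_filt n (inj (prj a)).
  have [| |k kP] := @ball_finite _ (fun j m => forall x, coef_ball J coef m x ->
      mball n (x *: db_vec db j)).
  - by move=> j m m' le H x bx; apply: H; apply: (coef_ball_le fr le).
  - by move=> j; apply: (ball_scale fr sf).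
  exists (k * r + k + r)%N => a Fa; apply: c1 => i; rewrite linear_sum.
  apply: (coef_ball_sum fr sf) => j; apply: (kP j) => l ltl; rewrite sofE.
  apply: (@frJ_le _ _ _ _ _ fr k (k * r + k + r)).
    by rewrite addnAC leq_addl.
  apply: Fa; apply: leq_trans (_ : (l * r + r <= _)%N); first by rewrite ltn_add2l.
  by rewrite leq_add2r (leq_trans _ (leq_addr _ _)) // leq_mul2r ltnW ?orbT.
exists (Retract injL prjL K cont); split=> n; last by exists n => p; apply: c1.
by exists (n * r + n + r)%N => p; apply: c2.
Qed.

End ModuleRetract.

End Retracts.

Lemma dependent_choice_seq (T : nat -> Type) (Q : forall i, T i -> Prop)
    (rel : forall i, T i -> T i.+1 -> Prop) :
  (exists x, Q 0%N x) ->
  (forall i x, Q i x -> exists y, Q i.+1 y /\ rel i x y) ->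
  exists f : forall i, T i, (forall i, Q i (f i)) /\ forall i, rel i (f i) (f i.+1).
Proof.
move=> ex0 exS.
pose x0 := cid ex0; pose next i (x : {x | Q i x}) := cid (exS i (projT1 x) (projT2 x)).
pose g := fix g i : {x | Q i x} := if i is k.+1 return {x | Q i x} then
  exist _ (projT1 (next k (g k))) (projT2 (next k (g k))).1 else x0.
exists (fun i => projT1 (g i)); split=> i; first exact: projT2.
exact: (projT2 (next i (g i))).2.
Qed.

(** * Noetherian row modules and resolutions by free modules of finite rank *)

Section NoetherianRows.
Variables (A : pzRingType).
Hypothesis noethA : noetherian_module A^o.

Lemma fg_cat (V : lmodType A) (L : set V) n1 n2 (e1 : 'I_n1 -> V) (e2 : 'I_n2 -> V) :
  (forall i, L (e1 i)) -> (forall i, L (e2 i)) ->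
  (forall v, L v -> exists a : 'I_n1 -> A, exists b : 'I_n2 -> A,
     v = \sum_i a i *: e1 i + \sum_i b i *: e2 i) -> fg_submodule L.
Proof.
move=> L1 L2 gen; exists (n1 + n2)%N.
exists (fun i => match fintype.split i with inl j => e1 j | inr j => e2 j end).
split=> [i|v /gen [a [b ->]]]; first by case: (fintype.split i).
exists (fun i => match fintype.split i with inl j => a j | inr j => b j end).
rewrite big_split_ord /=; congr (_ + _); apply: eq_bigr => i _.
  by have /= := unsplitK (inl i : 'I_n1 + 'I_n2) => ->.
by have /= := unsplitK (inr i : 'I_n1 + 'I_n2) => ->.
Qed.

Lemma noetherian_rows n : noetherian_module 'rV[A]_n.
Proof.
move=> L sL.
(* Induction on the number of trailing entries allowed to be nonzero: the entries at position [i] of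
   the rows in [Lk i] form a left ideal, and rows realising its generators are added to generators
   of [Lk i.+1]. *)
pose Lk k : set 'rV[A]_n := [set v | L v /\ forall j : 'I_n, (j < k)%N -> v 0 j = 0].
suff H k : fg_submodule (Lk (n - k)%N).
  have := H n; rewrite subnn; congr fg_submodule.
  by apply/predeqP => v; split=> [[]|].
elim: k => [|k IHk].
  rewrite subn0; exists 0%N, (fun=> 0); split=> [[]//|v [_ v0]].
  exists (fun=> 0); rewrite big_ord0; apply/rowP => j; rewrite mxE v0 //.
have [lenk|ltkn] := leqP n k.
  have -> : (n - k.+1 = n - k)%N.
    by move: lenk; rewrite subnS -subn_eq0 => /eqP ->.
  exact: IHk.
set i := (n - k.+1)%N; have iE : (n - k)%N = i.+1 by rewrite /i subnSK.
rewrite iE in IHk; have ltin : (i < n)%N by rewrite /i -subSn // subSS leq_subr.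
pose j0 := Ordinal ltin.
pose I : set A := [set a | exists2 v, Lk i v & v 0 j0 = a].
have sI : submodule (I : set A^o).
  split; first by exists 0; rewrite ?mxE //; split => [|j _]; rewrite ?mxE //; apply: submod0.
  move=> a _ _ [u [Lu u0] <-] [v [Lv v0] <-]; exists (a *: u + v); last by rewrite !mxE.
  split; first exact: sL.2.
  by move=> j ltj; rewrite !mxE u0 // v0 // mulr0 addr0.
have [m [e [eI egen]]] := noethA sI; have [l [g [gL ggen]]] := IHk.
have /choice [w wP] : forall s, exists v, Lk i v /\ v 0 j0 = e s.
  by move=> s; have [v] := eI s; exists v.
apply: (@fg_cat _ _ m l w g) => [s|s|v Lv]; first exact: (wP s).1.
  by have [gs g0] := gL s; split => // j ltj; apply: g0; apply: ltnW.
have [|a aE] := egen (v 0 j0); first by exists v.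
have [|b bE] := ggen (v - \sum_s a s *: w s); last first.
  by exists a, b; rewrite -bE addrC subrK.
split.
  apply: (submodB sL Lv.1); apply: submod_sum => // s _.
  by apply: submodZ => //; case: (wP s) => [[]].
move=> j; rewrite ltnS leq_eqVlt => ji; rewrite !mxE summxE.
case/orP: ji => [/eqP ji|ltji].
  have -> : j = j0 by apply: val_inj.
  rewrite aE; apply/eqP; rewrite subr_eq0; apply/eqP/eq_bigr => s _.
  by rewrite mxE (wP s).2.
rewrite (Lv.2 j ltji) big1 ?subrr // => s _.
by rewrite mxE (wP s).1.2 // mulr0.
Qed.

Lemma noetherian_seq (V : lmodType A) (v : nat -> V) : noetherian_module V ->
  exists b, forall n, exists c : 'I_b -> A, v n = \sum_(l < b) c l *: v l.
Proof.
move=> nV.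
pose L : set V := [set x | exists b, exists c : nat -> A, x = \sum_(l < b) c l *: v l].
have widen b b' (c : nat -> A) : (b <= b')%N -> \sum_(l < b) c l *: v l =
    \sum_(l < b') (if (l < b)%N then c l else 0) *: v l.
  move=> le; rewrite (big_ord_widen b' (fun l => c l *: v l) le) big_mkcond.
  by apply: eq_bigr => l _; case: ifP; rewrite ?scale0r.
have sL : submodule L.
  split; first by exists 0%N, (fun=> 0); rewrite big_ord0.
  move=> a _ _ [b1 [c1 ->]] [b2 [c2 ->]]; exists (maxn b1 b2).
  exists (fun l => a * (if (l < b1)%N then c1 l else 0) + (if (l < b2)%N then c2 l else 0)).
  rewrite (widen _ _ c1 (leq_maxl b1 b2)) (widen _ _ c2 (leq_maxr b1 b2)).
  rewrite scaler_sumr -big_split; apply: eq_bigr => l _.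
  by rewrite scalerDl scalerA.
have [s [e [eL gen]]] := nV L sL.
have /choice [b bP] := eL; pose B := \max_i b i.
exists B => n.
have /gen [a ->] : L (v n).
  exists n.+1, (fun l => if l == n then 1 else 0).
  rewrite big_ord_recr /= eqxx scale1r big1 ?add0r // => l _.
  by rewrite ltn_eqF ?scale0r.
have /choice [c cP] := bP.
exists (fun l => \sum_i a i * (if (l < b i)%N then c i l else 0)).
under eq_bigr => i _ do rewrite cP (widen _ _ (c i) (leq_bigmax i)) scaler_sumr.
rewrite exchange_big; apply: eq_bigr => l _.
by rewrite scaler_suml; apply: eq_bigr => i _; rewrite scalerA.
Qed.

End NoetherianRows.

Section FreeRows.
Variable A : pzRingType.

Definition row_comb (V : lmodType A) n (e : 'I_n -> V) (v : 'rV[A]_n) : V :=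
  \sum_j v 0 j *: e j.

Lemma row_comb_linear (V : lmodType A) n (e : 'I_n -> V) : linear (row_comb e).
Proof.
move=> a u v; rewrite /row_comb scaler_sumr -big_split; apply: eq_bigr => j _ /=.
by rewrite !mxE scalerDl scalerA.
Qed.

Lemma row_linear_expand (V : lmodType A) n (g : 'rV[A]_n -> V) : linear g ->
  forall v, g v = row_comb (fun j => g (delta_mx 0 j)) v.
Proof.
move=> lg v; rewrite {1}[v]row_sum_delta.
rewrite (big_morph g (linear_add lg) (linear_zero lg)); apply: eq_bigr => j _.
by rewrite -[_ *: delta_mx 0 j]addr0 lg (linear_zero lg) addr0.
Qed.

Lemma row_lift (Y Z : lmodType A) n (g : 'rV[A]_n -> Y) (d : Z -> Y) :
  linear g -> linear d -> (forall v, exists z, d z = g v) ->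
  exists2 h : 'rV[A]_n -> Z, linear h & forall v, d (h v) = g v.
Proof.
move=> lg ld im; have /choice [z zP] := fun j => im (delta_mx 0 j).
exists (row_comb z); first exact: row_comb_linear.
move=> v; rewrite (row_linear_expand lg) (big_morph d (linear_add ld) (linear_zero ld)).
apply: eq_bigr => j _.
by rewrite -[_ *: z j]addr0 ld (linear_zero ld) addr0 zP.
Qed.

Hypothesis noethA : noetherian_module A^o.

Lemma free_resolution (M : lmodType A) : finitely_generated M ->
  exists (m : nat -> nat) (D : forall i, 'M[A]_(m i.+1, m i)) (aug : 'rV[A]_(m 0%N) -> M),
    [/\ linear aug, forall x, exists v, aug v = x,
        forall v, aug v = 0 <-> exists w, v = w *m D 0%N &
        forall i (v : 'rV[A]_(m i.+1)), v *m D i = 0 <-> exists w, v = w *m D i.+1].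
Proof.
move=> [n0 [e [_ egen]]].
have ker n (L : set 'rV[A]_n) : submodule L -> exists m, exists D : 'M[A]_(m, n),
    forall v, L v <-> exists w, v = w *m D.
  move=> sL; have [m [g [gL ggen]]] := noetherian_rows noethA sL.
  exists m, (\matrix_(i, j) g i 0 j) => v; split=> [/ggen [a ->]|[w ->]].
    exists (\row_i a i); apply/rowP => j; rewrite summxE !mxE; apply: eq_bigr => i _.
    by rewrite !mxE.
  suff -> : w *m (\matrix_(i, j) g i 0 j) = \sum_i w 0 i *: g i.
    by apply: submod_sum => // i _; apply: submodZ.
  by apply/rowP => j; rewrite summxE !mxE; apply: eq_bigr => i _; rewrite !mxE.
have laug := row_comb_linear e; pose aug := row_comb e.
have s0 : submodule [set v | aug v = 0].
  split=> [|a u v /= u0 v0]; first exact: (linear_zero laug).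
  by rewrite [LHS]laug -/aug u0 v0 scaler0 addr0.
have sD m n (D : 'M[A]_(m, n)) : submodule [set v : 'rV[A]_m | v *m D = 0].
  split=> [|a u v /= u0 v0]; first by rewrite /= mul0mx.
  by rewrite mulmxDl -scalemxAl u0 v0 scaler0 addr0.
(* A stage bundles a matrix with its two sizes, so that in the iteration the number of rows of one
   matrix is by conversion the number of columns of the next. *)
pose st := {m : nat & {n : nat & 'M[A]_(m, n)}}.
pose mk m n D : st := existT _ m (existT (fun n => 'M[A]_(m, n)) n D).
have [m0 [D0 D0P]] := ker _ _ s0.
pose kerm m n (D : 'M[A]_(m, n)) := projT1 (cid (ker _ _ (sD m n D))).
pose kerD m n (D : 'M[A]_(m, n)) : 'M[A]_(kerm m n D, m) :=
  projT1 (cid (projT2 (cid (ker _ _ (sD m n D))))).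
have kerDP m n (D : 'M[A]_(m, n)) (v : 'rV[A]_m) : v *m D = 0 <-> exists w, v = w *m kerD m n D.
  exact: (projT2 (cid (projT2 (cid (ker _ _ (sD m n D))))) v).
pose next (s : st) : st := mk _ _ (kerD _ _ (projT2 (projT2 s))).
pose s i := iter i next (mk m0 n0 D0).
exists (fun i => projT1 (projT2 (s i))), (fun i => projT2 (projT2 (s i))), aug.
by split=> // x; have [a ->] := egen x I; exists (\row_j a j);
  apply: eq_bigr => j _; rewrite mxE.
Qed.

End FreeRows.

Section ChainMaps.
Variables (R : pzRingType) (M : lmodType R).
Local Unset Implicit Arguments.
Variables (m : nat -> nat) (D : forall i, 'M[R]_(m i.+1, m i)).
Variable (augA : 'rV[R]_(m 0%N) -> M).
Variables (B : nat -> lmodType R) (dB : forall i, B i.+1 -> B i).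
Local Set Implicit Arguments.
Variable (augB : B 0%N -> M).
Hypothesis laugA : linear augA.
Hypothesis exA0 : forall v, augA v = 0 <-> exists w, v = w *m D 0%N.
Hypothesis exA : forall i (v : 'rV[R]_(m i.+1)), v *m D i = 0 <-> exists w, v = w *m D i.+1.
Hypothesis ldB : forall i, linear (dB i).
Hypothesis laugB : linear augB.
Hypothesis surjB : forall x, exists b, augB b = x.
Hypothesis exB0 : forall b, augB b = 0 <-> exists b', b = dB 0%N b'.
Hypothesis exB : forall i b, dB i b = 0 <-> exists b', b = dB i.+1 b'.

Lemma free_chain_map : exists c : forall i, 'rV[R]_(m i) -> B i,
  [/\ forall i, linear (c i), forall v, augB (c 0%N v) = augA v &
      forall i v, dB i (c i.+1 v) = c i (v *m D i)].
Proof.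
have lD i : linear (fun v : 'rV[R]_(m i.+1) => v *m D i).
  by move=> a u v; rewrite mulmxDl scalemxAl.
pose Q i (c : 'rV[R]_(m i) -> B i) := linear c /\
  match i return ('rV[R]_(m i) -> B i) -> Prop with
  | 0 => fun c => forall v, augB (c v) = augA v
  | k.+1 => fun c => forall v, v *m D k = 0 -> dB k (c v) = 0
  end c.
have [||c [cQ cR]] := @dependent_choice_seq (fun i => 'rV[R]_(m i) -> B i) Q
  (fun i c c' => forall v, dB i (c' v) = c (v *m D i)).
- have [|h lh hP] := row_lift laugA laugB; first by move=> v; apply: surjB.
  by exists h.
- move=> i c [lc cP].
  have lcD : linear (fun v => c (v *m D i)) by move=> a u v; rewrite lD lc.
  have [|h lh hP] := row_lift lcD (@ldB i).
    move=> v; suff [b ->] : exists b, c (v *m D i) = dB i b by exists b.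
    case: i c lc cP lcD v => [|i] c lc cP lcD v.
      by apply/exB0; rewrite cP; apply/exA0; exists v.
    by apply/exB; apply: cP; apply/exA; exists v.
  by exists h; split => //; split => // v v0; rewrite hP v0 (linear_zero lc).
exists c; split => [i||i v]; [by have [] := cQ i | by have [] := cQ 0%N | exact: cR].
Qed.

End ChainMaps.

Section Image.
Variables (R : pzRingType) (U V : lmodType R) (d : {linear U -> V}).

Definition image_pred : pred V := fun v => `[< exists u, d u = v >].

Fact image_closed : submod_closed image_pred.
Proof.
split=> [|a u v]; first by apply/asboolP; exists 0; apply: linear0.
move=> /asboolP [x <-] /asboolP [y <-]; apply/asboolP.
by exists (a *: x + y); rewrite linearP.
Qed.

HB.instance Definition _ := GRing.isSubmodClosed.Build R V image_pred image_closed.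

Record image_of := ImageOf { image_val :> V ; _ : image_val \in image_pred }.

HB.instance Definition _ := [isSub for @image_val].
HB.instance Definition _ := [Choice of image_of by <:].
HB.instance Definition _ := [SubChoice_isSubLmodule of image_of by <:].

(** [projective] lifts only along surjections; the image of [d] is therefore turned into a module,
    and [d] is corestricted to it. *)
Lemma projective_lift (P : lmodType R) (f : {linear P -> V}) : projective P ->
  (forall x, exists u, d u = f x) ->
  exists h : {linear P -> U}, forall x, d (h x) = f x.
Proof.
move=> projP im.
have dI u : d u \in image_pred by apply/asboolP; exists u.
have fI x : f x \in image_pred by apply/asboolP; apply: im.
pose d' (u : U) : image_of := ImageOf (dI u).
pose f' (x : P) : image_of := ImageOf (fI x).
have ld : linear d' by move=> a u v; apply: val_inj; rewrite /= linearP.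
have lf : linear f' by move=> a u v; apply: val_inj; rewrite /= linearP.
pose d'L : {linear U -> image_of} := HB.pack d' (GRing.isLinear.Build _ _ _ _ d' ld).
pose f'L : {linear P -> image_of} := HB.pack f' (GRing.isLinear.Build _ _ _ _ f' lf).
have [|h hP] := projP _ _ d'L f'L.
  by move=> [v vI]; have /asboolP [u uE] := vI; exists u; apply: val_inj.
by exists h => x; have := congr1 image_val (hP x).
Qed.

End Image.

(** * The pseudocompact topology of a projective module *)

Section ModuleTopology.
Variables (R S : uniformRing) (sigma sigma' delta : R -> R).
Variables (C : {rmorphism R -> S}) (t : S) (coef : S -> nat -> R).
Local Notation J := (@Rpow R).
Hypotheses (pcR : left_pseudocompact_ring R) (noethR : noetherian_ring R).
Hypothesis fr : skew_frame sigma sigma' delta J.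
Hypothesis sf : series_frame sigma sigma' delta J C t coef.
Hypothesis S_ball : forall U : set S, nbhs 0 U -> exists n, coef_ball J coef n `<=` U.
Variables (P : uniformLmod S) (db : dual_basis P).
Hypothesis pcP : pseudocompact_module P.

Local Notation mball := (mod_ball J coef db).

Lemma nbhs_mod_ball (U : set P) : nbhs 0 U -> exists n, mball n `<=` U.
Proof.
have [cS _ _ base] := pcP; move=> /base [L [sL oL LU _]].
have L0 : nbhs 0 L by apply: open_nbhs_nbhs; split => //; apply: submod0.
have [| |n nP] := @ball_finite _ (fun j n => forall x, coef_ball J coef n x ->
    L (x *: db_vec db j)).
- by move=> j m m' le H x bx; apply: H; apply: (coef_ball_le fr le).
- move=> j; have : nbhs 0 [set x : S | L (x *: db_vec db j)].
    have cj : (fun x : S => x *: db_vec db j) @ (0 : S) --> (0 : S) *: db_vec db j.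
      apply: (@continuous_comp _ _ _ (fun x : S => (x, db_vec db j))
        (fun z : S * P => z.1 *: z.2)); last exact: cS.
      by apply: cvg_pair => /=; [exact: cvg_id | exact: cvg_cst].
    by apply: (cj L); rewrite scale0r.
  by move=> /S_ball.
exists n => p bp; apply: LU; rewrite (db_expand db p).
by apply: submod_sum => // j _; apply: nP; apply: bp.
Qed.

(** Uniqueness of the topology: the identity, from [P] with the topology of the dual basis to [P]
    with its given one, is continuous by [nbhs_mod_ball], hence open by the open mapping theorem. *)
Lemma mod_ball_nbhs n : nbhs 0 (mball n).
Proof.
have [_ hP _ base] := pcP.
have [q [q1 q2]] := retract_module fr sf db.
pose U : set (set (resScalars C P)) :=
  [set L | submodule (L : set P) /\ open (L : set P)].
have nU L : U L -> nbhs (0 : P) L.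
  by move=> [sL oL]; apply: open_nbhs_nbhs; split => //; apply: (submod0 sL).
have [k kP] := q1 n.
have [| | | | | |K UK KP] := @rt_open_mapping R sigma sigma' delta J fr
   (resScalars C P) (resScalars C P) q U id _ _ _ _ _ _ k.
- by [].
- by exists setT; split => //; apply: openT.
- move=> K L [sK oK] [sL oL]; exists (K `&` L) => //.
  by split; [apply: submodI | apply: openI].
- move=> L [sL _]; split; first exact: (submod0 sL).
  by move=> a u v; apply: (sL.2 (C a)).
- move=> p Up; apply/esym/hP => V W V0 Wp.
  have [L [sL oL LV _]] := base _ V0.
  by exists p; split; [apply: LV; apply: (Up L) | apply: nbhs_singleton].
- move=> K /nU /nbhs_mod_ball [m mK]; have [l lP] := q1 m.
  by exists l => p /lP /mK.
apply: filterS (nU _ UK) => p Kp; apply: kP.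
by have [p' Fp' <-] := KP p Kp.
Qed.

Lemma cont_homP (f : P -> R) :
  f \in @cont_hom R S C P <-> continuous_dual J C coef db f.
Proof.
split=> [/asboolP [lf cf]|[lf cf]].
  split => // n; apply: nbhs_mod_ball.
  by apply: (cf 0 (J n)); rewrite (rlinear0 lf); apply: Rpow_nbhs.
apply/asboolP; split => // x U.
move=> /nbhs_translate /(Rpow_base pcR) [n nU]; have [m mP] := cf n.
apply/nbhs_translate; apply: filterS (mod_ball_nbhs m) => y /mP /nU.
by rewrite /= (rlinearD lf).
Qed.

End ModuleTopology.

Section Comparison.
Variables (R S : pzRingType) (sigma sigma' delta : R -> R) (J : nat -> set R).
Variables (C : {rmorphism R -> S}) (t : S) (coef : S -> nat -> R).
Hypothesis fr : skew_frame sigma sigma' delta J.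
Hypothesis sf : series_frame sigma sigma' delta J C t coef.
Variables (M : lmodType S).
Local Unset Implicit Arguments.
Variables (P : nat -> lmodType S) (d : forall i, {linear P i.+1 -> P i}).
Variables (aug : {linear P 0%N -> M}) (db : forall i, dual_basis (P i)).
Variables (m : nat -> nat) (D : forall i, 'M[R]_(m i.+1, m i)).
Variables (augA : 'rV[R]_(m 0%N) -> resScalars C M).
Variables (c : forall i, 'rV[R]_(m i) -> resScalars C (P i)).
Hypothesis resP : is_projective_resolution d aug.
Hypothesis surjA : forall x, exists v, augA v = x.
Hypothesis exA0 : forall v, augA v = 0 <-> exists w, v = w *m D 0%N.
Hypothesis exA : forall i (v : 'rV[R]_(m i.+1)), v *m D i = 0 <-> exists w, v = w *m D i.+1.
Hypothesis lc : forall i, linear (c i).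
Hypothesis augc : forall v, aug (c 0%N v) = augA v.
Hypothesis dc : forall i v, d i (c i.+1 v) = c i (v *m D i).

Definition row_filt (n k : nat) : set 'rV[R]_n := [set v | forall j, J k (v 0 j)].

Let FB i (n : nat) : set (resScalars C (P i)) := mod_ball J coef (db i) n.

Let d_fun i : resScalars C (P i.+1) -> resScalars C (P i) := d i.

Let row_d i (v : 'rV[R]_(m i.+1)) : 'rV[R]_(m i) := v *m D i.

Local Set Implicit Arguments.

Let Jl := frJl fr.

Local Notation cd i := (continuous_dual J C coef (db i)).

Lemma row_filtration n : filtration (row_filt n).
Proof.
split=> [k|k l le v Jv j]; last by apply: (frJ_le fr le); apply: Jv.
split=> [j|a u v Ju Jv j]; rewrite !mxE; first exact: (lideal0 (Jl k)).
by apply: (lidealD (Jl k)) => //; apply: (lidealM (Jl k)).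
Qed.

Lemma row_lcont n (X : lmodType R) (F : nat -> set X) (g : 'rV[R]_n -> X) :
  (forall k, submodule (F k)) ->
  (forall x k, exists l, forall a, J l a -> F k (a *: x)) -> linear g ->
  lcont (row_filt n) F g.
Proof.
move=> sF cF lg; split => // k.
have [| |l lP] := @ball_finite _ (fun j l => forall a, J l a ->
    F k (a *: g (delta_mx 0 j))).
- by move=> j l l' le H a Ja; apply: H; apply: (frJ_le fr le).
- by move=> j; apply: cF.
exists l => v Jv; rewrite (row_linear_expand lg); apply: submod_sum => // j _.
by apply: lP; apply: Jv.
Qed.

Lemma J_filtration : filtration (J : nat -> set R^o).
Proof. by split=> [n|k n le x]; [apply: Jl | apply: (frJ_le fr le)]. Qed.

Lemma mod_ball_filtration i : filtration (FB i).
Proof.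
split=> [n|k n le p]; last exact: (mod_ball_le fr).
split=> [j|a u v bu bv j]; first by rewrite linear0; apply: (coef_ball0 fr sf).
have -> : db_coord (db i) j (a *: u + v) = C a * db_coord (db i) j u + db_coord (db i) j v.
  exact: linearP.
apply: (coef_ballD fr sf) => // k ltk; rewrite (srC sf).
by apply: (lidealM (Jl n)); apply: bu.
Qed.

Let lrow_d i : lcont (row_filt (m i.+1)) (row_filt (m i)) (row_d i).
Proof.
apply: row_lcont; first by move=> k; have [] := row_filtration (m i).
  move=> x k; exists k => a Ja j; rewrite mxE; exact: (frJr fr).
by move=> a u v; rewrite /row_d mulmxDl scalemxAl.
Qed.

Let ld i : lcont (FB i.+1) (FB i) (d i).
Proof.
split; first by move=> a u v; apply: (linearP (d i) (C a)).
exact: (mod_ball_linear fr sf).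
Qed.

Let lcc i : lcont (row_filt (m i)) (FB i) (c i).
Proof.
apply: row_lcont => //; first by move=> k; have [] := mod_ball_filtration i.
move=> x k; have [l lP] := ball_scale fr sf (db i) k x.
exists l => a Ja; apply: lP => j _; rewrite (srC1 sf).
by case: ifP => _ //; apply: (lideal0 (Jl l)).
Qed.

Local Notation coneX := (cone R (fun i => 'rV[R]_(m i)) (fun i => resScalars C (P i))).
Local Notation coneF := (cone_filt R (fun i => 'rV[R]_(m i)) (fun i => resScalars C (P i))
  (fun i => row_filt (m i)) FB).

Let cone_retract i : exists q : retract J (coneX i),
  (forall n, exists k, forall x, rt_filt q k x -> coneF i n x) /\
  (forall n, exists k, forall x, coneF i k x -> rt_filt q n x).
Proof.
case: i => [|i]; first exact: (retract_module fr sf (db 0%N)).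
have [q [q1 q2]] := retract_module fr sf (db i.+1).
have [r [r1 rP]] := retract_row fr (m i).
have [p [p1 p2]] := retract_prod fr q r.
exists p; split=> n.
  have [k1 k1P] := q1 n; have [k2 k2P] := r1 n.
  have [l lP] := p1 (maxn k1 k2); exists l => x /lP [x1 x2]; split.
    by apply: k1P; apply: (rt_filtration fr q).2 x1; apply: leq_maxl.
  by apply: k2P; apply: (rt_filtration fr r).2 x2; apply: leq_maxr.
have [l lP] := p2 n; have [k1 k1P] := q2 l; have [k2 k2P] := rP l.
exists (maxn k1 k2) => x [x1 x2]; apply: lP.
  by apply: k1P; apply: (mod_ball_filtration i.+1).2 x1; apply: leq_maxl.
by apply: k2P; apply: (row_filtration (m i)).2 x2; apply: leq_maxr.
Qed.

Let cone_lift i (phi : coneX i -> coneX i) : lcont (coneF i) (coneF i) phi ->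
  (forall x, exists y, cone_d R _ _ row_d d_fun c i y = phi x) ->
  exists2 s : coneX i -> coneX i.+1, lcont (coneF i) (coneF i.+1) s &
    forall x, cone_d R _ _ row_d d_fun c i (s x) = phi x.
Proof.
move=> [lphi cphi] im; have [q [q1 q2]] := cone_retract i.
have [r [r1 r2]] := cone_retract i.+1.
have [lcd ccd] := cone_d_lcont (fun i => row_filtration (m i)) mod_ball_filtration lrow_d ld lcc i.
have [| |s [ls cs] sP] := @lift_retract R sigma sigma' delta J fr _ _ _ q q r phi _ _ _ im.
- split => // n; have [k kP] := q2 n; have [l lP] := cphi k; have [h hP] := q1 l.
  by exists h => x /hP /lP /kP.
- split => // n; have [k kP] := q2 n; have [l lP] := ccd k; have [h hP] := r1 l.
  by exists h => x /hP /lP /kP.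
exists s => //; split => // n.
have [k kP] := r1 n; have [l lP] := cs k; have [h hP] := q2 l.
by exists h => x /hP /lP /kP.
Qed.

Let lJ n (g : 'rV[R]_n -> R^o) : linear g ->
  lcont (row_filt n) (J : nat -> set R^o) g.
Proof.
apply: row_lcont => [k|x k]; first exact: Jl.
by exists k => a; apply: (frJr fr).
Qed.

Let laugP : linear (aug : resScalars C (P 0%N) -> resScalars C M).
Proof. by move=> a u v; apply: (linearP aug (C a)). Qed.

Lemma comparison_inj0 (beta : P 0%N -> R) : cd 0%N beta ->
  (forall p, beta (d 0%N p) = 0) -> (forall v, beta (c 0%N v) = 0) ->
  forall p, beta p = 0.
Proof.
case: resP => projP surjP exP0 exP.
exact: (@cone_inj0 R J (fun i => 'rV[R]_(m i)) (fun i => resScalars C (P i)) _ FB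
  row_d d_fun c augA aug laugP surjA exP0 augc beta).
Qed.

Lemma comparison_injS k (beta : P k.+1 -> R) (gamma : 'rV[R]_(m k) -> R^o) :
  cd k.+1 beta -> linear gamma -> (forall p, beta (d k.+1 p) = 0) ->
  (forall v, beta (c k.+1 v) = gamma (v *m D k)) ->
  exists2 beta' : P k -> R, cd k beta' & forall p, beta p = beta' (d k p).
Proof.
case: resP => projP surjP exP0 exP cb lg bd bc.
exact: (cone_injS (fun i => row_filtration (m i)) mod_ball_filtration lrow_d ld lcc
  laugP surjA exA0 exP0 exA exP augc dc cone_lift J_filtration cb (lJ lg) bd bc).
Qed.

Lemma comparison_surj k (alpha : 'rV[R]_(m k) -> R^o) :
  linear alpha -> (forall v, alpha (v *m D k) = 0) ->
  exists2 beta : P k -> R, cd k beta & (forall p, beta (d k p) = 0) /\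
    match k return ('rV[R]_(m k) -> R^o) -> (P k -> R) -> Prop with
    | 0%N => fun alpha beta => forall v, alpha v = beta (c 0%N v)
    | k'.+1 => fun alpha beta => exists2 gamma : 'rV[R]_(m k') -> R^o, linear gamma &
        forall v, alpha v = beta (c k'.+1 v) + gamma (v *m D k')
    end alpha beta.
Proof.
case: resP => projP surjP exP0 exP la ad.
have [beta cb [bd H]] := cone_surjective (fun i => row_filtration (m i)) mod_ball_filtration
  lrow_d ld lcc laugP surjA exA0 exP0 exA exP augc dc cone_lift J_filtration (lJ la) ad.
exists beta => //; split => //; case: k alpha la ad beta cb bd H => [//|k] alpha la ad beta cb bd.
by move=> [gamma [lg _] H]; exists gamma.
Qed.

End Comparison.

(** * The connecting homomorphism *)

Section Acyclicity.
Variables (R S : pzRingType) (sigma sigma' delta : R -> R) (J : nat -> set R).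
Variables (C : {rmorphism R -> S}) (t : S) (coef : S -> nat -> R).
Hypothesis fr : skew_frame sigma sigma' delta J.
Hypothesis sf : series_frame sigma sigma' delta J C t coef.
Variables (M : lmodType S).
Local Unset Implicit Arguments.
Variables (P : nat -> lmodType S) (d : forall i, {linear P i.+1 -> P i}).
Variables (aug : {linear P 0%N -> M}) (db : forall i, dual_basis (P i)).
Local Set Implicit Arguments.
Hypothesis resP : is_projective_resolution d aug.

Local Notation cd i := (continuous_dual J C coef (db i)).
Local Notation T := (Top sigma' delta (fun p => t *: p)).
Local Notation th := (theta sigma' delta J (fun p => t *: p)).
Local Notation tau := (shift_twist sigma' delta).

Definition dual_boundary (i : nat) : (P i -> R) -> Prop :=
  match i return (P i -> R) -> Prop with
  | 0 => fun f => f = 0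
  | k.+1 => fun f => exists2 g, cd k g & f = g \o d k
  end.

Definition dual_cocycle (i : nat) (f : P i -> R) := cd i f /\ forall p, f (d i p) = 0.

Lemma dd i p : d i (d i.+1 p) = 0.
Proof. by case: resP => _ _ _ exP; apply/exP; exists p. Qed.

Lemma boundary_cd i (f : P i -> R) : dual_boundary f -> cd i f.
Proof.
case: i f => [|i] f /=; first by move=> ->; apply: (cd0 C coef fr _).
by move=> [g cg ->]; exact: (cd_comp fr sf (db i.+1) (d i) cg).
Qed.

Lemma boundary0 i : dual_boundary (0 : P i -> R).
Proof.
case: i => [//|i] /=; exists 0; first exact: (cd0 C coef fr _).
by apply/funext.
Qed.

Lemma boundaryB i (f g : P i -> R) :
  dual_boundary f -> dual_boundary g -> dual_boundary (f - g).
Proof.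
case: i f g => [|i] f g /=; first by move=> -> ->; rewrite subrr.
by move=> [f' cf ->] [g' cg ->]; exists (f' - g') => //; apply: (cdB fr).
Qed.

Lemma boundary_theta i (f : P i -> R) b : dual_boundary f -> dual_boundary (th f b).
Proof.
case: i f => [|i] f /=; first by move=> ->; rewrite (theta0 fr).
move=> [g cg ->]; exists (th g b); first exact: (cd_theta fr sf).
exact: theta_comp.
Qed.

Lemma boundary_cocycle i (f : P i -> R) : dual_boundary f -> dual_cocycle f.
Proof.
move=> bf; split; first exact: boundary_cd.
case: i f bf => [|i] f /=; first by move=> ->.
by move=> [g [lg _] ->] p; rewrite /= dd (rlinear0 lg).
Qed.

Lemma cocycleB i (f g : P i -> R) :
  dual_cocycle f -> dual_cocycle g -> dual_cocycle (f - g).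
Proof.
move=> [cf f0] [cg g0]; split; first exact: (cdB fr).
by move=> p; rewrite -[LHS]/(f _ - g _) f0 g0 subrr.
Qed.

Lemma cocycle_theta i (f : P i -> R) b : dual_cocycle f -> dual_cocycle (th f b).
Proof.
move=> [cf f0]; split; first exact: (cd_theta fr sf).
move=> p; have := theta_comp sigma' delta J t (d i) f b.
have -> : f \o d i = 0 by apply/funext => q; apply: f0.
by rewrite (theta0 fr) => /(congr1 (@^~ p)).
Qed.

(** Instance of [cd_expand] for the free module of rank one and the functional taking the
    coefficient of index [n]. *)
Lemma coef_mul_expand x y n : coef (x * y) n = Sum J (fun k => coef x k * coef (t ^+ k * y) n).
Proof.
pose idL : {linear S^o -> S^o} :=
  HB.pack (fun p : S^o => p) (GRing.isLinear.Build _ _ _ _ (fun p : S^o => p) (fun _ _ _ => erefl)).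
have db1 : forall p : S^o, p = \sum_(j < 1) (idL p : S) *: (1 : S^o).
  by move=> p; rewrite big_ord1 -[_ *: _]/(p * 1) mulr1.
pose dbS := @DualBasis S S^o 1 (fun=> 1) (fun=> idL) db1.
have := @cd_expand R S sigma sigma' delta J C t coef fr sf S^o dbS _ x y
  (@cd_coef R S sigma sigma' delta J C t coef fr sf S^o dbS (fun p : S^o => p : S) n _).
by apply.
Qed.

Section SeriesMaps.
Variables (N : lmodType S) (dbN : dual_basis N) (l : nat -> N -> R).
Hypothesis cl : forall n, continuous_dual J C coef dbN (l n).

Lemma series_rlinear a p q :
  series_of coef (fun n => l n (C a *: p + q)) =
  C a * series_of coef (fun n => l n p) + series_of coef (fun n => l n q).
Proof.
apply: (series_inj sf) => n; rewrite (srD sf) (srC sf) !(coef_series_of sf).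
exact: (rlinearP (cl n).1).
Qed.

(** Compatibility with [T] says exactly that the series commutes with [t]; with R-linearity and
    continuity of the coefficients, expansion in powers of [t] extends this to all scalars in
    [S]. *)
Lemma series_linear : T (l 0%N) = 0 -> (forall n, T (l n.+1) = l n) ->
  linear (fun p => series_of coef (fun n => l n p) : S^o).
Proof.
move=> T0 Tl; pose u p := series_of coef (fun n => l n p).
have ut p : u (t *: p) = t * u p.
  apply: (series_inj sf) => n; rewrite (srt sf) !(coef_series_of sf).
  rewrite (TopP fr (fun p => t *: p)); congr (sigma _ + _).
  by case: n => [|n]; rewrite ?T0 ?Tl ?(coef_series_of sf).
have uk k p : u (t ^+ k *: p) = t ^+ k * u p.
  elim: k => [|k IHk]; first by rewrite scale1r mul1r.
  by rewrite exprS -scalerA ut IHk mulrA.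
have us x p : u (x *: p) = x * u p.
  apply: (series_inj sf) => n; rewrite coef_mul_expand (coef_series_of sf).
  rewrite (cd_expand fr sf _ _ (cl n)); apply: eq_Sum => k.
  by rewrite -uk (coef_series_of sf).
move=> a p q; rewrite -[RHS]/(a * u p + u q) -us.
by have := series_rlinear 1 (a *: p) q; rewrite rmorph1 scale1r mul1r.
Qed.

End SeriesMaps.

(* [l] lifts [g] to the limit of the tower of the [T]s, and [f] is the coboundary
   of [l]. *)
Definition connecting (i : nat) (f : P i.+1 -> S) (g : P i -> R) := exists l : nat -> P i -> R,
  [/\ forall n, cd i (l n), T (l 0%N) = g, forall n, T (l n.+1) = l n &
      forall n p, coef (f p) n = l n (d i p)].

Lemma connectingB i (f f' : P i.+1 -> S) g g' : connecting f g -> connecting f' g' ->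
  connecting (f - f') (g - g').
Proof.
move=> [l [cl gE Tl fl]] [l' [cl' gE' Tl' fl']].
exists (fun n => l n - l' n); split => [n||n|n p]; first exact: (cdB fr).
- by rewrite (TopB fr) gE gE'.
- by rewrite (TopB fr) Tl Tl'.
by rewrite -[(f - f') p]/(f p - f' p) (scoefB sf) fl fl'.
Qed.

Lemma connecting_cocycle i (f : P i.+1 -> S) g : linear (f : P i.+1 -> S^o) ->
  connecting f g -> dual_cocycle g.
Proof.
move=> lf [l [cl gE Tl fl]]; split; first by rewrite -gE; apply: (cd_Top fr sf).
move=> p; rewrite -gE -[LHS]/((T (l 0%N) \o d i) p) -Top_comp.
have -> : l 0%N \o d i = fun p => coef (f p) 0 by apply/funext => q; rewrite fl.
by rewrite (Top_coef fr sf).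
Qed.

(** Let [u] be the series with coefficients [l]. The coefficients [w] of [u * x] have the right
    coboundary, but are not [T]-compatible, since [u (t *: p) = t * u p + C (sigma (g p))]. The
    error [g p * sigma' (coef x q)] is removed by adding [theta] of [g] at [b q], a cocycle, so the
    coboundary is unchanged. Here [b q] collects the coefficients of index [q] of the iterated left
    quotients of [x] by [t], and applying [T] at level 0 leaves precisely the right coefficients of
    [x]. *)
Lemma connecting_mulr i (f : P i.+1 -> S) g x : linear (f : P i.+1 -> S^o) -> connecting f g ->
  connecting (fun p => f p * x) (th g (fun k => sigma' (right_coef sigma' delta J coef x k))).
Proof.
move=> lf fg; have cg := connecting_cocycle lf fg.
have [l [cl gE Tl fl]] := fg.
pose u p := series_of coef (fun n => l n p).
have ld p : u (d i p) = f p by apply: (series_inj sf) => n; rewrite (coef_series_of sf) fl.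
have ut p : u (t *: p) = t * u p + C (sigma (g p)).
  apply: (series_inj sf) => n; rewrite (srD sf) (srt sf) (srC1 sf) !(coef_series_of sf).
  rewrite (TopP fr (fun p => t *: p)); case: n => [|n] /=.
    by rewrite gE (frs_0 fr) add0r addrC.
  by rewrite Tl (coef_series_of sf) addr0.
pose L := left_div sigma' delta J coef.
pose b q k := coef (iter k.+1 L x) q.
pose w q p := coef (u p * x) q.
have vg : vanishing sigma' delta J (fun p : P i => t *: p) g.
  by apply: (cd_vanishing fr sf (db := db i)); case: cg.
have cw q : cd i (w q).
  split.
    move=> a p p'; change (w q (C a *: p + p') = a * w q p + w q p').
    by rewrite /w /u (series_rlinear cl) mulrDl (srD sf) -mulrA (srC sf).
  move=> n; have [m mP] := srM sf x (maxn n q.+1).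
  pose Q k m' := forall p, mod_ball J coef (db i) m' p -> J m (l k p).
  have [|k _|m' m'P] := @finite_uniform Q m.
  - by move=> k m1 m2 le H p bp; apply: H; apply: (mod_ball_le fr le).
  - by have [_ /(_ m)] := cl k.
  exists m' => p bp; apply: (frJ_le fr (leq_maxl n q.+1)).
  apply: mP; last by rewrite leq_max ltnSn orbT.
  by move=> k ltkm; rewrite (coef_series_of sf); apply: m'P.
have Tw q : T (w q) = (fun p => (if q is k.+1 then w k p else 0) + g p * sigma' (coef x q)).
  apply/funext => p; rewrite /Top /w ut mulrDl -mulrA (srD sf) (srt sf) (srC sf).
  rewrite addrAC addrK (frs'_D fr) (frs'_M fr) !(frs_K fr).
  by case: q.
have taub q : tau (b q.+1) = (fun k => b q k - delta_seq 0 (sigma' (coef x q.+1)) k).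
  apply/funext => k; rewrite /shift_twist /delta_seq.
  have LE y := coef_left_div fr sf y q.
  case: k => [|k] /=.
    rewrite sub0r -[X in sigma' X]opprK opprK.
    have -> : - delta (b q.+1 0%N) = sigma (b q 0%N) - coef x q.+1.
      by rewrite LE opprD addrA subrr add0r.
    by rewrite (frs'_B fr) (frs_K fr).
  by rewrite {1}/b LE addrK (frs_K fr) subr0.
have taub0 : tau (b 0%N) = (fun k => sigma' (right_coef sigma' delta J coef x k) -
    delta_seq 0 (sigma' (coef x 0)) k).
  apply/funext => k; rewrite /shift_twist /delta_seq /right_coef /right_coef0.
  case: k => [|k] /=; last by rewrite subr0.
  by rewrite -(frs'_B fr) addrAC subrr.
exists (fun q => w q + th g (b q)); split => [q||q|q p].
- by apply: (cdD fr) => //; apply: (cd_theta fr sf); case: cg.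
- rewrite (TopD fr) Tw (Top_theta fr) // taub0 (thetaBr fr) // (theta_delta fr).
  by apply/funext => p /=; rewrite -[LHS]/(0 + _ + (_ - _)) add0r addrCA subrr addr0.
- rewrite (TopD fr) Tw (Top_theta fr) // taub (thetaBr fr) // (theta_delta fr).
  apply/funext => p /=; rewrite -[LHS]/(_ + _ + (_ - _)) -addrA; congr (_ + _).
  by rewrite addrCA subrr addr0.
rewrite -[RHS]/(w q _ + th g _ (d i p)) /w ld.
by have [_ ->] := cocycle_theta (b q) cg; rewrite addr0.
Qed.

Section FinitelyGenerated.
Hypothesis fgM : finitely_generated (resScalars C M).
Hypothesis noethR : noetherian_module R^o.
Hypothesis noethRc : noetherian_module (R^c)^o.

Lemma free_comparison : exists m : nat -> nat, exists c : forall i, 'rV[R]_(m i) -> resScalars C (P i),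
  (forall i, linear (c i)) /\
  (forall i (f : P i -> R), dual_cocycle f -> (forall v, f (c i v) = 0) -> dual_boundary f).
Proof.
have [m [D [augA [laugA surjA exA0 exA]]]] := free_resolution noethR fgM.
have [projP surjP exP0 exP] := resP.
have ldP i : linear (d i : resScalars C (P i.+1) -> resScalars C (P i)).
  by move=> a u v; apply: (linearP (d i) (C a)).
have laug : linear (aug : resScalars C (P 0%N) -> resScalars C M).
  by move=> a u v; apply: (linearP aug (C a)).
have [c [lc augc dc]] := @free_chain_map R (resScalars C M) m D augA
  (fun i => resScalars C (P i)) (fun i => d i) aug laugA exA0 exA ldP laug surjP exP0 exP.
exists m, c; split => // -[|i] f [cf f0] fc.
  apply/funext => p.
  exact: (comparison_inj0 (db := db) D resP surjA augc cf f0 fc).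
have [| |g cg gE] := comparison_injS fr sf resP surjA exA0 exA lc augc dc
  (gamma := fun=> 0) cf _ f0 _.
- by move=> a u v; rewrite scaler0 addr0.
- by [].
by exists g => //; apply/funext.
Qed.

(** Functionals form a right R-module, so their values on the basis make up a row over the opposite
    ring [R^c]; this is where right noetherianity enters. *)
Let row_eval (m : nat) i (c : 'rV[R]_m -> resScalars C (P i)) (f : P i -> R) : 'rV[R^c]_m :=
  \row_j f (c (delta_mx 0 j)).

Let boundary_of_row i m (c : 'rV[R]_m -> resScalars C (P i)) : linear c ->
  (forall f : P i -> R, dual_cocycle f -> (forall v, f (c v) = 0) -> dual_boundary f) ->
  forall r (z : 'I_r -> P i -> R) (a : 'I_r -> R) f, dual_cocycle f ->
  (forall l, dual_cocycle (z l)) ->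
  row_eval c f = \sum_l (a l : R^c) *: row_eval c (z l) ->
  dual_boundary (f - fun p => \sum_l z l p * a l).
Proof.
move=> lc cP r z a f cf cz E.
have csum : dual_cocycle (fun p => \sum_l z l p * a l).
  have H s : dual_cocycle (fun p => \sum_(l <- s) z l p * a l).
    elim: s => [|l s IHs].
      have := boundary_cocycle (boundary0 i); congr dual_cocycle.
      by apply/funext => p; rewrite big_nil.
    have cl : dual_cocycle (fun p => z l p * a l).
      have := cocycle_theta (delta_seq 0 (a l)) (cz l).
      by rewrite (theta_delta fr).
    have := cocycleB cl (cocycleB (boundary_cocycle (boundary0 i)) IHs).
    congr dual_cocycle; rewrite sub0r opprK; apply/funext => p.
    by rewrite big_cons.
  exact: H.
apply: cP => [|v]; first exact: cocycleB.
rewrite -[LHS]/(f (c v) - _); apply/eqP; rewrite subr_eq0; apply/eqP.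
have lcf (g : P i -> R) : dual_cocycle g -> g (c v) = \sum_j v 0 j * g (c (delta_mx 0 j)).
  move=> [[lg _] _]; rewrite (row_linear_expand lc) /row_comb (rlinear_sum lg).
  by apply: eq_bigr => j _; apply: (rlinearZ lg).
rewrite (lcf f) // (lcf _ csum); apply: eq_bigr => j _; congr (_ * _).
have := congr1 (fun w : 'rV[R^c]_m => w 0 j) E.
rewrite mxE summxE => ->; apply: eq_bigr => l _.
by rewrite !mxE.
Qed.

Lemma cocycle_generators i : exists r, exists z : 'I_r -> P i -> R,
  (forall l, dual_cocycle (z l)) /\ forall f, dual_cocycle f ->
  exists a : 'I_r -> R, dual_boundary (f - fun p => \sum_l z l p * a l).
Proof.
have [m [c [lc cP]]] := free_comparison.
pose L : set 'rV[R^c]_(m i) := [set v | exists2 f, dual_cocycle f & v = row_eval (c i) f].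
have sL : submodule L.
  split.
    exists 0; first exact: boundary_cocycle (boundary0 i).
    by apply/rowP => j; rewrite !mxE.
  move=> a _ _ [f cf ->] [g cg ->].
  exists ((fun p => f p * a) - (0 - g)).
    apply: cocycleB; last by apply: cocycleB => //; exact: boundary_cocycle (boundary0 i).
    by have := cocycle_theta (delta_seq 0 a) cf; rewrite (theta_delta fr).
  by rewrite sub0r opprK; apply/rowP => j; rewrite !mxE.
have [r [e [eL gen]]] := noetherian_rows noethRc sL.
have /choice [z zP] : forall l, exists f, dual_cocycle f /\ e l = row_eval (c i) f.
  by move=> l; have [f] := eL l; exists f.
exists r, z; split=> [l|f cf]; first by case: (zP l).
have [|a aE] := gen (row_eval (c i) f); first by exists f.
exists a; apply: (boundary_of_row (lc i) (cP i)) => // [l|]; first by case: (zP l).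
by rewrite aE; apply: eq_bigr => l _; have [_ ->] := zP l.
Qed.

Lemma cocycle_limit i (f : nat -> P i -> R) : (forall n, dual_cocycle (f n)) ->
  (forall n, dual_boundary (f n - T (f n.+1))) -> forall n, dual_boundary (f n).
Proof.
move=> cf Tf; have [m [c [lc cP]]] := free_comparison.
apply: (limit_absorb fr (tp := fun p : P i => t *: p)) => //.
- exact: boundary0.
- exact: boundaryB.
- by move=> g b; apply: boundary_theta.
- by move=> n; apply: (cd_vanishing fr sf (db := db i)); case: (cf n).
have [b bP] := noetherian_seq (fun n => row_eval (c i) (f n)) (noetherian_rows noethRc (n := m i)).
exists b => n; have [a aE] := bP n; exists a.
exact: (boundary_of_row (lc i) (cP i) _ _ aE).
Qed.

Lemma Top_inverse i : exists inv : (P i -> R) -> P i -> R,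
  forall g, cd i g -> cd i (inv g) /\ T (inv g) = g.
Proof.
have /choice [inv invP] : forall g : P i -> R, exists f, cd i g -> cd i f /\ T f = g.
  move=> g; have [cg|ncg] := pselect (cd i g); last by exists 0.
  by have [f cf fE] := Top_surjective fr sf cg; exists f.
by exists inv.
Qed.

(** Vanishing of lim gives primitives [k n] of the [f n], which fail to be [T]-compatible by
    cocycles [z n]. Two corrections follow: cocycles [y n] make the defect a coboundary, and
    coboundaries then remove it. *)
Lemma cocycle_acyclic i (f : nat -> P i.+1 -> R) : (forall n, dual_cocycle (f n)) ->
  (forall n, T (f n.+1) = f n) ->
  exists l : nat -> P i -> R, [/\ forall n, cd i (l n), forall n, T (l n.+1) = l n &
    forall n, f n = l n \o d i].
Proof.
move=> cf Tf.
have /choice [k kP] : forall n, exists g, cd i g /\ f n = g \o d i.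
  move=> n; suff [g cg gE] : dual_boundary (f n) by exists g.
  by apply: cocycle_limit => // j; rewrite Tf subrr; apply: boundary0.
have ck n : cd i (k n) by case: (kP n).
pose z n := T (k n.+1) - k n.
have cz n : dual_cocycle (z n).
  split; first by apply: (cdB fr) => //; apply: (cd_Top fr sf).
  move=> p; rewrite -[LHS]/(((T (k n.+1)) \o d i) p - (k n \o d i) p).
  by rewrite -Top_comp; have [_ <-] := kP n.+1; have [_ <-] := kP n; rewrite Tf subrr.
have [r [g [cg gP]]] := cocycle_generators i.
have /choice [a aP] := fun n => gP _ (cz n).
(* With [z n] written on the generators modulo boundaries, the equation [y n - T (y n.+1) = z n] is
   solved for the coefficients on each generator separately. *)
have /choice [b bP] := fun l : 'I_r => shift_twist_telescope fr (fun n => a n l).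
have vg l : vanishing sigma' delta J (fun p : P i => t *: p) (g l).
  by apply: (cd_vanishing fr sf (db := db i)); case: (cg l).
pose y n := \sum_(l < r) th (g l) (b l n).
have cy n : dual_cocycle (y n).
  rewrite /y; apply: (big_ind (@dual_cocycle i)) => [|u v cu cv|l _].
  - exact: boundary_cocycle (boundary0 i).
  - rewrite -[v]opprK -[- v]sub0r; apply: cocycleB => //; apply: cocycleB => //.
    exact: boundary_cocycle (boundary0 i).
  by apply: cocycle_theta.
have Tsum I (s : seq I) (F : I -> P i -> R) : T (\sum_(l <- s) F l) = \sum_(l <- s) T (F l).
  by apply: (big_morph T); [apply: (TopD fr) | apply: (Top0 fr)].
have yT n : y n - T (y n.+1) = fun p => \sum_l g l p * a n l.
  rewrite /y Tsum -sumrB fct_sumE; apply/funext => p; apply: eq_bigr => l _.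
  rewrite (Top_theta fr) // -(thetaBr fr) //.
  by rewrite (funext (bP l n)) (theta_delta fr).
pose k' n := k n + y n.
have ck' n : cd i (k' n) by apply: (cdD fr) => //; case: (cy n).
have k'd n : k' n \o d i = f n.
  apply/funext => p; rewrite -[LHS]/(k n (d i p) + y n (d i p)).
  have [_ ->] := cy n; rewrite addr0.
  by have [_ ->] := kP n.
have bk' n : dual_boundary (T (k' n.+1) - k' n).
  have -> : T (k' n.+1) - k' n = z n - (y n - T (y n.+1)).
    by rewrite /k' (TopD fr) /z opprB opprD addrACA [T _ - y n]addrC.
  by rewrite yT; apply: aP.
(* What remains depends on the degree: in degree 0 a boundary is zero and [k'] is already
   compatible. *)
clearbody k'; clear kP ck z cz r g cg gP a aP b bP vg y cy Tsum yT k.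
case: i f cf Tf k' ck' k'd bk' => [|i] f cf Tf k' ck' k'd bk'.
  exists k'; split => // n.
  by apply/eqP; rewrite -subr_eq0; apply/eqP/bk'.
have /choice [be beP] : forall n, exists g, cd i g /\ T (k' n.+1) - k' n = g \o d i.
  by move=> n; have [g cg gE] := bk' n; exists g.
have [inv invP] := Top_inverse i.
(* The defect of [k'] is [be n \o d i]. Surjectivity of [T] one degree lower solves
   [T (e n.+1) = e n + be n], and subtracting [e n \o d i] leaves the coboundary of [k' n]
   unchanged. *)
pose e := fix e n := if n is j.+1 then inv (e j + be j) else 0.
have ce n : cd i (e n).
  elim: n => [|n IHn] /=; first exact: (cd0 C coef fr _).
  by apply: (invP _ _).1; apply: (cdD fr) => //; case: (beP n).
have Te n : T (e n.+1) = e n + be n.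
  by apply: (invP _ _).2; apply: (cdD fr) => //; case: (beP n).
exists (fun n => k' n - (e n \o d i)); split => n.
- by apply: (cdB fr) => //; exact: (cd_comp fr sf (db i.+1) (d i) (ce n)).
- rewrite (TopB fr) Top_comp Te.
  have -> : (e n + be n) \o d i = (e n \o d i) + (be n \o d i) by [].
  have [_ <-] := beP n.
  by rewrite opprD opprB addrCA [X in _ + X]addrCA subrr addr0 addrC.
apply/funext => p; rewrite -[RHS]/(k' n (d i.+1 p) - e n (d i (d i.+1 p))).
by rewrite dd (rlinear0 (ce n).1) subr0 -k'd.
Qed.


Lemma Top_sequence i (g : P i -> R) : cd i g -> exists l : nat -> P i -> R,
  [/\ forall n, cd i (l n), T (l 0%N) = g & forall n, T (l n.+1) = l n].
Proof.
move=> cg; have [inv invP] := Top_inverse i.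
pose l := fix l n := if n is k.+1 then inv (l k) else inv g.
have cl n : cd i (l n) by elim: n => [|n IHn]; apply: (invP _ _).1.
by exists l; split => // [|n]; apply: (invP _ _).2.
Qed.

Lemma connecting_exists i (f : P i.+1 -> S) : linear (f : P i.+1 -> S^o) ->
  (forall p, f (d i.+1 p) = 0) -> exists g, connecting f g.
Proof.
move=> lf f0; have [|n|l [cl Tl fl]] := @cocycle_acyclic i (fun n p => coef (f p) n).
- move=> n; split; first exact: (cd_coef fr sf).
  by move=> p; rewrite f0 (scoef0 sf).
- by rewrite (Top_coef fr sf).
by exists (T (l 0%N)), l; split => // n p; have /(congr1 (@^~ p)) := fl n.
Qed.

(** Subtracting the coefficients of [e] from the lifts of [g] gives cocycles; together with [g] they
    form a [T]-compatible sequence of cocycles, so [cocycle_limit] applies to its first term. *)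
Lemma connecting_boundary i (f : P i.+1 -> S) g (e : P i -> S) : connecting f g ->
  linear (e : P i -> S^o) -> (forall p, f p = e (d i p)) -> dual_boundary g.
Proof.
move=> [l [cl gE Tl fl]] le fE.
pose l' n := l n - (fun p => coef (e p) n).
have cl' n : dual_cocycle (l' n).
  split; first by apply: (cdB fr) => //; apply: (cd_coef fr sf).
  by move=> p; rewrite -[LHS]/(l n _ - coef (e _) n) -fE -fl subrr.
have Tl' n : T (l' n.+1) = l' n by rewrite (TopB fr) Tl (Top_coef fr sf).
have gE' : T (l' 0%N) = g by rewrite (TopB fr) gE (Top_coef fr sf) // subr0.
have cg : dual_cocycle g.
  split; first by rewrite -gE; apply: (cd_Top fr sf).
  move=> p; rewrite -gE' -[LHS]/((T (l' 0%N) \o d i) p) -Top_comp.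
  have -> : l' 0%N \o d i = 0 by apply/funext => q; apply: (cl' 0%N).2.
  by rewrite (Top0 fr).
apply: (@cocycle_limit i (fun n => if n is k.+1 then l' k else g) _ _ 0%N) => -[|n] //=.
  by rewrite gE' subrr; apply: boundary0.
by rewrite Tl' subrr; apply: boundary0.
Qed.

(** The second member matters only up to boundaries: a tower over a primitive of [b], composed with
    [d], lifts [b] and has zero coboundary, so it can be subtracted from [l]. *)
Lemma connecting_subl i (f : P i.+1 -> S) g b : connecting f g -> dual_boundary b ->
  connecting f (g - b).
Proof.
move=> [l [cl gE Tl fl]] bb.
suff [e [ce bE Te e0]] : exists e, [/\ forall n, cd i (e n), T (e 0%N) = b,
    forall n, T (e n.+1) = e n & forall n p, e n (d i p) = 0].
  exists (fun n => l n - e n); split => [n||n|n p]; first exact: (cdB fr).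
  - by rewrite (TopB fr) gE bE.
  - by rewrite (TopB fr) Tl Te.
  by rewrite fl -[RHS]/(l n _ - e n _) e0 subr0.
case: i f g b l bb {cl gE Tl fl} => [|i] f g b l /= bb.
  by exists (fun=> 0); split => // [n||n]; rewrite ?bb ?(Top0 fr) //; exact: (cd0 C coef fr _).
have [b' cb' ->] := bb; have [e [ce bE Te]] := Top_sequence cb'.
exists (fun n => e n \o d i); split => [n||n|n p].
- exact: (cd_comp fr sf (db i.+1) (d i) (ce n)).
- by rewrite Top_comp bE.
- by rewrite Top_comp Te.
by rewrite /= dd (rlinear0 (ce n).1).
Qed.

(** By [connecting_subl] one may take [g = 0]; the lifts then satisfy the hypotheses of
    [series_linear] and assemble to an S-linear primitive of [f]. *)
Lemma coboundary_connecting i (f : P i.+1 -> S) g : connecting f g -> dual_boundary g ->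
  exists2 e : P i -> S, linear (e : P i -> S^o) & forall p, f p = e (d i p).
Proof.
move=> fg bg; have [l [cl gE Tl fl]] := connecting_subl fg bg.
exists (fun p => series_of coef (fun n => l n p)).
  by apply: (series_linear cl) => //; rewrite gE subrr.
by move=> p; apply: (series_inj sf) => n; rewrite (coef_series_of sf).
Qed.

Lemma connecting_surjective i (g : P i -> R) : dual_cocycle g ->
  exists f : P i.+1 -> S, [/\ linear (f : P i.+1 -> S^o),
    forall p, f (d i.+1 p) = 0 & connecting f g].
Proof.
move=> [cg g0]; have [l [cl gE Tl]] := Top_sequence cg.
exists (fun p => series_of coef (fun n => (l n \o d i) p)); split.
- apply: (series_linear (dbN := db i.+1) (l := fun n => l n \o d i)) => [n||n].
  + exact: (cd_comp fr sf (db i.+1) (d i) (cl n)).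
  + by rewrite Top_comp gE; apply/funext.
  + by rewrite Top_comp Tl.
- move=> p; apply: (series_inj sf) => n.
  by rewrite (coef_series_of sf) /= dd (scoef0 sf) (rlinear0 (cl n).1).
by exists l; split => // n p; rewrite (coef_series_of sf).
Qed.

End FinitelyGenerated.

End Acyclicity.

(** * Vanishing of Hom into the power series ring *)

Section HomVanishing.
Variables (R S : pzRingType) (sigma sigma' delta : R -> R) (J : nat -> set R).
Variables (C : {rmorphism R -> S}) (t : S) (coef : S -> nat -> R).
Hypothesis fr : skew_frame sigma sigma' delta J.
Hypothesis sf : series_frame sigma sigma' delta J C t coef.

Lemma hom_series_eq0 (M : lmodType S) (f : {linear M -> S^o}) :
  noetherian_module (R^c)^o -> finitely_generated (resScalars C M) -> forall m, f m = 0.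
Proof.
move=> noethRc [r [e [_ egen]]].
have lf : linear (f : M -> S^o) by move=> a u v; apply: linearP.
pose F n p : R := coef (f p : S) n; pose tp (p : M) := t *: p.
have TF n : Top sigma' delta tp (F n) = if n is k.+1 then F k else 0.
  exact: (Top_coef fr sf _ lf).
suff F0 n : F n = 0.
  move=> m; apply: (series_inj sf) => n.
  by rewrite -[LHS]/(F n m) F0 (scoef0 sf).
apply: (limit_absorb fr (tp := tp) (Bd := fun g => g = 0)) => {n}.
- by [].
- by move=> g h -> ->; rewrite subrr.
- by move=> g b ->; apply: (theta0 fr).
(* [T] lowers the index of [F n] and kills [F 0], so [n.+1] iterations already give zero. *)
- move=> n k; exists n.+1 => i le p.
  have T0 j : iter j (Top sigma' delta tp) 0 = 0.
    by elim: j => //= j ->; apply: (Top0 fr).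
  have -> : iter i (Top sigma' delta tp) (F n) = 0.
    rewrite -(subnK le) iterD; suff -> : iter n.+1 (Top sigma' delta tp) (F n) = 0 by exact: T0.
    by elim: n {le} => [|n IHn]; rewrite iterSr TF //; exact: T0.
  exact: (lideal0 (frJl fr k)).
- by move=> n; rewrite TF subrr.
pose ev (g : M -> R) : 'rV[R^c]_r := \row_j g (e j).
have [b bP] := noetherian_seq (fun n => ev (F n)) (noetherian_rows noethRc (n := r)).
exists b => n; have [a aE] := bP n; exists a.
apply/eqP; rewrite subr_eq0; apply/eqP/funext => p; have [z ->] := egen p I.
have lF k : rlinear C (F k).
  by move=> a' u v; rewrite /F -[a' *: u]/(C a' *: (u : M)) lf (srD sf) (srC sf).
have Fsum k : F k (\sum_i z i *: e i : resScalars C M) = \sum_i z i * F k (e i).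
  by rewrite (rlinear_sum (lF k)); apply: eq_bigr => i _; rewrite (rlinearZ (lF k)).
rewrite Fsum; under [RHS]eq_bigr => l _ do rewrite Fsum mulr_suml.
rewrite exchange_big /=; apply: eq_bigr => i _.
under eq_bigr => l _ do rewrite -mulrA.
rewrite -mulr_sumr; congr (_ * _).
have := congr1 (fun w : 'rV[R^c]_r => w 0 i) aE.
by rewrite mxE summxE => ->; apply: eq_bigr => l _; rewrite !mxE.
Qed.

End HomVanishing.

Definition linear_coboundary (R : pzRingType) (N : lmodType R) (Q : projResolution N) k :
    (Q k -> R) -> Prop :=
  match k return (Q k -> R) -> Prop with
  | 0%N => fun h => forall q, h q = 0
  | k'.+1 => fun h => exists2 e : Q k' -> R, linear (e : Q k' -> R^o) &
      forall q, h q = e (pr_d Q k' q)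
  end.

(** * Comparison with Ext over R *)

Section ProjectiveComparison.
Variables (R : pzRingType) (N : lmodType R).
Local Unset Implicit Arguments.
Variables (m : nat -> nat) (D : forall i, 'M[R]_(m i.+1, m i)).
Variables (augA : 'rV[R]_(m 0%N) -> N) (Q : projResolution N).
Variables (a : forall i, 'rV[R]_(m i) -> Q i).

(** The discrete filtration makes every linear map continuous, so the cone lemmas specialise to the
    purely algebraic comparison. *)
Let triv (X : lmodType R) (n : nat) : set X := [set 0].

Let dQ i : Q i.+1 -> Q i := pr_d Q i.

Let row_d i (v : 'rV[R]_(m i.+1)) : 'rV[R]_(m i) := v *m D i.

Local Set Implicit Arguments.

Hypothesis surjA : forall x, exists v, augA v = x.
Hypothesis exA0 : forall v, augA v = 0 <-> exists w, v = w *m D 0%N.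
Hypothesis exA : forall i (v : 'rV[R]_(m i.+1)), v *m D i = 0 <-> exists w, v = w *m D i.+1.
Hypothesis la : forall i, linear (a i).
Hypothesis auga : forall v, pr_aug Q (a 0%N v) = augA v.
Hypothesis da : forall i v, pr_d Q i (a i.+1 v) = a i (v *m D i).

Let triv_filtration X : filtration (triv X).
Proof.
split=> [n|k n _ x //]; split => // b u v -> ->.
by rewrite scaler0 addr0.
Qed.

Let triv_lcont (X Y : lmodType R) (F : nat -> set X) (G : nat -> set Y) (g : X -> Y) :
  (forall n, F n `<=` [set 0]) -> (forall n, submodule (G n)) -> linear g -> lcont F G g.
Proof.
move=> F0 sG lg; split => // n; exists 0%N => x /F0 ->.
by rewrite (linear_zero lg); apply: (submod0 (sG n)).
Qed.

Let lrow_d i : lcont (triv _) (triv _) (row_d i).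
Proof.
apply: (triv_lcont (fun _ _ H => H)) => [n|]; first by have [] := triv_filtration 'rV[R]_(m i).
by move=> b u v; rewrite /row_d mulmxDl scalemxAl.
Qed.

Let ldQ i : lcont (triv _) (triv _) (dQ i).
Proof.
apply: (triv_lcont (fun _ _ H => H)) => [n|]; first by have [] := triv_filtration (Q i).
by move=> b u v; apply: linearP.
Qed.

Let lla i : lcont (triv _) (triv _) (a i).
Proof. by apply: (triv_lcont (fun _ _ H => H)) => [n|]; [have [] := triv_filtration (Q i)|exact: la]. Qed.

Local Notation coneX := (cone R (fun i => 'rV[R]_(m i)) Q).
Local Notation coneF := (cone_filt R (fun i => 'rV[R]_(m i)) Q (fun i => triv _) (fun i => triv _)).
Local Notation coned := (cone_d R (fun i => 'rV[R]_(m i)) Q row_d dQ a).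

Let cone_lift i (phi : coneX i -> coneX i) : lcont (coneF i) (coneF i) phi ->
  (forall x, exists y, coned i y = phi x) ->
  exists2 s : coneX i -> coneX i.+1, lcont (coneF i) (coneF i.+1) s &
    forall x, coned i (s x) = phi x.
Proof.
move=> [lphi _] im.
have filtF k : filtration (coneF k) by apply: cone_filtration.
have F0 k n : coneF k n `<=` [set 0].
  by case: k => [//|k] [x y] [/= -> ->].
have lcd := (cone_d_lcont (fun i => triv_filtration 'rV[R]_(m i))
  (fun i => triv_filtration (Q i)) lrow_d ldQ lla i).1.
suff [s ls sP] : exists2 s : coneX i -> coneX i.+1, linear s & forall x, coned i (s x) = phi x.
  by exists s => //; apply: triv_lcont => // n; have [] := filtF i.+1.
pose cL : {linear coneX i.+1 -> coneX i} :=
  HB.pack (coned i) (GRing.isLinear.Build _ _ _ _ (coned i) lcd).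
have [projQ _ _ _] := pr_proj Q.
(* A cone term is a product of a projective [Q k] and a free row module; the two components are
   lifted separately and added. *)
have liftQ k (g : Q k -> coneX i) : linear g -> (forall x, exists y, coned i y = g x) ->
    exists2 h : Q k -> coneX i.+1, linear h & forall x, coned i (h x) = g x.
  move=> lg img.
  pose gL : {linear Q k -> coneX i} := HB.pack g (GRing.isLinear.Build _ _ _ _ g lg).
  have [|h hP] := @projective_lift _ _ _ cL _ gL (projQ k); first exact: img.
  by exists h => //; move=> b u v; apply: linearP.
case: i phi lphi im filtF F0 lcd cL liftQ => [|i] phi lphi im filtF F0 lcd cL liftQ.
  exact: (liftQ 0%N).
have lin1 : linear (fun q : Q i.+1 => phi (q, 0)).
  by move=> b u v; rewrite -lphi; congr phi; congr pair; rewrite /= scaler0 addr0.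
have lin2 : linear (fun v : 'rV[R]_(m i) => phi (0, v)).
  by move=> b u v; rewrite -lphi; congr phi; congr pair; rewrite /= scaler0 addr0.
have [|h lh hP] := liftQ _ _ lin1; first by move=> x; apply: im.
have [|g lg gP] := row_lift lin2 lcd; first by move=> x; apply: im.
exists (fun x => h x.1 + g x.2).
  by move=> b u v; rewrite lh lg addrACA -scalerDr.
move=> x; rewrite (linear_add lcd) hP gP -(linear_add lphi); congr phi.
by case: x => u v; congr pair; rewrite /= ?addr0 ?add0r.
Qed.

Let laugQ : linear (pr_aug Q : Q 0%N -> N).
Proof. by move=> b u v; apply: linearP. Qed.

Lemma projective_comparison k (h : Q k -> R) : linear (h : Q k -> R^o) ->
  (forall q, h (pr_d Q k q) = 0) ->
  match k return (Q k -> R) -> Prop with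
  | 0%N => fun h => forall v, h (a 0%N v) = 0
  | k'.+1 => fun h => exists2 gamma : 'rV[R]_(m k') -> R^o, linear gamma &
      forall v, h (a k'.+1 v) = gamma (v *m D k')
  end h ->
  linear_coboundary h.
Proof.
have [projQ surjQ exQ0 exQ] := pr_proj Q.
have cR (X : lmodType R) (g : X -> R^o) : linear g -> lcont (triv X) (triv R^o) g.
  move=> lg; apply: (triv_lcont (fun _ _ H => H)); last exact: lg.
  by move=> n; exact: ((triv_filtration R^o).1 n).
case: k h => [|k] h lh h0 H.
  exact: (cone_inj0 (FB := fun i => triv (Q i)) (dB := dQ) (f := a) row_d laugQ surjA exQ0 auga (cR _ _ lh) h0 H).
have [gamma lg hE] := H.
have [e [le _] eP] := cone_injS (fun i => triv_filtration _) (fun i => triv_filtration _)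
  lrow_d ldQ lla laugQ surjA exA0 exQ0 exA exQ auga da cone_lift (triv_filtration _)
  (cR _ _ lh) (cR _ _ lg) h0 hE.
by exists e.
Qed.

End ProjectiveComparison.

Section Restriction.
Variables (R S : pzRingType) (sigma sigma' delta : R -> R) (J : nat -> set R).
Variables (C : {rmorphism R -> S}) (t : S) (coef : S -> nat -> R).
Hypothesis fr : skew_frame sigma sigma' delta J.
Hypothesis sf : series_frame sigma sigma' delta J C t coef.
Variables (M : lmodType S).
Local Unset Implicit Arguments.
Variables (P : nat -> lmodType S) (d : forall i, {linear P i.+1 -> P i}).
Variables (aug : {linear P 0%N -> M}) (db : forall i, dual_basis (P i)).
Local Set Implicit Arguments.
Hypothesis resP : is_projective_resolution d aug.
Hypothesis fgM : finitely_generated (resScalars C M).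
Hypothesis noethR : noetherian_module R^o.
Variables (Q : projResolution (resScalars C M)).
Variables (c : forall i, {linear Q i -> resScalars C (P i)}).
Hypothesis augc : forall q, aug (c 0%N q) = pr_aug Q q.
Hypothesis dc : forall i q, d i (c i.+1 q) = c i (pr_d Q i q).

Let resolve : exists m : nat -> nat, exists D : forall i, 'M[R]_(m i.+1, m i),
  exists augA : 'rV[R]_(m 0%N) -> resScalars C M, exists a : forall i, 'rV[R]_(m i) -> Q i,
  [/\ forall x, exists v, augA v = x,
      forall v, augA v = 0 <-> exists w, v = w *m D 0%N,
      forall i (v : 'rV[R]_(m i.+1)), v *m D i = 0 <-> exists w, v = w *m D i.+1,
      forall i, linear (a i) &
      (forall v, pr_aug Q (a 0%N v) = augA v) /\
      forall i v, pr_d Q i (a i.+1 v) = a i (v *m D i)].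
Proof.
have [m [D [augA [laugA surjA exA0 exA]]]] := free_resolution noethR fgM.
have [_ surjQ exQ0 exQ] := pr_proj Q.
have ldQ i : linear (pr_d Q i) by move=> b u v; apply: linearP.
have laugQ : linear (pr_aug Q) by move=> b u v; apply: linearP.
have [a [la auga da]] := free_chain_map laugA exA0 exA ldQ laugQ surjQ exQ0 exQ.
by exists m, D, augA, a.
Qed.

(** A finite free resolution maps to [Q] by [a] and to [P] by [c \o a]. A primitive of [g \o c] on
    [Q] pulls back along [a], and the comparison of [P] with the free resolution gives a continuous
    one on [P]. *)
Lemma restriction_injective k (g : P k -> R) :
  dual_cocycle J C coef d db g -> @linear_coboundary _ _ Q k (fun q => g (c k q)) ->
  dual_boundary J C coef d db g.
Proof.
have [m [D [augA [a [surjA exA0 exA la [auga da]]]]]] := resolve.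
pose c' i v := c i (a i v).
have lc' i : linear (c' i) by move=> b u v; rewrite /c' la linearP.
have augc' v : aug (c' 0%N v) = augA v by rewrite /c' augc auga.
have dc' i v : d i (c' i.+1 v) = c' i (v *m D i) by rewrite /c' dc da.
case: k g => [|k] g [cg g0] H.
  apply/funext => p.
  apply: (comparison_inj0 (db := db) D resP surjA augc' cg g0) => v.
  exact: H.
have [e le eE] := H.
have [| |g' cg' gE] := comparison_injS fr sf resP surjA exA0 exA lc' augc' dc'
  (gamma := fun v => e (a k v)) cg _ g0 _.
- by move=> b u v; rewrite la le.
- by move=> v; rewrite /c' eE da.
by exists g' => //; apply/funext.
Qed.

(** The comparison with [P] provides [g] for which [h] and [g \o c] agree on the free resolution up
    to a coboundary; the comparison with [Q] then makes their difference a coboundary on [Q]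
    itself. *)
Lemma restriction_surjective k (h : Q k -> R) : linear (h : Q k -> R^o) ->
  (forall q, h (pr_d Q k q) = 0) ->
  exists2 g : P k -> R, dual_cocycle J C coef d db g &
    linear_coboundary (fun q => h q - g (c k q)).
Proof.
move=> lh h0.
have [m [D [augA [a [surjA exA0 exA la [auga da]]]]]] := resolve.
pose c' i v := c i (a i v).
have lc' i : linear (c' i) by move=> b u v; rewrite /c' la linearP.
have augc' v : aug (c' 0%N v) = augA v by rewrite /c' augc auga.
have dc' i v : d i (c' i.+1 v) = c' i (v *m D i) by rewrite /c' dc da.
have [| |g cg [g0 H]] := comparison_surj fr sf db resP surjA exA0 exA lc' augc' dc'
  (alpha := fun v => h (a k v)) _ _.
- by move=> b u v; rewrite la lh.
- by move=> v; rewrite -da h0.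
have [lg _] := cg.
exists g => //; apply: (projective_comparison surjA exA0 exA la auga da).
- move=> b u v; rewrite linearP lh.
  have -> : g (b *: c k u + c k v) = b * g (c k u) + g (c k v) by apply: lg.
  by rewrite scalerBr opprD addrACA.
- by move=> q; rewrite h0 -dc g0 subrr.
case: k h lh h0 g cg g0 H lg => [|k] h lh h0 g cg g0 H lg.
  by move=> v; rewrite H subrr.
by have [gamma lgam hE] := H; exists gamma => // v; rewrite hE addrC addKr.
Qed.

End Restriction.

(** Lets a homomorphism on classes be given by a relation between representatives, such as
    [connecting], whose lifts are not canonical. The equivalence in the conclusion recovers the
    relation from an equality of classes. *)
Lemma additive_relation (V W X Y : zmodType) (p : V -> X) (q : W -> Y) (r : V -> W -> Prop) :
  {morph p : u v / u - v} -> {morph q : u v / u - v} ->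
  (forall x, exists v, x = p v) ->
  (forall v, exists w, r v w) ->
  (forall v v' w w', r v w -> r v' w' -> r (v - v') (w - w')) ->
  (forall v w, r v w -> p v = 0 -> q w = 0) ->
  (forall v w w', r v w -> q w' = 0 -> r v (w - w')) ->
  exists Phi : {additive X -> Y}, forall v w, Phi (p v) = q w <-> r v w.
Proof.
move=> pB qB surjp total rB r0 rsub.
have /choice [s sP] := surjp; have /choice [h hP] := total.
pose Phi x := q (h (s x)).
have sub0 (Z : zmodType) (z z' : Z) : z - z' = 0 -> z = z'.
  by move/eqP; rewrite subr_eq0 => /eqP.
have PhiP v w : r v w -> Phi (p v) = q w.
  move=> rvw; apply: sub0; rewrite -qB.
  by apply: (r0 (s (p v) - v)); [apply: rB | rewrite pB -sP subrr].
have PhiB : {morph Phi : x y / x - y}.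
  by move=> x y; rewrite {1}(sP x) {1}(sP y) -pB (PhiP _ _ (rB _ _ _ _ (hP (s x)) (hP (s y)))) qB.
pose PhiL : {additive X -> Y} := HB.pack Phi (GRing.isZmodMorphism.Build _ _ Phi PhiB).
exists PhiL => v w; split=> [E|]; last exact: PhiP.
have rv := hP v; rewrite -[w](subKr (h v)); apply: rsub => //.
by rewrite qB -(PhiP _ _ rv) -E -[PhiL _]/(Phi _) subrr.
Qed.

Lemma additive_bijective (X Y : zmodType) (f : {additive X -> Y}) :
  (forall x, f x = 0 -> x = 0) -> (forall y, exists x, f x = y) -> bijective f.
Proof.
move=> f0 /choice [g gP]; exists g => // x.
apply/eqP; rewrite -subr_eq0; apply/eqP/f0.
by rewrite raddfB gP subrr.
Qed.

(** * Cohomology classes *)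

Section CohomologyClass.
Variables (X : nat -> Type) (d : forall i, X i.+1 -> X i).
Variables (G : zmodType) (D : forall i, zmodClosed (X i -> G)).
Local Notation class := (@cohomology_class X d G D _).

Lemma cohomology_classB i : {morph @cohomology_class X d G D i : f g / f - g}.
Proof. by move=> f g; rewrite /cohomology_class raddfB. Qed.

Lemma cohomology_class_surjective i (x : cohomology d D i) : exists f, x = class f.
Proof. by exists (repr x); rewrite /cohomology_class reprK. Qed.

Lemma cohomology_class_eq0 i (f : cocycles d D i) :
  class f = 0 <-> coboundary_fun d D (f : X i -> G).
Proof.
have -> : (0 : cohomology d D i) = class 0 by rewrite /cohomology_class raddf0.
split=> [/eqP|H].
  by rewrite /cohomology_class -Quotient.idealrBE subr0 => /asboolP.
apply/eqP; rewrite /cohomology_class -Quotient.idealrBE subr0.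
exact/asboolP.
Qed.

Lemma cocycles_intro i (f : X i -> G) : f \in D i -> (forall x, f (d x) = 0) ->
  exists g : cocycles d D i, cocycle_fun g = f.
Proof.
move=> Df f0; have cf : f \in @cocycle X d G D i by apply/andP; split => //; apply/asboolP.
by exists (Cocycles cf).
Qed.

Lemma cocyclesP i (f : cocycles d D i) : (f : X i -> G) \in D i /\ forall x, f (d x) = 0.
Proof. by case: f => f /= /andP [Df /asboolP]. Qed.

End CohomologyClass.

Definition resolution_basis (S : uniformRing) (M : lmodType S) (P : pcResolution M) i :
    dual_basis (P i) :=
  sval (cid (projective_dual_basis
    (let: And4 projP _ _ _ := pcr_proj P in projP i) (pcr_fg P i))).

(** * The connecting isomorphism on Ext groups, its linearity and naturality *)

Section Connecting.
Variables (R : uniformRing) (sigma : {rmorphism R -> R}) (sigma' : R -> R).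
Variables (delta : {additive R -> R}).
Variables (S : uniformRing) (C : {rmorphism R -> S}) (t : S) (coef : S -> nat -> R).
Hypotheses (pcR : left_pseudocompact_ring R) (noethR : noetherian_ring R).
Hypothesis hS : skew_power_series sigma delta C t coef.
Hypothesis fr : skew_frame sigma sigma' delta (@Rpow R).

Let sf := series pcR noethR hS fr.

Definition connects (M : lmodType S) (P : pcResolution M) i (f : P i.+1 -> S) (g : P i -> R) :=
  @connecting R S sigma' delta (@Rpow R) C t coef (fun k => P k) (pcr_d P) (resolution_basis P) i f g.

Section Resolution.
Variables (M : lmodType S) (P : pcResolution M).
Local Notation ES i := (Ext_cocycles (pc_projResolution P) S^o i).
Local Notation EP i := (ExtPM_cocycles C P i).
Local Notation cocycle := (@dual_cocycle R S (@Rpow R) C coef (fun k => P k) (pcr_d P) (resolution_basis P) _).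
Local Notation boundary := (@dual_boundary R S (@Rpow R) C coef (fun k => P k) (pcr_d P) (resolution_basis P) _).

Let cochainP i (f : P i -> R) : f \in @cont_hom R S C (P i) <->
  continuous_dual (@Rpow R) C coef (resolution_basis P i) f.
Proof. exact: (cont_homP pcR noethR fr sf (nbhs_ball pcR hS) _ (pcr_pc P i)). Qed.

Lemma ExtS_cocycleP i (f : ES i) : linear (f : P i -> S^o) /\ forall p, f (pcr_d P i p) = 0.
Proof. by have [/asboolP lf f0] := cocyclesP f. Qed.

Lemma ExtPM_cocycleP i (g : EP i) : cocycle (g : P i -> R).
Proof. by have [/cochainP cg g0] := cocyclesP g. Qed.

Lemma ExtPM_cocycle_intro i (g : P i -> R) : cocycle g -> exists g' : EP i, (g' : P i -> R) = g.
Proof. by move=> [/cochainP cg g0]; apply: cocycles_intro. Qed.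

Lemma ExtS_class_eq0 i (f : ES i.+1) : Ext_class f = 0 <->
  exists2 e : P i -> S, linear (e : P i -> S^o) & forall p, f p = e (pcr_d P i p).
Proof.
split=> [/cohomology_class_eq0 [e /asboolP le eE]|[e le eE]]; first by exists e.
by apply/cohomology_class_eq0; exists e => //; apply/asboolP.
Qed.

Lemma ExtPM_class_eq0 i (g : EP i) : ExtPM_class g = 0 <-> boundary (g : P i -> R).
Proof.
split=> [/cohomology_class_eq0|bg].
  case: i g => [|i] g /=; first by move=> g0; apply/funext.
  by move=> [e /cochainP ce eE]; exists e => //; apply/funext.
apply/cohomology_class_eq0; case: i g bg => [|i] g /=; first by move=> ->.
by move=> [e /cochainP ce ->]; exists e.
Qed.

Hypothesis fgM : finitely_generated (resScalars C M).

Lemma connecting_map i : exists Phi : {additive ExtS P i.+1 -> ExtPM C P i},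
  forall (f : ES i.+1) (g : EP i), Phi (Ext_class f) = ExtPM_class g <-> connects f g.
Proof.
apply: additive_relation.
- exact: cohomology_classB.
- exact: cohomology_classB.
- exact: cohomology_class_surjective.
- move=> f; have [lf f0] := ExtS_cocycleP f.
  have [g fg] := connecting_exists fr sf (resolution_basis P) (pcr_proj P) fgM
    noethR.1 noethR.2 lf f0.
  have [g' g'E] := ExtPM_cocycle_intro (connecting_cocycle fr sf lf fg).
  by exists g'; rewrite /connects g'E.
- by move=> f f' g g' fg fg'; apply: (connectingB fr sf fg fg').
- move=> f g fg /ExtS_class_eq0 [e le eE]; apply/ExtPM_class_eq0.
  exact: (connecting_boundary fr sf (pcr_proj P) fgM noethR.1 noethR.2 fg le eE).
move=> f g b fg /ExtPM_class_eq0 bb.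
exact: (connecting_subl fr sf (pcr_proj P) fg bb).
Qed.

Variables (i : nat) (Phi : {additive ExtS P i.+1 -> ExtPM C P i}).
Hypothesis PhiP : forall (f : ES i.+1) (g : EP i),
  Phi (Ext_class f) = ExtPM_class g <-> connects f g.

Lemma connecting_map_bijective : bijective Phi.
Proof.
apply: additive_bijective => [x|y].
  have [f ->] := cohomology_class_surjective x.
  have [g gE] := cohomology_class_surjective (Phi (Ext_class f)).
  move=> Phi0; have g0 : ExtPM_class g = 0 by rewrite /ExtPM_class -gE.
  apply/ExtS_class_eq0.
  exact: (coboundary_connecting fr sf (pcr_proj P) ((PhiP _ _).1 gE) ((ExtPM_class_eq0 _).1 g0)).
have [g ->] := cohomology_class_surjective y.
have [f [lf f0 fg]] := connecting_surjective fr sf (pcr_proj P) (ExtPM_cocycleP g).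
have [||f' f'E] := @cocycles_intro _ (@pr_d S M (pc_projResolution P)) _
   (Ext_cochains (pc_projResolution P) S^o) i.+1 f.
- exact/asboolP.
- exact: f0.
by exists (Ext_class f'); apply/PhiP; rewrite /connects f'E.
Qed.

Lemma connecting_map_linear : right_S_linear sigma' delta t Phi.
Proof.
move=> x f f' g f'E /PhiP fg; have [lf _] := ExtS_cocycleP f.
have fgx := connecting_mulr fr sf x lf fg.
have lfx : linear ((fun p => f p * x) : P i.+1 -> S^o).
  by move=> a u v; rewrite /= lf mulrDl -mulrA.
have cgx := @connecting_cocycle R S sigma sigma' delta (@Rpow R) C t coef fr sf (fun k => P k)
  (pcr_d P) (resolution_basis P) i _ _ lfx fgx.
have [g' g'E] := ExtPM_cocycle_intro cgx.
exists g'; last first.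
  have f'x : (f' : P i.+1 -> S) = (fun p => f p * x) by apply/funext.
  by apply/PhiP; rewrite /connects g'E f'x.
exists (right_coef sigma' delta (@Rpow R) coef x) => [|p].
  exact: ((series_cvg pcR noethR hS _ _).2 (right_expansion_cvg fr sf x)).
rewrite g'E; apply: ((Rpow_cvg pcR noethR _ _).2 _) => n.
apply: (SumP fr); apply: (theta_null fr).
by apply: (cd_vanishing fr sf (db := resolution_basis P i)); have [] := ExtPM_cocycleP g.
Qed.

End Resolution.

Lemma ExtPM_restricts (M : lmodType S) (P : pcResolution M) i :
  finitely_generated (resScalars C M) -> restricts_to_Ext C P i.
Proof.
move=> fgM Q c augc dc.
have EQP k (f : Ext_cocycles Q R^o k) : linear (f : Q k -> R^o) /\ forall q, f (pr_d Q k q) = 0.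
  by have [/asboolP lf f0] := cocyclesP f.
have EQ0 k (f : Ext_cocycles Q R^o k) : Ext_class f = 0 <-> linear_coboundary (f : Q k -> R).
  split=> [/cohomology_class_eq0|H]; first case: k f => [//|k] f.
    by move=> [e /asboolP le eE]; exists e.
  apply/cohomology_class_eq0; case: k f H => [//|k] f [e le eE].
  by exists e => //; apply/asboolP.
(* Agreement only up to a coboundary on [Q], as the last condition of [additive_relation]
   requires. *)
pose r (g : ExtPM_cocycles C P i) (h : Ext_cocycles Q R^o i) :=
  linear_coboundary (fun q => h q - g (c i q)).
have lcB k (h h' : Q k -> R) : linear_coboundary h -> linear_coboundary h' ->
    linear_coboundary (fun q => h q - h' q).
  case: k h h' => [|k] h h' /=; first by move=> h0 h'0 q; rewrite h0 h'0 subrr.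
  move=> [e le eE] [e' le' eE']; exists (e - e'); first exact: linear_sub.
  by move=> q; rewrite eE eE'.
have pull (g : ExtPM_cocycles C P i) : exists h : Ext_cocycles Q R^o i, forall q, h q = g (c i q).
  have [[lg _] g0] := ExtPM_cocycleP g.
  have [||h hE] := @cocycles_intro _ (@pr_d R _ Q) _ (Ext_cochains Q R^o) i (fun q => g (c i q)).
  - apply/asboolP => a u v; rewrite linearP; exact: lg.
  - by move=> q; rewrite -dc g0.
  by exists h => q; rewrite hE.
have lc0 k : linear_coboundary (fun _ : Q k => 0 : R).
  case: k => [//|k]; exists (fun=> 0) => //.
  by move=> a u v; rewrite scaler0 addr0.
have rP (g : ExtPM_cocycles C P i) (h : Ext_cocycles Q R^o i) : (forall q, h q = g (c i q)) -> r g h.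
  move=> hE; have := lc0 i; congr linear_coboundary.
  by apply/funext => q; rewrite hE subrr.
have lcE k (h h' : Q k -> R) : linear_coboundary h -> (forall q, h q = h' q) ->
    linear_coboundary h'.
  by move=> lh hE; rewrite -(funext hE).
have [k kP] : exists k : {additive ExtPM C P i -> Ext Q R^o i},
    forall (g : ExtPM_cocycles C P i) (h : Ext_cocycles Q R^o i), k (ExtPM_class g) = Ext_class h <-> r g h.
  apply: additive_relation.
  - exact: cohomology_classB.
  - exact: cohomology_classB.
  - exact: cohomology_class_surjective.
  - by move=> g; have [h hE] := pull g; exists h; apply: rP.
  - move=> g g' h h' gh gh'; apply: lcE (lcB _ _ _ gh gh') _ => q.
    rewrite -[RHS]/(h q - h' q - (g (c i q) - g' (c i q))) !opprB addrACA [RHS]addrACA.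
    by rewrite [X in _ + X = _]addrC.
  - move=> g h gh /(ExtPM_class_eq0) bg; apply/EQ0.
    suff H : linear_coboundary (fun q => - g (c i q)).
      by apply: lcE (lcB _ _ _ gh H) _ => q; rewrite opprK subrK.
    case: (i) c dc g bg {gh r pull rP h augc} => [|k] c dc g /= bg.
      by move=> q; rewrite bg oppr0.
    have [e [le _] eE] := bg.
    exists (fun q => - e (c k q)) => [a u v|q]; last by rewrite eE /= dc.
    rewrite linearP; have -> : e (a *: c k u + c k v) = a * e (c k u) + e (c k v) by exact: le.
    by rewrite opprD scalerN.
  by move=> g h h' gh /EQ0 bh'; apply: lcE (lcB _ _ _ gh bh') _ => q; rewrite addrAC.
exists k; last by move=> g h hE; apply/kP/rP.
apply: additive_bijective => [x|y].
  have [g ->] := cohomology_class_surjective x.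
  have [h hE] := pull g; have /kP kg := rP _ _ hE.
  rewrite -/(ExtPM_class g) kg => /EQ0 bh; apply/ExtPM_class_eq0.
  apply: (restriction_injective fr sf (pcr_proj P) fgM noethR.1 augc dc (ExtPM_cocycleP g)).
  exact: lcE bh hE.
have [h ->] := cohomology_class_surjective y; have [lh h0] := EQP _ h.
have [g cg hg] := restriction_surjective fr sf (resolution_basis P) (pcr_proj P) fgM
  noethR.1 augc dc lh h0.
have [g' g'E] := ExtPM_cocycle_intro cg.
by exists (ExtPM_class g'); apply/kP; rewrite /r g'E.
Qed.

Lemma connects_comp (M M' : lmodType S) (P : pcResolution M) (P' : pcResolution M')
    (c : forall i, {linear P i -> P' i}) i (f : P' i.+1 -> S) (g : P' i -> R) :
  (forall p, pcr_d P' i (c i.+1 p) = c i (pcr_d P i p)) ->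
  connects f g -> connects (P := P) (f \o c i.+1) (g \o c i).
Proof.
move=> dc [l [cl gE Tl fl]]; exists (fun n => l n \o c i); split => [n||n|n p].
- exact: (cd_comp fr sf (resolution_basis P i) (c i) (cl n)).
- by rewrite Top_comp gE.
- by rewrite Top_comp Tl.
by rewrite /= fl dc.
Qed.

End Connecting.

Theorem proposition3p1
    (R : uniformRing) (sigma : {rmorphism R -> R}) (sigma' : R -> R)
    (delta : {additive R -> R})
    (S : uniformRing) (C : {rmorphism R -> S}) (t : S) (coef : S -> nat -> R)
    (pcR : left_pseudocompact_ring R) (noethR : noetherian_ring R)
    (sigmaK : cancel sigma sigma') (sigmaK' : cancel sigma' sigma)
    (csigma : continuous sigma) (csigma' : continuous sigma')
    (cdelta : continuous delta) (derdelta : left_derivation sigma delta)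
    (nildelta : sigma_nilpotent sigma sigma' delta)
    (hS : skew_power_series sigma delta C t coef)
    (noethS : noetherian_ring S) :
  (forall M : lmodType S, finitely_generated (resScalars C M) ->
     forall f : {linear M -> S^o}, forall m, f m = 0) /\
  exists Phi : forall (M : lmodType S) (P : pcResolution M) (i : nat),
      {additive ExtS P i.+1 -> ExtPM C P i},
    (forall (M : lmodType S) (P : pcResolution M) (i : nat),
       finitely_generated (resScalars C M) ->
       [/\ bijective (Phi M P i),
           right_S_linear sigma' delta t (Phi M P i) &
           restricts_to_Ext C P i]) /\
    (forall (M M' : lmodType S) (P : pcResolution M) (P' : pcResolution M')
       (h : {linear M -> M'}) (c : forall i, {linear P i -> P' i}) (i : nat),
       finitely_generated (resScalars C M) ->
       finitely_generated (resScalars C M') ->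
       @chain_map_over S M M' h
         (pc_projResolution P) (pc_projResolution P') c ->
       forall (f : Ext_cocycles (pc_projResolution P) S^o i.+1)
         (f' : Ext_cocycles (pc_projResolution P') S^o i.+1)
         (g : ExtPM_cocycles C P i) (g' : ExtPM_cocycles C P' i),
         (forall p, f p = f' (c i.+1 p)) -> (forall p, g p = g' (c i p)) ->
         Phi M' P' i (Ext_class f') = ExtPM_class g' ->
         Phi M P i (Ext_class f) = ExtPM_class g).
Proof.
have fr := frame pcR noethR sigmaK sigmaK' csigma csigma' cdelta derdelta nildelta.
have sf := series pcR noethR hS fr.
split; first by move=> M fgM f; apply: (hom_series_eq0 fr sf f noethR.2 fgM).
(* The family must be defined for every [M]; the zero map is the value when [M] is not finitely
   generated over [R]. Keeping the characterisation by [connects] makes naturality independent of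
   all choices, since that relation is stable under chain maps. *)
have exPhi (M : lmodType S) (P : pcResolution M) i :
    exists Phi : {additive ExtS P i.+1 -> ExtPM C P i},
    finitely_generated (resScalars C M) -> forall f g,
    Phi (Ext_class f) = ExtPM_class g <-> connects sigma' delta C t coef f g.
  have [fgM|nfg] := pselect (finitely_generated (resScalars C M)); last by exists \0.
  by have [Phi PhiP] := connecting_map pcR noethR hS fr P fgM i; exists Phi.
pose Phi M P i := sval (cid (exPhi M P i)).
have PhiP M P i : finitely_generated (resScalars C M) -> forall f g,
    Phi M P i (Ext_class f) = ExtPM_class g <-> connects sigma' delta C t coef f g.
  exact: (svalP (cid (exPhi M P i))).
exists Phi; split=> [M P i fgM|M M' P P' h c i fgM fgM' [_ dc] f f' g g' fE gE].
  split; first exact: (connecting_map_bijective pcR noethR hS fr (PhiP M P i fgM)).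
    exact: (connecting_map_linear pcR noethR hS fr (PhiP M P i fgM)).
  exact: (ExtPM_restricts pcR noethR hS fr).
move=> /(PhiP M' P' i fgM') fg'; apply/(PhiP M P i fgM).
have -> : (f : P i.+1 -> S) = (f' : P' i.+1 -> S) \o c i.+1 by apply/funext.
have -> : (g : P i -> R) = (g' : P' i -> R) \o c i by apply/funext.
exact: (@connects_comp _ _ _ _ _ _ _ _ pcR noethR hS fr M M' P P' c i _ _ (dc i) fg').
Qed.
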